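(* Let $A$ be a locally $C^*$-algebra and let $\{E_n\}_n$ be a countable family of Hilbert $A$-modules. Let $$\text{str.-}\bigoplus_n M(E_n)=\Big\{(t_n)_n:\ t_n\in M(E_n)\ \text{and}\ \sum_n t_n^*\circ t_n\ \text{converges strictly in}\ M(A)\Big\},$$ a vector space with coordinatewise operations. Then $\text{str.-}\bigoplus_n M(E_n)$ is a Hilbert $M(A)$-module with the module action defined by $(t_n)_n\cdot b=(t_n\cdot b)_n$, $b\in M(A)$, and the $M(A)$-valued inner product defined by $$\langle (t_n)_n,(s_n)_n\rangle_{M(A)}=\text{str.-}\lim_n\sum_{k=1}^n t_k^*\circ s_k ,$$ where str.-lim denotes the limit in the strict topology of $M(A)$. Moreover, the Hilbert $M(A)$-modules $\text{str.-}\bigoplus_n M(E_n)$ and $M\big(\bigoplus_n E_n\big)$ are unitarily equivalent.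
   Context: A locally $C^*$-algebra is a complete Hausdorff complex topological $*$-algebra $A$ whose topology is determined by its continuous $C^*$-seminorms; $S(A)$ is the set of all continuous $C^*$-seminorms on $A$. For $p\in S(A)$, $A_p=A/\ker p$ is a $C^*$-algebra with the norm induced by $p$. A pre-Hilbert $A$-module is a complex vector space $E$ which is a right $A$-module (compatibly with the complex algebra structure), with an $A$-valued inner product $\langle\cdot,\cdot\rangle:E\times E\to A$ which is $\mathbb C$- and $A$-linear in the second variable, with $\langle\xi,\eta\rangle^*=\langle\eta,\xi\rangle$, $\langle\xi,\xi\rangle\ge 0$, and $\langle\xi,\xi\rangle=0$ iff $\xi=0$. It is a Hilbert $A$-module if it is complete for the topology given by the seminorms $\overline p_E(\xi)=\sqrt{p(\langle\xi,\xi\rangle)}$, $p\in S(A)$. $A$ is a Hilbert $A$-module with $\langle a,b\rangle=a^*b$. For $p\in S(A)$, $E_p=E/\ker\overline p_E$ is a Hilbert $A_p$-module with the induced operations; $\sigma_p^E:E\to E_p$ is the quotient map. An $A$-module morphism $T:E\to F$ between Hilbert $A$-modules is adjointable if there is an $A$-module morphism $T^*:F\to E$ with $\langle T\xi,\eta\rangle=\langle\xi,T^*\eta\rangle$ for all $\xi\in E,\eta\in F$. $L_A(E,F)$ is the set of all such morphisms, with the topology given by the seminorms $\widetilde p_{L_A(E,F)}(T)=\|T_p\|$, $p\in S(A)$, where $T_p\in L_{A_p}(E_p,F_p)$ is the induced operator $T_p(\sigma_p^E(\xi))=\sigma_p^F(T\xi)$; $L_A(E)=L_A(E,E)$, which is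 a locally $C^*$-algebra. Hilbert $A$-modules $E,F$ are unitarily equivalent if there is $U\in L_A(E,F)$ with $U^*U=\mathrm{id}_E$ and $UU^*=\mathrm{id}_F$. The multiplier algebra $M(A)$ is identified with the locally $C^*$-algebra $L_A(A)$. The multiplier module of a Hilbert $A$-module $E$ is $M(E)=L_A(A,E)$, a Hilbert $M(A)$-module with action $t\cdot m=t\circ m$ and inner product $\langle s,t\rangle_{M(A)}=s^*\circ t$. The strict topology on $M(E)$ is the one generated by the seminorms $\|t\|_{p,a,\xi}=\overline p_E(t(a))+p(t^*(\xi))$, $(p,a,\xi)\in S(A)\times A\times E$; the strict topology on $M(A)$ is the case $E=A$. A series converges strictly if its sequence of partial sums does. $\bigoplus_n E_n$ is the Hilbert $A$-module of all sequences $(\xi_n)_n$ with $\xi_n\in E_n$ such that $\sum_n\langle\xi_n,\xi_n\rangle$ converges in $A$, with action $(\xi_n)_n a=(\xi_n a)_n$ and inner product $\langle(\xi_n)_n,(\eta_n)_n\rangle=\sum_n\langle\xi_n,\eta_n\rangle$. *)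

(* Defs.v *)
From HB Require Import structures.
From mathcomp Require Import all_boot all_order all_algebra.
From mathcomp Require Import complex.
From mathcomp Require Import boolp classical_sets functions reals.
From mathcomp Require Import topology normedtype sequences.

Set Implicit Arguments.
Unset Strict Implicit.
Unset Printing Implicit Defensive.

Import Order.TTheory GRing.Theory Num.Theory.
Import numFieldNormedType.Exports.

Local Open Scope classical_set_scope.
Local Open Scope ring_scope.

Declare Scope staralg_scope.
Reserved Notation "a ** b" (at level 40, left associativity).

(* Complex *-algebras.  No unit is assumed, which is why the MathComp ring
   structures (all of them unital) are not used. *)
HB.mixin Record isStarAlgebra (R : realType) A & GRing.Lmodule R[i] A := {
  amul : A -> A -> A;
  star : A -> A;
  amulA : associative amul;
  amulDl : forall a b c, amul (a + b) c = amul a c + amul b c;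
  amulDr : forall a b c, amul a (b + c) = amul a b + amul a c;
  amulZl : forall (z : R[i]) a b, amul (z *: a) b = z *: amul a b;
  amulZr : forall (z : R[i]) a b, amul a (z *: b) = z *: amul a b;
  starK : involutive star;
  starD : forall a b, star (a + b) = star a + star b;
  starZ : forall (z : R[i]) a, star (z *: a) = (Num.conj z) *: star a;
  starM : forall a b, star (amul a b) = amul (star b) (star a)
}.

#[short(type="starAlgType")]
HB.structure Definition StarAlgebra (R : realType) :=
  {A of isStarAlgebra R A & GRing.Lmodule R[i] A}.

Notation "a ** b" := (amul a b) : staralg_scope.
Local Open Scope staralg_scope.

(* A *-algebra and a topology, with no compatibility between the two. *)
#[short(type="preTopStarAlgType")]
HB.structure Definition PreTopStarAlgebra (R : realType) :=
  {A of StarAlgebra R A & Topological A}.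

Section seminorms.
Variables (R : realType).

(* Convergence, Cauchy filters and completeness for the (linear) topology
   generated by a family P of seminorms; D is the carrier. *)
Definition seminorm_cvg (V : lmodType R[i]) (P : set (V -> R))
    (F : set_system V) (x : V) : Prop :=
  forall p, P p -> (fun y => p (y - x)) @ F --> (0 : R).

Definition seminorm_cauchy (V : lmodType R[i]) (P : set (V -> R))
    (F : set_system V) : Prop :=
  forall p, P p ->
    (fun z : V * V => p (z.1 - z.2)) @ (filter_prod F F) --> (0 : R).

Definition seminorm_complete (V : lmodType R[i]) (P : set (V -> R))
    (D : set V) : Prop :=
  forall F : set_system V, ProperFilter F -> F D -> seminorm_cauchy P F ->
    exists2 x, D x & seminorm_cvg P F x.

Definition is_cstar_seminorm (A : starAlgType R) (p : A -> R) : Prop :=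
  [/\ forall a b, p (a + b) <= p a + p b,
      forall (z : R[i]) a, p (z *: a) = complex.Re `|z| * p a,
      forall a b, p (a ** b) <= p a * p b,
      forall a, p (star a) = p a
    & forall a, p (star a ** a) = p a ^+ 2].

(* S(A) *)
Definition cstar_seminorms (A : preTopStarAlgType R) : set (A -> R) :=
  [set p | is_cstar_seminorm p /\ continuous p].

Definition positive (A : starAlgType R) (a : A) : Prop :=
  exists b : A, a = star b ** b.

End seminorms.
Arguments cstar_seminorms {R} A _.

(* Completeness is that of the uniform structure of the additive group A. *)
HB.mixin Record isLocallyCstar (R : realType) A
    & PreTopStarAlgebra R A & TopologicalLmodule R[i] A := {
  amul_continuous : continuous (fun z : A * A => amul z.1 z.2);
  star_continuous : continuous (@star R A);
  locCstar_hausdorff : hausdorff_space A;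
  locCstar_complete : forall F : set_system A, ProperFilter F ->
    (fun z : A * A => z.1 - z.2) @ (filter_prod F F) --> (0 : A) ->
    exists x : A, F --> x;
  locCstar_topology : forall (F : set_system A) (x : A), Filter F ->
    seminorm_cvg (cstar_seminorms A) F x -> F --> x
}.

#[short(type="locCstarType")]
HB.structure Definition LocallyCstar (R : realType) :=
  {A of isLocallyCstar R A & PreTopStarAlgebra R A & TopologicalLmodule R[i] A}.

(* The data of an inner product B-module.  Its carrier is a subset car of an
   ambient vector space amb; act and ip are only meaningful on car.  A module
   whose underlying set is a whole type has car = setT.  For the direct sums
   below it is then part of the assertion "is a Hilbert module" that the
   carrier is stable under the operations. *)
Record ipModule (R : realType) (B : preTopStarAlgType R) := IPModule {
  amb : lmodType R[i];
  car : set amb;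
  act : amb -> B -> amb;
  ip : amb -> amb -> B
}.
Arguments amb {R B} i.
Arguments car {R B} i _.
Arguments act {R B i} _ _.
Arguments ip {R B i} _ _.

Section hilbert_modules.
Variables (R : realType) (B : preTopStarAlgType R).
Implicit Types E F : ipModule B.

Record pre_hilbert_module E : Prop := {
  car0 : car E 0;
  carD : forall x y, car E x -> car E y -> car E (x + y);
  carZ : forall (z : R[i]) x, car E x -> car E (z *: x);
  car_act : forall x b, car E x -> car E (act x b);
  actDl : forall x y b, car E x -> car E y -> act (x + y) b = act x b + act y b;
  actDr : forall x b c, car E x -> act x (b + c) = act x b + act x c;
  actA : forall x b c, car E x -> act x (b ** c) = act (act x b) c;
  actZl : forall (z : R[i]) x b, car E x -> act (z *: x) b = z *: act x b;
  actZr : forall (z : R[i]) x b, car E x -> act x (z *: b) = z *: act x b;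
  ipDr : forall x y y', car E x -> car E y -> car E y' ->
    ip x (y + y') = ip x y + ip x y';
  ipZr : forall (z : R[i]) x y, car E x -> car E y -> ip x (z *: y) = z *: ip x y;
  ip_act : forall x y b, car E x -> car E y -> ip x (act y b) = ip x y ** b;
  ip_star : forall x y, car E x -> car E y -> star (ip x y) = ip y x;
  ip_ge0 : forall x, car E x -> positive (ip x x);
  ip_eq0 : forall x, car E x -> (ip x x = 0 <-> x = 0)
}.

Unset Implicit Arguments.

Definition mod_seminorm E (p : B -> R) (x : amb E) : R := Num.sqrt (p (ip x x)).

Definition mod_seminorms E : set (amb E -> R) :=
  [set mod_seminorm E p | p in cstar_seminorms B].

Definition hilbert_module E : Prop :=
  pre_hilbert_module E /\ seminorm_complete (mod_seminorms E) (car E).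

Record module_morphism E F (T : amb E -> amb F) : Prop := {
  mor_car : forall x, car E x -> car F (T x);
  morD : forall x y, car E x -> car E y -> T (x + y) = T x + T y;
  morZ : forall (z : R[i]) x, car E x -> T (z *: x) = z *: T x;
  mor_act : forall x b, car E x -> T (act x b) = act (T x) b
}.

Definition is_adjoint E F (T : amb E -> amb F) (S : amb F -> amb E) : Prop :=
  forall x y, car E x -> car F y -> ip (T x) y = ip x (S y).

Definition adjointable E F (T : amb E -> amb F) : Prop :=
  module_morphism E F T /\
  exists S : amb F -> amb E, module_morphism F E S /\ is_adjoint E F T S.

(* T^*, read off pointwise: T^* y is the element x' of E such that
   <T x, y> = <x, x'> for all x in E. *)
Definition adj E F (T : amb E -> amb F) (y : amb F) : amb E :=
  xget 0 [set x' | car E x' /\ forall x, car E x -> ip (T x) y = ip x x'].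

(* ||T_p||.  The norm of sigma_p(x) in E_p is mod_seminorm p x, hence this is
   the supremum of ||T_p v|| over the v of norm at most 1 in E_p. *)
Definition op_seminorm E F (p : B -> R) (T : amb E -> amb F) : R :=
  sup [set mod_seminorm F p (T x)
       | x in [set x | car E x /\ mod_seminorm E p x <= 1]].

Definition unitarily_equivalent E F : Prop :=
  exists U : amb E -> amb F,
    [/\ adjointable E F U,
        forall x, car E x -> adj E F U (U x) = x
      & forall y, car F y -> U (adj E F U y) = y].

Definition self_module : ipModule B :=
  @IPModule R B B setT (fun a b => a ** b) (fun a b => star a ** b).

End hilbert_modules.

Set Implicit Arguments.

Arguments mod_seminorm {R B} E p x.
Arguments mod_seminorms {R B} E _.
Arguments hilbert_module {R B} E.
Arguments module_morphism {R B} E F T.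
Arguments is_adjoint {R B} E F T S.
Arguments adjointable {R B} E F T.
Arguments adj {R B} E F T y.
Arguments op_seminorm {R B} E F p T.
Arguments unitarily_equivalent {R B} E F.
Arguments self_module {R} B.

Section multiplier_algebra.
Variables (R : realType) (A : locCstarType R).
Local Notation SA := (self_module A).
Implicit Types (S T : A -> A).

Definition multiplier_pred : {pred A -> A} :=
  fun T => `[< adjointable SA SA T >].

(* M(A) = L_A(A) *)
Record multiplier := Multiplier {
  mulfun :> A -> A;
  mulfunP : mulfun \in multiplier_pred
}.

HB.instance Definition _ := [isSub for mulfun].
HB.instance Definition _ := [Choice of multiplier by <:].


Lemma cstar_seminorm0 (p : A -> R) : is_cstar_seminorm p -> p 0 = 0.
Proof. by case=> _ pZ _ _ _; rewrite -(scale0r 0) pZ normr0 mul0r. Qed.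

Lemma cstar_seminorms_sep (a : A) :
  (forall p, cstar_seminorms A p -> p a = 0) -> a = 0.
Proof.
move=> pa0; apply: (@locCstar_hausdorff R A) => U V Ua V0.
have : globally [set a] --> (0 : A).
  apply: locCstar_topology => p Sp W W0 x /= ->.
  by rewrite subr0 pa0//; exact: nbhs_singleton.
move=> /(_ V V0)/(_ a erefl) Va.
by exists a; split => //; exact: nbhs_singleton.
Qed.

Lemma star_amul_eq0 (a : A) : star a ** a = 0 -> a = 0.
Proof.
move=> aa0; apply: cstar_seminorms_sep => p [Sp _].
case: (Sp) => _ _ _ _ /(_ a); rewrite aa0 cstar_seminorm0// => /esym/eqP.
by rewrite expf_eq0 => /andP[_ /eqP].
Qed.

Lemma amul_inj (a b : A) : (forall c, star c ** a = star c ** b) -> a = b.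
Proof.
move=> ab; apply/eqP; rewrite -subr_eq0; apply/eqP/star_amul_eq0.
by rewrite -scaleN1r amulDr amulZr !scaleN1r ab subrr.
Qed.

Lemma adj_unique T S : is_adjoint SA SA T S -> adj SA SA T = S.
Proof.
move=> TS; apply/funext => y; apply: xget_subset1.
  by split => // x xA; apply: TS.
move=> u v [_ uP] [_ vP]; apply: amul_inj => c.
by rewrite -[LHS]uP// -[RHS]vP.
Qed.

Lemma adjP T : adjointable SA SA T ->
  module_morphism SA SA (adj SA SA T) /\ is_adjoint SA SA T (adj SA SA T).
Proof. by move=> [_ [S [mS TS]]]; rewrite (adj_unique TS). Qed.

Lemma multiplierP (m : multiplier) : adjointable SA SA m.
Proof. exact: (asboolW (mulfunP m)). Qed.

Lemma star0 : star (0 : A) = 0.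
Proof. by rewrite -(scale0r (0 : A)) starZ rmorph0 !scale0r. Qed.

Lemma amul0 (a : A) : a ** 0 = 0.
Proof. by rewrite -(scale0r (0 : A)) amulZr !scale0r. Qed.

Lemma zero_amul (a : A) : 0 ** a = 0.
Proof. by rewrite -(scale0r (0 : A)) amulZl !scale0r. Qed.

Lemma zero_morphism : module_morphism SA SA 0.
Proof.
by split => //= *; rewrite /GRing.zero/= ?addr0 ?scaler0 ?zero_amul.
Qed.

Lemma linear_morphism (z : R[i]) S T :
  module_morphism SA SA S -> module_morphism SA SA T ->
  module_morphism SA SA (z *: S + T).
Proof.
move=> [_ SD SZ Sa] [_ TD TZ Ta]; split => //= [x y _ _|w x _|x b _].
- by rewrite /= !fctE SD// TD// scalerDr addrACA.
- by rewrite !fctE SZ// TZ// scalerDr !scalerA mulrC.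
- by rewrite !fctE Sa// Ta// amulDl amulZl.
Qed.

Lemma comp_morphism S T : module_morphism SA SA S -> module_morphism SA SA T ->
  module_morphism SA SA (S \o T).
Proof.
move=> [_ SD SZ Sa] [_ TD TZ Ta]; split => //= [x y _ _|w x _|x b _].
- by rewrite TD// SD.
- by rewrite TZ// SZ.
- by rewrite Ta// Sa.
Qed.

Lemma linear_adjoint (z : R[i]) S S' T T' :
  is_adjoint SA SA S S' -> is_adjoint SA SA T T' ->
  is_adjoint SA SA (z *: S + T) (Num.conj z *: S' + T').
Proof.
move=> aS aT x y _ _ /=; rewrite !fctE starD starZ amulDl amulDr amulZl amulZr.
by congr (_ *: _ + _); [exact: aS|exact: aT].
Qed.

Lemma comp_adjoint S S' T T' :
  is_adjoint SA SA S S' -> is_adjoint SA SA T T' ->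
  is_adjoint SA SA (S \o T) (T' \o S').
Proof. by move=> aS aT x y _ _ /=; rewrite [LHS]aS// [LHS]aT. Qed.

Lemma adjoint_sym S T : is_adjoint SA SA S T -> is_adjoint SA SA T S.
Proof.
move=> aST x y _ _ /=; rewrite -[in LHS](starK y) -starM.
by rewrite -[star y ** T x]aST// starM starK.
Qed.

Lemma zero_adjoint : is_adjoint SA SA 0 0.
Proof. by move=> x y _ _ /=; rewrite amul0 star0 zero_amul. Qed.

Lemma multiplier_submod_closed : submod_closed multiplier_pred.
Proof.
split; first by apply/asboolP; split; [|exists 0; split];
  by [exact: zero_morphism|exact: zero_adjoint].
move=> z S T /asboolP[mS [S' [mS' aS]]] /asboolP[mT [T' [mT' aT]]].
apply/asboolP; split; first exact: linear_morphism.
exists (Num.conj z *: S' + T'); split; first exact: linear_morphism.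
exact: linear_adjoint.
Qed.

HB.instance Definition _ :=
  GRing.isSubmodClosed.Build _ _ multiplier_pred multiplier_submod_closed.
HB.instance Definition _ := [SubChoice_isSubLmodule of multiplier by <:].

Lemma multiplier_comp_subproof (m n : multiplier) :
  (m \o n : A -> A) \in multiplier_pred.
Proof.
have [mm [m' [mm' am]]] := multiplierP m.
have [mn [n' [mn' an]]] := multiplierP n.
apply/asboolP; split; first exact: comp_morphism.
by exists (n' \o m'); split; [exact: comp_morphism|exact: comp_adjoint].
Qed.

Lemma multiplier_adj_subproof (m : multiplier) :
  adj SA SA m \in multiplier_pred.
Proof.
have [mm' am] := adjP (multiplierP m); have [mm _] := multiplierP m.
apply/asboolP; split => //; exists m; split => //; exact: adjoint_sym.
Qed.

Definition multiplier_mul (m n : multiplier) : multiplier :=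
  Multiplier (multiplier_comp_subproof m n).

Definition multiplier_star (m : multiplier) : multiplier :=
  Multiplier (multiplier_adj_subproof m).

Let is_adj (m : multiplier) : is_adjoint SA SA m (multiplier_star m).
Proof. exact: (adjP (multiplierP m)).2. Qed.

Let mul_assoc : associative multiplier_mul.
Proof. by move=> m n k; apply/val_inj. Qed.

Let mul_Dl (m n k : multiplier) :
  multiplier_mul (m + n) k = multiplier_mul m k + multiplier_mul n k.
Proof. exact/val_inj. Qed.

Let mul_Dr (m n k : multiplier) :
  multiplier_mul m (n + k) = multiplier_mul m n + multiplier_mul m k.
Proof.
have [[_ mD _ _] _] := multiplierP m.
by apply/val_inj/funext => a /=; rewrite fctE mD.
Qed.

Let mul_Zl (z : R[i]) (m n : multiplier) :
  multiplier_mul (z *: m) n = z *: multiplier_mul m n.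
Proof. exact/val_inj. Qed.

Let mul_Zr (z : R[i]) (m n : multiplier) :
  multiplier_mul m (z *: n) = z *: multiplier_mul m n.
Proof.
have [[_ _ mZ _] _] := multiplierP m.
by apply/val_inj/funext => a /=; rewrite fctE mZ.
Qed.

Let star_K : involutive multiplier_star.
Proof.
by move=> m; apply/val_inj/adj_unique/adjoint_sym/is_adj.
Qed.

Let star_D (m n : multiplier) :
  multiplier_star (m + n) = multiplier_star m + multiplier_star n.
Proof.
apply/val_inj/adj_unique; have := linear_adjoint 1 (is_adj m) (is_adj n).
by rewrite conjC1 !scale1r.
Qed.

Let star_Z (z : R[i]) (m : multiplier) :
  multiplier_star (z *: m) = Num.conj z *: multiplier_star m.
Proof.
apply/val_inj/adj_unique.
by have := linear_adjoint z (is_adj m) zero_adjoint; rewrite !addr0.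
Qed.

Let star_M (m n : multiplier) :
  multiplier_star (multiplier_mul m n) =
  multiplier_mul (multiplier_star n) (multiplier_star m).
Proof. by apply/val_inj/adj_unique/comp_adjoint; exact: is_adj. Qed.

HB.instance Definition _ := @isStarAlgebra.Build R multiplier
  multiplier_mul multiplier_star mul_assoc mul_Dl mul_Dr mul_Zl mul_Zr
  star_K star_D star_Z star_M.

HB.instance Definition _ := isPointed.Build multiplier 0.

(* Subbase: the open balls {t | ||(t - s)_p|| < e}, indexed by (p, s, e). *)
HB.instance Definition _ := @isSubBaseTopological.Build multiplier
  ((A -> R) * multiplier * R : pointedType)%type
  [set i | cstar_seminorms A i.1.1 /\ 0 < i.2]
  (fun i => [set t : multiplier |
     op_seminorm SA SA i.1.1 (t - i.1.2 : multiplier) < i.2]).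

End multiplier_algebra.

Section multiplier_modules.
Variables (R : realType) (A : locCstarType R).
Local Notation SA := (self_module A).
Local Notation M := (multiplier A).
Implicit Types E : ipModule A.

(* M(E) = L_A(A, E); the value of the inner product is the element s^* o t of
   M(A) when s and t are adjointable (and 0 otherwise). *)
Definition multiplier_module E : ipModule M :=
  @IPModule R M (A -> amb E)
    [set t | adjointable SA E t]
    (fun t b => t \o b)
    (fun s t => insubd (0 : M) (adj SA E s \o t)).

Definition strict_seminorms E : set ((A -> amb E) -> R) :=
  [set q | exists p a x, [/\ cstar_seminorms A p, car E x &
     q = fun t => mod_seminorm E p (t a) + p (adj SA E t x)]].

Arguments strict_seminorms E _ : clear implicits.

Definition strict_cvg (u : nat -> M) (l : M) : Prop :=
  seminorm_cvg (strict_seminorms SA) ((fun n => u n : A -> A) @ \oo) l.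

End multiplier_modules.
Arguments strict_seminorms {R A} E _.

Section sequences_of_vectors.
Variables (K : pzRingType) (V : nat -> lmodType K).

Definition vseq := forall n, V n.

HB.instance Definition _ := Choice.on vseq.

Let add (x y : vseq) : vseq := fun n => x n + y n.
Let opp (x : vseq) : vseq := fun n => - x n.
Let zero : vseq := fun=> 0.
Let scale (z : K) (x : vseq) : vseq := fun n => z *: x n.

Let addA : associative add.
Proof. by move=> x y z; apply: functional_extensionality_dep => n; exact: addrA. Qed.
Let addC : commutative add.
Proof. by move=> x y; apply: functional_extensionality_dep => n; exact: addrC. Qed.
Let add0 : left_id zero add.
Proof. by move=> x; apply: functional_extensionality_dep => n; exact: add0r. Qed.
Let addN : left_inverse zero opp add.
Proof. by move=> x; apply: functional_extensionality_dep => n; exact: addNr. Qed.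

HB.instance Definition _ := GRing.isZmodule.Build vseq addA addC add0 addN.

Let scaleA (a b : K) (x : vseq) : scale a (scale b x) = scale (a * b) x.
Proof. by apply: functional_extensionality_dep => n; exact: scalerA. Qed.
Let scale1 : left_id 1 scale.
Proof. by move=> x; apply: functional_extensionality_dep => n; exact: scale1r. Qed.
Let scaleDr : right_distributive scale +%R.
Proof. by move=> z x y; apply: functional_extensionality_dep => n; exact: scalerDr. Qed.
Let scaleDl (x : vseq) : {morph (scale^~ x) : a b / a + b}.
Proof. by move=> a b; apply: functional_extensionality_dep => n; exact: scalerDl. Qed.

HB.instance Definition _ :=
  GRing.Zmodule_isLmodule.Build K vseq scaleA scale1 scaleDr scaleDl.

End sequences_of_vectors.

Section direct_sums.
Variables (R : realType) (A : locCstarType R).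
Local Notation M := (multiplier A).
Variable E : nat -> ipModule A.

Definition direct_sum : ipModule A :=
  @IPModule R A (vseq (fun n => amb (E n)))
    [set x | (forall n, car (E n) (x n)) /\
             exists l : A, series (fun n => ip (x n) (x n)) @ \oo --> l]
    (fun x a n => act (x n) a)
    (fun x y => xget 0 [set l : A | series (fun n => ip (x n) (y n)) @ \oo --> l]).

Local Notation ME n := (multiplier_module (E n)).

Definition strict_direct_sum : ipModule M :=
  @IPModule R M (vseq (fun n => amb (ME n)))
    [set t | (forall n, car (ME n) (t n)) /\
             exists l : M, strict_cvg (series (fun n => @ip _ _ (ME n) (t n) (t n))) l]
    (fun t b n => @act _ _ (ME n) (t n) b)
    (fun t s =>
       xget 0 [set l : M | strict_cvg (series (fun n => @ip _ _ (ME n) (t n) (s n))) l]).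

End direct_sums.

(* Main.v *)
(* In a complete algebra whose elements may be unbounded over the seminorms, a
   self-adjoint h is positive when, for each seminorm q, q (N - h) <= N for some
   N. Then (1 + h)^-1 is the limit, for all q at once, of polynomials in h, and
   with r = (1 + h)^-1 the element r h r is bounded by 2 for every q; its square
   root yields that of h, since h = ((1 + h) sqrt (r h r))^2. Applied to h^2 this
   gives |h|, and Kaplansky's argument gives that x* x is positive.

   An adjointable T : A -> A is bounded for each p: as T (x b) = (T x) b, a
   p-bounded x may be replaced by x (1 + x* x)^-1, which is bounded for every
   seminorm, and on such elements uniform boundedness holds. It follows that
   M(D) is a Hilbert M(A)-module for every Hilbert A-module D.

   With D the direct sum of the E_n, (t_n)_n |-> (a |-> (t_n a)_n) is a bijection
   from the strict direct sum of the M(E_n) to M(D) preserving all the structure.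
   The strict convergence of the partial sums u_n of t_k^* s_k to l = t^* s is
   obtained by pairing w = (u_n - l) a with itself: w^* w is a tail of the series
   defining <t w, s a>, so p(w)^2 <= |t| p(w) |(s_k a)_(k >= n)|. *)

Require Import Defs.
From HB Require Import structures.
From mathcomp Require Import all_boot all_order all_algebra.
From mathcomp Require Import finmap complex ring lra.
From Stdlib Require Ncring Ncring_tac.
From mathcomp Require Import boolp classical_sets functions reals.
From mathcomp Require Import topology normedtype sequences.

Set Implicit Arguments.
Unset Strict Implicit.
Unset Printing Implicit Defensive.

Import Order.TTheory GRing.Theory Num.Theory.
Import numFieldNormedType.Exports.

Local Open Scope classical_set_scope.
Local Open Scope ring_scope.

(** The obstacle is that elements need not be bounded over all seminorms, while the quotient by a
    single seminorm is not known here to be complete; so neither spectrum nor functional calculus is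
    at hand. This imposes two levels. For one fixed seminorm, square roots are only approximate:
    polynomials in h whose square is within e of h, and the order inequalities are proved up to such
    errors. Exact roots and inverses are limits in the whole algebra, which requires estimates in
    every seminorm.

    The order theory cannot be bypassed, because a positive element is by definition of the form b*
    b: positivity of a sum of inner products already needs roots in A, and positivity of t* t, for t
    in M(E), needs roots in M(A). Hence the theory is developed for an abstract family of seminorms
    and applied to both algebras. Moreover completeness of a module over M(A) refers to all
    continuous C*-seminorms of M(A), not just to those induced by S(A); each of them has to be
    controlled by finitely many induced ones. *)

Section ncring.
Variable U : pzRingType.

(** The algebras below are not commutative; these instances make the normaliser for noncommutative
    rings available on them. *)
#[export] Instance pzRing_ncring_ops :
  @Ncring.Ring_ops U 0 1 +%R *%R (fun x y => x - y) -%R eq := {}.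

#[export] Instance pzRing_ncring :
  @Ncring.Ring U 0 1 +%R *%R (fun x y => x - y) -%R eq pzRing_ncring_ops.
Proof.
split => //=; try (by move=> ? ? -> ? ? ->); try (by move=> ? ? ->).
- exact: RelationClasses.eq_equivalence.
- exact: add0r.
- exact: addrC.
- exact: addrA.
- exact: mul1r.
- exact: mulr1.
- exact: mulrA.
- exact: mulrDl.
- by move=> *; exact: mulrDr.
- exact: subrr.
Qed.
End ncring.

Ltac ncring := Ncring_tac.non_commutative_ring.

(** * The scalar iteration behind square roots *)

Section sqrt_iteration_real.
Variable R : realType.

(** The case x = 1 of [sqrt_iter] below. It increases to 1 and dominates the iteration in every
    seminorm with [q x <= 1]. *)
Fixpoint sqrt_iter1 n : R :=
  if n is m.+1 then 2^-1 * (1 + sqrt_iter1 m * sqrt_iter1 m) else 0.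

Lemma sqrt_iter1_itv n : 0 <= sqrt_iter1 n <= 1.
Proof. by elim: n => [|n /andP[h0 h1]] /=; [rewrite lexx ler01|nra]. Qed.

(** With d = 1 - y the recursion is d -> d (1 - d/2), so 1/d grows by at least 1/2 at each step,
    starting from 1. *)
Lemma sqrt_iter1_rate n : (1 - sqrt_iter1 n) * n.+2%:R <= 2.
Proof.
elim: n => [|n IHn] /=; first by rewrite subr0 mul1r.
have /andP[h0 h1] := sqrt_iter1_itv n.
have n0 : 0 <= n%:R :> R by [].
have e2 : n.+2%:R = n%:R + 2 :> R by rewrite -addn2 natrD.
have e3 : n.+3%:R = n%:R + 3 :> R by rewrite -addn3 natrD.
move: IHn; rewrite e2 e3 {e2 e3}.
move: (sqrt_iter1 n) (n%:R) h0 h1 n0 => y m h0 h1 m0 IHn.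
pose d := 1 - y; have hd : d * (m + 2) <= 2 by rewrite /d; nra.
have -> : 1 - 2^-1 * (1 + y * y) = d * (1 - d / 2) by rewrite /d; field.
have d0 : 0 <= d by rewrite subr_ge0.
have d1 : d <= 1 by rewrite /d; lra.
have : (2 - d * (m + 2)) * (m + 1) >= 0 by rewrite mulr_ge0//; lra.
have : 0 <= d * d by rewrite mulr_ge0.
nra.
Qed.

Lemma sqrt_iter1_cvg (e : R) : 0 < e -> exists n, forall m, (n <= m)%N ->
  1 - sqrt_iter1 m <= e.
Proof.
move=> e0; exists (Num.truncn (2 / e)).+1 => m nm.
have h := sqrt_iter1_rate m.
have m2 : 0 < m.+2%:R :> R by [].
have : 2 / e < m.+2%:R.
  apply: lt_le_trans (truncnS_gt _) _; rewrite ler_nat.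
  by rewrite (leq_trans nm)// -addn2 leq_addr.
rewrite ltr_pdivrMr// => h2.
rewrite -(ler_pM2r m2); apply: le_trans h _; lra.
Qed.

Lemma le_eps (a b C : R) : 0 < C -> (forall e, 0 < e -> e <= 1 -> a <= b + C * e) -> a <= b.
Proof.
move=> C0 h; apply/ler_addgt0Pr => e e0.
have := h (Num.min 1 (e / C)); rewrite lt_min ltr01 divr_gt0// => /(_ isT).
rewrite ge_min lexx => /(_ isT) /le_trans; apply.
rewrite lerD2l; apply: (@le_trans _ _ (C * (e / C))).
  by rewrite ler_pM2l// ge_min lexx orbT.
by rewrite mulrC divfK// gt_eqF.
Qed.

End sqrt_iteration_real.

(** * Unital algebras with a C*-seminorm *)

Section cstar_seminorm.
Variables (R : realType) (U : algType R) (st : U -> U).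

(* U is a unital complex *-algebra seen as a real algebra; the imaginary unit
   is only used to write y = a + ib and to multiply c + id by its adjoint. *)
Record star_axioms : Prop := {
  stK : involutive st;
  stD : forall a b, st (a + b) = st a + st b;
  stZ : forall (r : R) a, st (r *: a) = r *: st a;
  stM : forall a b, st (a * b) = st b * st a;
  st_re_im : forall y, exists a b, [/\ st a = a, st b = b &
    st y * y + y * st y = a * a + b * b]
}.

(** [q_pyth] is the germ of the order theory: adding a commuting square does not make a square
    smaller in norm. The monotonicity of [q] on positive elements is derived from it. *)
Record cstar_seminorm (q : U -> R) : Prop := {
  qD : forall a b, q (a + b) <= q a + q b;
  qZ : forall (r : R) a, q (r *: a) = `|r| * q a;
  qM : forall a b, q (a * b) <= q a * q b;
  qst : forall a, q (st a) = q a;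
  qC : forall a, q (st a * a) = q a * q a;
  q_pyth : forall c d, st c = c -> st d = d -> GRing.comm c d ->
    q c * q c <= q (c * c + d * d)
}.

Hypothesis hst : star_axioms.

Lemma st0 : st 0 = 0.
Proof. by rewrite -(scale0r 0) (stZ hst) !scale0r. Qed.

Lemma stN a : st (- a) = - st a.
Proof. by rewrite -scaleN1r (stZ hst) scaleN1r. Qed.

Lemma stB a b : st (a - b) = st a - st b.
Proof. by rewrite (stD hst) stN. Qed.

Lemma st1 : st 1 = 1.
Proof.
have := stM hst (st 1) 1; rewrite mulr1 (stK hst) => h.
by rewrite [RHS]h mulr1.
Qed.

Lemma stA r : st r%:A = r%:A.
Proof. by rewrite (stZ hst) st1. Qed.

Lemma commrZ (a b : U) (r : R) : GRing.comm a b -> GRing.comm a (r *: b).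
Proof. by rewrite /GRing.comm => ab; rewrite -scalerAr -scalerAl ab. Qed.

Lemma commrA (a : U) (r : R) : GRing.comm a r%:A.
Proof. exact/commrZ/commr1. Qed.

(** A fixed point y satisfies (1 - y)^2 = 1 - x, so 1 - y is a root of 1 - x. The iterates are
    polynomials in x with nonnegative coefficients, which is why the scalar case x = 1 bounds
    them. *)
Fixpoint sqrt_iter (x : U) n : U :=
  if n is m.+1 then 2^-1 *: (x + sqrt_iter x m * sqrt_iter x m) else 0.

Lemma sqrt_iter_sa x n : st x = x -> st (sqrt_iter x n) = sqrt_iter x n.
Proof.
by move=> sx; elim: n => [|n IHn] /=; rewrite ?st0// (stZ hst) (stD hst) (stM hst) IHn sx.
Qed.

Lemma sqrt_iter_comm c x n : GRing.comm c x -> GRing.comm c (sqrt_iter x n).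
Proof.
move=> cx; elim: n => [|n IHn] /=; first exact: commr0.
by apply/commrZ/commrD => //; exact: commrM.
Qed.

Lemma sqrt_iterE x n : (1 - sqrt_iter x n) * (1 - sqrt_iter x n) - (1 - x) =
  2 *: (sqrt_iter x n.+1 - sqrt_iter x n).
Proof.
rewrite /= scalerBr scalerA mulfV ?pnatr_eq0// scale1r.
by rewrite scaler_nat mulr2n; ncring.
Qed.

Section one_seminorm.
Variable q : U -> R.
Hypothesis hq : cstar_seminorm q.

Lemma q0 : q 0 = 0.
Proof. by rewrite -(scale0r 0) (qZ hq) normr0 mul0r. Qed.

Lemma qN a : q (- a) = q a.
Proof. by rewrite -scaleN1r (qZ hq) normrN1 mul1r. Qed.

Lemma qB a b : q (a - b) <= q a + q b.
Proof. by rewrite -(qN b) (qD hq). Qed.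

Lemma q_distC a b : q (a - b) = q (b - a).
Proof. by rewrite -qN opprB. Qed.

Lemma q_ge0 a : 0 <= q a.
Proof. by have := qB a a; rewrite subrr q0; lra. Qed.

Lemma q1 : q 1 <= 1.
Proof.
have := qC hq 1; rewrite st1 mulr1.
have := q_ge0 1; nra.
Qed.

Lemma qA r : q r%:A <= `|r|.
Proof. by rewrite (qZ hq) ler_piMr// q1. Qed.

Lemma q_sa a : st a = a -> q (a * a) = q a * q a.
Proof. by move=> sa; rewrite -(qC hq) sa. Qed.

Lemma q_near a b e : q (a - b) <= e -> q a <= q b + e.
Proof. by move=> ab; rewrite -(subrK b a) addrC (le_trans (qD hq _ _))// lerD. Qed.

Lemma qM_le a b (x y : R) : q a <= x -> q b <= y -> q (a * b) <= x * y.
Proof. by move=> ax by_; apply: le_trans (qM hq _ _) _; rewrite ler_pM// q_ge0. Qed.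

Lemma q_sqrt_iter x n : q x <= 1 -> q (sqrt_iter x n) <= sqrt_iter1 R n.
Proof.
move=> qx; elim: n => [|n IHn] /=; first by rewrite q0.
rewrite (qZ hq) ger0_norm ?invr_ge0// ler_wpM2l ?invr_ge0//.
by rewrite (le_trans (qD hq _ _))// lerD// qM_le.
Qed.

(** The iterates commute, so a^2 - b^2 = (a - b)(a + b), and each increment is dominated by the
    scalar increment. The scalar increments telescope. *)
Lemma q_sqrt_iter_step x n : q x <= 1 ->
  q (sqrt_iter x n.+1 - sqrt_iter x n) <= sqrt_iter1 R n.+1 - sqrt_iter1 R n.
Proof.
move=> qx; elim: n => [|n IHn].
  rewrite /= !mul0r !addr0 !subr0 (qZ hq) ger0_norm ?invr_ge0//.
  by rewrite ler_wpM2l ?invr_ge0.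
have c : GRing.comm (sqrt_iter x n.+1) (sqrt_iter x n).
  by apply: sqrt_iter_comm; apply/commr_sym/sqrt_iter_comm.
move: c IHn (q_sqrt_iter n qx) (q_sqrt_iter n.+1 qx).
have eU m : sqrt_iter x m.+1 = 2^-1 *: (x + sqrt_iter x m * sqrt_iter x m) by [].
have eR m : sqrt_iter1 R m.+1 =
  2^-1 * (1 + sqrt_iter1 R m * sqrt_iter1 R m) by [].
rewrite (eU n.+1) (eR n.+1) [X in _ -> _ -> _ -> _ -> q (_ - X) <= _]eU.
rewrite [X in _ -> _ -> _ -> _ -> _ <= _ - X]eR.
move: (sqrt_iter x n.+1) (sqrt_iter1 R n.+1) => a u.
move: (sqrt_iter x n) (sqrt_iter1 R n) => b v c IHn hb ha.
rewrite -scalerBr opprD addrACA subrr add0r (qZ hq) ger0_norm ?invr_ge0//.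
have -> : a * a - b * b = (a - b) * (a + b).
  by rewrite mulrDr !mulrBl c addrA subrK.
have -> : 2^-1 * (1 + u * u) - 2^-1 * (1 + v * v) = 2^-1 * ((u - v) * (u + v)).
  by ring.
by rewrite ler_wpM2l ?invr_ge0// qM_le// (le_trans (qD hq _ _))// lerD.
Qed.

Lemma q_sqrt_iter_dist x m n : (m <= n)%N -> q x <= 1 ->
  q (sqrt_iter x n - sqrt_iter x m) <= 1 - sqrt_iter1 R m.
Proof.
move=> mn qx; apply: (@le_trans _ _ (sqrt_iter1 R n - sqrt_iter1 R m)); last first.
  by have /andP[_ ?] := sqrt_iter1_itv R n; rewrite lerD2r.
elim: n mn => [|n IHn]; first by rewrite leqn0 => /eqP ->; rewrite !subrr q0.
rewrite leq_eqVlt => /predU1P[->|]; first by rewrite !subrr q0.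
rewrite ltnS => /IHn h.
rewrite -(subrKA (sqrt_iter x n)) (le_trans (qD hq _ _))//.
by rewrite (le_trans (lerD (q_sqrt_iter_step n qx) h))// addrA subrK.
Qed.

(** For a single seminorm no limit is available; a polynomial in x that is a root up to e replaces
    the exact root, and it still commutes with whatever commutes with x. *)
Lemma approx_sqrt x e : 0 < e -> st x = x -> q x <= 1 ->
  exists2 y, [/\ st y = y, forall c, GRing.comm c x -> GRing.comm c y & q y <= 1]
    & q ((1 - y) * (1 - y) - (1 - x)) <= e.
Proof.
move=> e0 sx qx; have [n hn] := @sqrt_iter1_cvg R (e / 2) ltac:(lra).
exists (sqrt_iter x n).
  split; [exact: sqrt_iter_sa|by move=> c; exact: sqrt_iter_comm|].
  by apply: le_trans (q_sqrt_iter n qx) _; have /andP[] := sqrt_iter1_itv R n.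
rewrite sqrt_iterE (qZ hq) ger0_norm//.
have := @q_sqrt_iter_dist x n n.+1 (leqnSn _) qx; have := hn n (leqnn _); lra.
Qed.

Lemma q_pyth1 c d e : 0 <= e -> st c = c -> st d = d -> GRing.comm c d ->
  q (c * c + d * d) <= 1 + e -> q (c * c) <= 1 + e.
Proof. by move=> e0 sc sd cd; rewrite (q_sa sc); apply: le_trans (q_pyth hq sc sd cd). Qed.

(** Let s be an approximate root of 1 - a^2. Then s^2 + a^2 is close to 1, the Pythagorean
    inequality bounds s^2, and s^2 is close to 1 - a^2. *)
Lemma q_one_sub_sqr a : st a = a -> q a <= 1 -> q (1 - a * a) <= 1.
Proof.
move=> sa qa; apply: (@le_eps _ _ _ 2) => // e e0 e1.
have saa : st (a * a) = a * a by rewrite (stM hst) sa.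
have qaa : q (a * a) <= 1 by rewrite q_sa// mulr_ile1// q_ge0.
have [y [sy cy _] hy] := approx_sqrt e0 saa qaa.
have ss : st (1 - y) = 1 - y by rewrite stB st1 sy.
have cs : GRing.comm (1 - y) a.
  apply/commr_sym/commrB; first exact: commr1.
  by apply: cy; exact: commrM.
have h : q ((1 - y) * (1 - y)) <= 1 + e.
  apply: (q_pyth1 (ltW e0) ss sa cs).
  rewrite -[X in q X](subrK 1) addrC (le_trans (qD hq _ _))//.
  apply: lerD; first exact: q1.
  apply: le_trans hy.
  by rewrite opprB addrA addrAC.
have : q ((1 - a * a) - (1 - y) * (1 - y)) <= e by rewrite q_distC.
by move/q_near; lra.
Qed.

End one_seminorm.
End cstar_seminorm.

Lemma le_of_sqr (R : realType) (x y : R) : 0 <= y -> x * x <= y * y -> x <= y.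
Proof. by move=> y0 xy; rewrite leNgt; apply/negP => h; nra. Qed.

(** * Positivity with respect to one seminorm *)

Section positive_for_a_seminorm.
Variables (R : realType) (U : algType R) (st : U -> U) (q : U -> R).
Hypotheses (hst : star_axioms st) (hq : cstar_seminorm st q).

(** The norm form of having spectrum in [0, 2N]. Unlike the form b* b it is visibly stable under
    sums. *)
Definition qpos (h : U) := st h = h /\ exists2 N : R, 0 < N & q (N%:A - h) <= N.

Lemma qposD h k : qpos h -> qpos k -> qpos (h + k).
Proof.
move=> [sh [N N0 hN]] [sk [M M0 kM]]; split; first by rewrite (stD hst) sh sk.
exists (N + M); first exact: addr_gt0.
by rewrite scalerDl opprD addrACA (le_trans (qD hq _ _))// lerD.
Qed.

Lemma qposZ (r : R) h : 0 < r -> qpos h -> qpos (r *: h).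
Proof.
move=> r0 [sh [N N0 hN]]; split; first by rewrite (stZ hst) sh.
exists (r * N); first exact: mulr_gt0.
by rewrite -scalerA -scalerBr (qZ hq) gtr0_norm// ler_pM2l.
Qed.

Lemma q_sub_sqr a (N : R) : st a = a -> 0 < N -> q a * q a <= N ->
  q (N%:A - a * a) <= N.
Proof.
move=> sa N0 qa; pose c := Num.sqrt N.
have c0 : 0 < c by rewrite sqrtr_gt0.
have cc : c * c = N by rewrite -expr2 sqr_sqrtr// ltW.
have -> : N%:A - a * a = N *: (1 - (c^-1 *: a) * (c^-1 *: a)).
  rewrite -scalerAl -scalerAr scalerA scalerBr scalerA -invfM cc mulfV ?scale1r//.
  by rewrite gt_eqF.
rewrite (qZ hq) gtr0_norm// ler_piMr ?(ltW N0)//.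
apply: (q_one_sub_sqr hst hq); first by rewrite (stZ hst) sa.
rewrite (qZ hq) gtr0_norm ?invr_gt0// mulrC ler_pdivrMr// mul1r.
by apply: le_of_sqr (ltW c0) _; rewrite cc.
Qed.

Lemma qpos_sqr a : st a = a -> qpos (a * a).
Proof.
move=> sa; split; first by rewrite (stM hst) sa.
have q0 : 0 <= q a * q a by rewrite mulr_ge0 ?(q_ge0 hq).
by exists (q a * q a + 1); [lra|apply: q_sub_sqr => //; lra].
Qed.

Lemma qpos1 : qpos 1.
Proof. by rewrite -(mulr1 1); apply: qpos_sqr; exact: st1. Qed.

Lemma qpos_approx_sqrt h (e : R) : 0 < e -> qpos h -> exists2 b,
  st b = b /\ (forall c, GRing.comm c h -> GRing.comm c b) & q (b * b - h) <= e.
Proof.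
move=> e0 [sh [N N0 hN]].
have eN0 : 0 < e / N by rewrite divr_gt0.
pose x := 1 - N^-1 *: h.
have sx : st x = x by rewrite /x (stB hst) (st1 hst) (stZ hst) sh.
have qx : q x <= 1.
  rewrite -(ler_pM2l N0) mulr1; apply: le_trans hN.
  rewrite -[X in X * _](gtr0_norm N0) -(qZ hq) /x scalerBr scalerA mulfV ?gt_eqF//.
  by rewrite scale1r.
have [y [sy cy _] hy] := approx_sqrt hst hq eN0 sx qx.
exists (Num.sqrt N *: (1 - y)).
  split; first by rewrite (stZ hst) (stB hst) (st1 hst) sy.
  move=> c ch; apply/commrZ/commrB; first exact: commr1.
  by apply/cy/commrB; [exact: commr1|exact: commrZ].
rewrite -scalerAl -scalerAr scalerA -expr2 sqr_sqrtr ?(ltW N0)//.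
move: hy; rewrite /x opprB addrC => hy.
have <- : N *: ((1 - y) * (1 - y) - N^-1 *: h) = N *: ((1 - y) * (1 - y)) - h.
  by rewrite scalerBr scalerA mulfV ?gt_eqF// scale1r.
rewrite (qZ hq) gtr0_norm// mulrC -ler_pdivlMr//.
by move: hy; rewrite (addrC _ (- 1)) addrA addNr add0r addrC.
Qed.

(** The constant in [qpos] is only some number; here any bound of [q h] is shown to serve. For a
    square this is [q_sub_sqr], and h is close to a square. *)
Lemma qpos_bound h (N : R) : qpos h -> q h <= N -> q (N%:A - h) <= N.
Proof.
move=> ph qh; apply: (@le_eps _ _ _ 3) => // e e0 e1.
have [b [sb _] hb] := qpos_approx_sqrt e0 ph.
have N0 : 0 <= N by apply: le_trans qh; exact: q_ge0 hq _.
have h1 : q ((N + e)%:A - b * b) <= N + e.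
  apply: q_sub_sqr => //; first by lra.
  by rewrite -(q_sa hq sb); have := q_near hq hb; lra.
have -> : N%:A - h = ((N + e)%:A - b * b) + (b * b - h) - e%:A.
  by rewrite scalerDl; ncring.
have := qB hq ((N + e)%:A - b * b + (b * b - h)) e%:A.
have := qD hq ((N + e)%:A - b * b) (b * b - h).
have := qA hst hq e; rewrite gtr0_norm//; lra.
Qed.

(** h and k need not commute, but h and N - h do, where N is [q (h + k)]. Both are positive up to e,
    since N - h = (N - (h + k)) + k; their approximate roots c and d give c^2 + d^2 close to N, and
    [q_pyth] bounds c^2. *)
Lemma q_le_qposD h k : qpos h -> qpos k -> q h <= q (h + k).
Proof.
move=> ph pk; set N := q (h + k).
have N0 : 0 <= N by exact: q_ge0 hq _.
apply: (@le_eps _ _ _ 4) => // e e0 e1.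
have pNh : qpos ((N + e)%:A - h).
  have -> : (N + e)%:A - h = ((N + e)%:A - (h + k)) + k by ncring.
  apply: qposD => //; split.
    by rewrite (stB hst) (stA hst) (stD hst) (proj1 ph) (proj1 pk).
  by exists (N + e); [lra|rewrite opprB addrC subrK/=; rewrite /N; lra].
have [c [sc cc] hc] := qpos_approx_sqrt e0 ph.
have [d [sd cd] hd] := qpos_approx_sqrt e0 pNh.
have cod : GRing.comm c d.
  apply/cd/commrB; first exact: commrA.
  exact/commr_sym/cc.
have h1 : q (c * c + d * d) <= N + 3 * e.
  have -> : c * c + d * d = (c * c - h) + (d * d - ((N + e)%:A - h)) + (N + e)%:A.
    by ncring.
  have := qD hq (c * c - h + (d * d - ((N + e)%:A - h))) (N + e)%:A.
  have := qD hq (c * c - h) (d * d - ((N + e)%:A - h)).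
  have := qA hst hq (N + e); rewrite ger0_norm; last by lra.
  lra.
have := q_pyth hq sc sd cod; rewrite -(q_sa hq sc).
rewrite (q_distC hq) in hc; have := q_near hq hc; lra.
Qed.

Lemma qpos_closed h : st h = h ->
  (forall e : R, 0 < e -> exists2 k, qpos k & q (k - h) <= e) -> qpos h.
Proof.
move=> sh hk; split => //; have h0 := q_ge0 hq h.
exists (q h + 1); first by lra.
apply: (@le_eps _ _ _ 1) => // e e0 e1; have [k pk kh] := hk _ e0.
have := qpos_bound pk (_ : q k <= q h + 1).
move=> /(_ ltac:(have := q_near hq kh; lra)) h1.
have -> : (q h + 1)%:A - h = ((q h + 1)%:A - k) + (k - h) by ncring.
have := qD hq ((q h + 1)%:A - k) (k - h); lra.
Qed.

(** The product is a limit of the squares of bc, for commuting approximate roots b of h and c of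
    k. *)
Lemma qpos_mul h k : qpos h -> qpos k -> GRing.comm h k -> qpos (h * k).
Proof.
move=> ph pk hk; apply: qpos_closed.
  by rewrite (stM hst) (proj1 ph) (proj1 pk).
move=> e e0; pose K := 1 + q h + q k.
have h0 := q_ge0 hq h; have k0 := q_ge0 hq k.
pose d := Num.min 1 (e / (2 * K)).
have d0 : 0 < d by rewrite lt_min ltr01 divr_gt0//; rewrite /K; lra.
have [b [sb cb] hb] := qpos_approx_sqrt d0 ph.
have [c [sc cc] hc] := qpos_approx_sqrt d0 pk.
have d1 : d <= 1 by rewrite ge_min lexx.
have dK : 2 * (d * K) <= e.
  rewrite mulrCA -ler_pdivlMr; first by rewrite ge_min lexx orbT.
  by rewrite /K; lra.
have bc : GRing.comm b c by apply/cc/commr_sym/cb/commr_sym.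
exists ((b * c) * (b * c)).
  by apply: qpos_sqr; rewrite (stM hst) sb sc bc.
have -> : b * c * (b * c) - h * k = (b * b - h) * (c * c) + h * (c * c - k).
  have -> : b * c * (b * c) = b * b * (c * c) by rewrite -!mulrA (mulrA c) -bc !mulrA.
  ncring.
have hcc := q_near hq hc.
have := qD hq ((b * b - h) * (c * c)) (h * (c * c - k)).
have := qM_le hq hb hcc; have := qM_le hq (lexx (q h)) hc.
have : d * (q k + d) <= d * (q k + 1) by rewrite ler_pM2l// lerD2l.
have : 0 <= d * q h by rewrite mulr_ge0// ltW.
move: dK; rewrite /K; lra.
Qed.

(** w is the sum of the powers (1 + xy)^k for k < n, because (1 + yx) y = y (1 + xy). *)
Lemma telescope_power_swap (x y : U) n : exists w, (1 + y * x) ^+ n = 1 + y * w * x /\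
  (q (1 + x * y) <= 1 -> q w <= n%:R).
Proof.
elim: n => [|n [w [IHn hw]]].
  by exists 0; rewrite mulr0 mul0r addr0 (q0 hq).
exists (1 + (1 + x * y) * w); split.
  by rewrite exprS IHn; ncring.
move=> h; rewrite -natr1 addrC (le_trans (qD hq _ _))// lerD ?(q1 hst hq)//.
by rewrite -[n%:R]mul1r (qM_le hq h)// hw.
Qed.

(** If r > 1, the second-order Bernoulli bound [key] outgrows every affine function. The exponents
    are powers of 2 because the C*-identity computes [q] only of repeated squares. *)
Lemma power_le_affine (r C : R) : 0 <= r -> 0 <= C ->
  (forall k : nat, r ^+ (2 ^ k)%N <= 1 + (2 ^ k)%:R * C) -> r <= 1.
Proof.
move=> r0 C0 h; case: (lerP r 1) => // r1; exfalso.
pose d := r - 1; have d0 : 0 < d by rewrite subr_gt0.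
have key : forall n : nat, 1 + n%:R * d + n%:R * (n%:R - 1) / 2 * d ^+ 2 <= r ^+ n.
  elim=> [|n IHn]; first by rewrite expr0 !mul0r !addr0.
  have n0 : 0 <= n%:R * (n%:R - 1) :> R.
    by case: n {IHn} => [|n]; rewrite ?mul0r// mulr_ge0// subr_ge0 ler1n.
  have rE : r = 1 + d by rewrite /d; ring.
  have -> : n.+1%:R = n%:R + 1 :> R by rewrite natr1.
  rewrite [r ^+ n.+1]exprS [X in _ <= X * _]rE.
  have : 0 <= d ^+ 3 by rewrite exprn_ge0// ltW.
  have : (1 + d) * (1 + n%:R * d + n%:R * (n%:R - 1) / 2 * d ^+ 2) <= (1 + d) * r ^+ n.
    by rewrite ler_wpM2l//; lra.
  move: (n%:R) (r ^+ n) n0 => m rn m0 h1 h2; apply: le_trans h1.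
  rewrite -subr_ge0.
  have -> : (1 + d) * (1 + m * d + m * (m - 1) / 2 * d ^+ 2) -
    (1 + (m + 1) * d + (m + 1) * (m + 1 - 1) / 2 * d ^+ 2) = m * (m - 1) / 2 * d ^+ 3.
    by field.
  by rewrite mulr_ge0// divr_ge0.
have [k hk] : exists k : nat, 2 * C / d ^+ 2 + 1 < (2 ^ k)%:R.
  exists (Num.truncn (2 * C / d ^+ 2 + 1)).+1; apply: lt_trans (truncnS_gt _) _.
  by rewrite ltr_nat ltn_expl.
have := le_trans (key (2 ^ k)%N) (h k).
have d2 : 0 < d ^+ 2 by rewrite exprn_gt0.
have k0 : 0 < (2 ^ k)%:R :> R by rewrite ltr0n expn_gt0.
have := mulr_gt0 k0 d0.
move: hk; rewrite -ltrBrDr ltr_pdivrMr// => hk.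
have : (2 ^ k)%:R * (2 * C) < (2 ^ k)%:R * (((2 ^ k)%:R - 1) * d ^+ 2) by rewrite ltr_pM2l.
move: ((2 ^ k)%:R) (d ^+ 2) => K D; lra.
Qed.

Lemma q_sa_pow2 a k : st a = a -> q (a ^+ (2 ^ k)) = q a ^+ (2 ^ k).
Proof.
move=> sa; elim: k => [|k IHk]; first by rewrite !expr1.
rewrite expnS mulnC !exprM !expr2 (q_sa hq) ?IHk//.
by elim: (2 ^ k)%N => [|n IHn]; rewrite ?(st1 hst)// exprSr (stM hst) IHn sa -exprS exprSr.
Qed.

(* A substitute for the equality of the spectra of y*y and yy* away from 0. *)
Lemma qposN_swap y : qpos (- (st y * y)) -> qpos (- (y * st y)).
Proof.
move=> [_ [N N0 hN]]; split; first by rewrite (stN hst) (stM hst) (stK hst).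
exists N => //; pose c := Num.sqrt N.
have c0 : 0 < c by rewrite sqrtr_gt0.
have cc : c^-1 * c^-1 = N^-1 by rewrite -invfM -expr2 sqr_sqrtr// ltW.
pose z := c^-1 *: y.
have eN (u v : U) : N%:A - - (u * v) = N *: (1 + (c^-1 *: u) * (c^-1 *: v)).
  rewrite opprK scalerDr -scalerAl -scalerAr !scalerA -mulrA cc mulfV ?gt_eqF//.
  by rewrite scale1r.
have sz : st z = c^-1 *: st y by rewrite /z (stZ hst).
move: hN; rewrite !eN -sz -/z !(qZ hq) gtr0_norm// !ger_pMr// => h1.
have sT : st (1 + z * st z) = 1 + z * st z.
  by rewrite (stD hst) (st1 hst) (stM hst) (stK hst).
(* The powers of 1 + z z* have [q] equal to powers of [q (1 + z * st z)], yet by telescoping they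
   grow at most linearly; so that number is at most 1. *)
apply: (@power_le_affine _ (q z * q z)); rewrite ?mulr_ge0 ?(q_ge0 hq)// => k.
rewrite -q_sa_pow2//; have [w [-> hw]] := telescope_power_swap (st z) z (2 ^ k).
rewrite (le_trans (qD hq _ _))// lerD ?(q1 hst hq)//.
have := qM_le hq (qM_le hq (lexx (q z)) (hw h1)) (lexx (q (st z))).
by rewrite (qst hq) mulrAC mulrC mulrA.
Qed.

End positive_for_a_seminorm.

(** * Square roots and positivity in complete unital algebras *)

Section seminorm_sequences.
Variables (R : realType) (V : zmodType) (S : set (V -> R)).

Definition seq_lim (u : nat -> V) (l : V) := forall q, S q ->
  forall e : R, 0 < e -> exists n, forall m, (n <= m)%N -> q (u m - l) <= e.

Definition seq_cauchy (u : nat -> V) := forall q, S q ->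
  forall e : R, 0 < e -> exists n, forall m, (n <= m)%N -> q (u m - u n) <= e.

End seminorm_sequences.

Section positive_for_all_seminorms.
Variables (R : realType) (U : algType R) (st : U -> U) (S : set (U -> R)).

Local Notation seq_lim := (seq_lim S).
Local Notation seq_cauchy := (seq_cauchy S).

Record cstar_family : Prop := {
  family_st : star_axioms st;
  family_seminorm : forall q, S q -> cstar_seminorm st q;
  family_sep : forall a, (forall q, S q -> q a = 0) -> a = 0;
  family_complete : forall u, seq_cauchy u -> exists l, seq_lim u l
}.

Hypothesis hS : cstar_family.
Let hst := family_st hS.
Let hq := family_seminorm hS.

Lemma seq_lim_eps_sep a : (forall q, S q -> forall e : R, 0 < e -> q a <= e) -> a = 0.
Proof.
move=> h; apply: (family_sep hS) => q Sq; apply/eqP.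
rewrite eq_le (q_ge0 (hq Sq)) andbT.
by apply/ler_addgt0Pr => e e0; rewrite add0r h.
Qed.

Lemma seq_lim_unique u a b : seq_lim u a -> seq_lim u b -> a = b.
Proof.
move=> ua ub; apply/eqP; rewrite -subr_eq0; apply/eqP/seq_lim_eps_sep => q Sq e e0.
have [n hn] := ua _ Sq (e / 2) ltac:(lra); have [m hm] := ub _ Sq (e / 2) ltac:(lra).
have := hn (maxn n m) (leq_maxl _ _); have := hm (maxn n m) (leq_maxr _ _).
move: (u _) => x.
rewrite (q_distC (hq Sq) x a) => h1 h2.
have -> : a - b = (a - x) + (x - b) by rewrite addrA subrK.
have := qD (hq Sq) (a - x) (x - b); lra.
Qed.

Lemma seq_lim_cst a : seq_lim (fun=> a) a.
Proof. by move=> q Sq e e0; exists 0%N => m _; rewrite subrr (q0 (hq Sq)) ltW. Qed.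

Lemma seq_lim_st u a : seq_lim u a -> seq_lim (fun n => st (u n)) (st a).
Proof.
move=> ua q Sq e e0; have [n hn] := ua _ Sq e e0; exists n => m nm.
by rewrite -(stB hst) (qst (hq Sq)) hn.
Qed.

Lemma seq_limN u a : seq_lim u a -> seq_lim (fun n => - u n) (- a).
Proof.
move=> ua q Sq e e0; have [n hn] := ua _ Sq e e0; exists n => m nm.
by rewrite -opprD (qN (hq Sq)) hn.
Qed.

Lemma seq_limD u v a b : seq_lim u a -> seq_lim v b ->
  seq_lim (fun n => u n + v n) (a + b).
Proof.
move=> ua vb q Sq e e0.
have [n hn] := ua _ Sq (e / 2) ltac:(lra); have [m hm] := vb _ Sq (e / 2) ltac:(lra).
exists (maxn n m) => k; rewrite geq_max => /andP[/hn h1 /hm h2].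
rewrite opprD addrACA; have := qD (hq Sq) (u k - a) (v k - b); lra.
Qed.

Lemma seq_limM u v a b : seq_lim u a -> seq_lim v b ->
  seq_lim (fun n => u n * v n) (a * b).
Proof.
move=> ua vb q Sq e e0; have a0 := q_ge0 (hq Sq) a; have b0 := q_ge0 (hq Sq) b.
pose K := 1 + q a + q b; pose d := Num.min 1 (e / K).
have K0 : 0 < K by rewrite /K; lra.
have d0 : 0 < d by rewrite lt_min ltr01 divr_gt0.
have d1 : d <= 1 by rewrite ge_min lexx.
have dK : d * K <= e by rewrite -ler_pdivlMr// ge_min lexx orbT.
have [n hn] := ua _ Sq d d0; have [m hm] := vb _ Sq d d0.
exists (maxn n m) => k; rewrite geq_max => /andP[/hn h1 /hm h2].
have -> : u k * v k - a * b = (u k - a) * v k + a * (v k - b) by ncring.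
have h3 := q_near (hq Sq) h2.
have := qD (hq Sq) ((u k - a) * v k) (a * (v k - b)).
have := qM_le (hq Sq) h1 h3; have := qM_le (hq Sq) (lexx (q a)) h2.
have : d * (q b + d) <= d * (q b + 1) by rewrite ler_pM2l// lerD2l.
move: dK; rewrite /K; lra.
Qed.

Lemma eq_seq_lim u v a : u =1 v -> seq_lim u a -> seq_lim v a.
Proof. by move=> uv ua q Sq e /(ua _ Sq)[n hn]; exists n => m; rewrite -uv; exact: hn. Qed.

Lemma seq_lim_comm u a c : (forall n, GRing.comm c (u n)) -> seq_lim u a -> GRing.comm c a.
Proof.
move=> cu ua; apply: (@seq_lim_unique (fun n => c * u n)).
  exact: seq_limM (@seq_lim_cst c) ua.
apply: eq_seq_lim (seq_limM ua (@seq_lim_cst c)) => n; exact/esym/cu.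
Qed.

Lemma seq_lim_sa u a : (forall n, st (u n) = u n) -> seq_lim u a -> st a = a.
Proof.
move=> su ua; apply: (@seq_lim_unique u) => //.
exact: eq_seq_lim (seq_lim_st ua).
Qed.

Lemma seq_lim_le u a q C : S q -> (forall n, q (u n) <= C) -> seq_lim u a -> q a <= C.
Proof.
move=> Sq uC ua; apply/ler_addgt0Pr => e e0; have [n /(_ n (leqnn _))] := ua _ Sq _ e0.
rewrite (q_distC (hq Sq)) => /(q_near (hq Sq)); have := uC n; lra.
Qed.

Lemma sqr_eq0_sa a : st a = a -> a * a = 0 -> a = 0.
Proof.
move=> sa aa; apply: (family_sep hS) => q Sq.
have := q_sa (hq Sq) sa; rewrite aa (q0 (hq Sq)) => /esym/eqP.
by rewrite mulf_eq0 orbb => /eqP.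
Qed.

Definition pos h := forall q, S q -> qpos st q h.

Lemma posD h k : pos h -> pos k -> pos (h + k).
Proof. by move=> ph pk q Sq; apply: (qposD hst (hq Sq)); [exact: ph|exact: pk]. Qed.

Lemma pos_sqr a : st a = a -> pos (a * a).
Proof. by move=> sa q Sq; exact: (qpos_sqr hst (hq Sq)). Qed.

(** As x lies in the unit ball of every seminorm, [sqrt_iter x] is Cauchy for all of them, and the
    root is now exact. *)
Lemma bounded_sqrt x : st x = x -> (forall q, S q -> q x <= 1) -> exists w,
  [/\ st w = w, forall c, GRing.comm c x -> GRing.comm c w, w * w = 1 - x &
      forall q, S q -> q (1 - w) <= 1].
Proof.
move=> sx qx.
have [l hl] : exists l, seq_lim (sqrt_iter x) l.
  apply: (family_complete hS) => q Sq e e0.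
  have [n hn] := sqrt_iter1_cvg e0; exists n => m nm.
  by apply: le_trans (q_sqrt_iter_dist (hq Sq) nm (qx _ Sq)) _; exact: hn.
have sl : st l = l by apply: seq_lim_sa hl => n; exact: (sqrt_iter_sa hst).
exists (1 - l); split.
- by rewrite (stB hst) (st1 hst) sl.
- move=> c cx; apply: commrB; first exact: commr1.
  by apply: seq_lim_comm hl => n; exact: sqrt_iter_comm.
- apply: (@seq_lim_unique (fun n => (1 - sqrt_iter x n) * (1 - sqrt_iter x n))).
    by apply: seq_limM; apply: seq_limD; [exact: seq_lim_cst|exact: seq_limN|
      exact: seq_lim_cst|exact: seq_limN].
  move=> q Sq e e0; have [n hn] := @sqrt_iter1_cvg R (e / 2) ltac:(lra).
  exists n => m nm; rewrite sqrt_iterE (qZ (hq Sq)) ger0_norm//.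
  have := q_sqrt_iter_dist (hq Sq) (leqnSn m) (qx _ Sq); have := hn m nm; lra.
- move=> q Sq; rewrite opprB addrC subrK.
  apply: seq_lim_le hl => // n; apply: le_trans (q_sqrt_iter (hq Sq) n (qx _ Sq)) _.
  by have /andP[] := sqrt_iter1_itv R n.
Qed.

(** * The inverse of 1 + h for a positive, possibly unbounded h *)

Section resolvent.
Variable h : U.

(** The error of Richardson's iteration for the inverse of 1 + h, with steps 1/1, 1/2, 1/3, ... A
    fixed step t is seen to contract only for the seminorms with [t * (N + 1) <= 1], and N may be
    unbounded over them. The steps 1/n are eventually small enough for each seminorm, and their sum
    diverges. *)
Fixpoint resolvent_residue n : U :=
  if n is m.+1 then resolvent_residue m * (1 - m.+1%:R^-1 *: (1 + h)) else 1.

Fixpoint resolvent_iter n : U :=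
  if n is m.+1 then resolvent_iter m + m.+1%:R^-1 *: resolvent_residue m else 0.

Lemma resolvent_residue_comm c n : GRing.comm c h -> GRing.comm c (resolvent_residue n).
Proof.
move=> ch; elim: n => [|n IHn] /=; first exact: commr1.
apply: commrM => //; apply: commrB; first exact: commr1.
by apply/commrZ/commrD => //; exact: commr1.
Qed.

Lemma resolvent_iter_comm c n : GRing.comm c h -> GRing.comm c (resolvent_iter n).
Proof.
move=> ch; elim: n => [|n IHn] /=; first exact: commr0.
by apply: commrD => //; apply/commrZ/resolvent_residue_comm.
Qed.

Lemma resolvent_residueE n : 1 - resolvent_iter n * (1 + h) = resolvent_residue n.
Proof.
elim: n => [|n IHn] /=; first by rewrite mul0r subr0.
rewrite mulrDl opprD addrA IHn mulrBr mulr1.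
by rewrite -scalerAl -scalerAr.
Qed.

Lemma resolvent_residue_sa n : st h = h -> st (resolvent_residue n) = resolvent_residue n.
Proof.
move=> sh; elim: n => [|n IHn] /=; first exact: st1.
rewrite (stM hst) IHn (stB hst) (st1 hst) (stZ hst) (stD hst) (st1 hst) sh.
suff : GRing.comm (1 - n.+1%:R^-1 *: (1 + h)) (resolvent_residue n) by [].
apply: resolvent_residue_comm; apply/commr_sym/commrB; first exact: commr1.
by apply/commrZ/commrD => //; exact: commr1.
Qed.

Lemma resolvent_iter_sa n : st h = h -> st (resolvent_iter n) = resolvent_iter n.
Proof.
move=> sh; elim: n => [|n IHn] /=; first exact: st0.
by rewrite (stD hst) IHn (stZ hst) resolvent_residue_sa.
Qed.

Section one_seminorm.
Variable q : U -> R.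
Hypotheses (Sq : S q) (hpos : qpos st q h).

Lemma q_resolvent_step (t N : R) : 0 < t -> q (N%:A - h) <= N -> 0 < N ->
  t * (N + 1) <= 1 -> q (1 - t *: (1 + h)) <= 1 - t.
Proof.
move=> t0 hN N0 tN.
have -> : 1 - t *: (1 + h) = (1 - t - t * N)%:A + t *: (N%:A - h).
  rewrite !scalerDl !scalerBr !scaleNr scalerDr scale1r scalerA opprD !addrA.
  by rewrite -!addrA; congr (_ + (_ + _)); rewrite addKr.
have := qD (hq Sq) (1 - t - t * N)%:A (t *: (N%:A - h)).
have := qA hst (hq Sq) (1 - t - t * N).
rewrite (qZ (hq Sq) t) (gtr0_norm t0) ger0_norm; last by lra.
have : t * q (N%:A - h) <= t * N by rewrite ler_pM2l.
lra.
Qed.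

(** Past M, the n-th factor has seminorm at most 1 - 1/n = (n - 1)/n, so that n times the residue
    stops growing. *)
Lemma q_resolvent_residue : exists C M, 0 <= C /\ forall n, (M.+1 <= n)%N ->
  q (resolvent_residue n) * n%:R <= C.
Proof.
have [_ [N N0 hN]] := hpos.
pose M := (Num.truncn (N + 1)); exists (q (resolvent_residue M.+1) * M.+1%:R), M.
split; first by rewrite mulr_ge0// (q_ge0 (hq Sq)).
elim=> [//|n IHn]; rewrite leq_eqVlt => /predU1P[<-//|]; rewrite ltnS => Mn.
apply: le_trans (IHn Mn).
have n0 : 0 < n.+1%:R :> R by [].
have tN : n.+1%:R^-1 * (N + 1) <= 1.
  rewrite mulrC ler_pdivrMr// mul1r ltW//; apply: lt_le_trans (truncnS_gt _) _.
  by rewrite ler_nat; apply: leq_trans Mn _.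
have t0 : 0 < n.+1%:R^-1 :> R by rewrite invr_gt0.
have h1 := q_resolvent_step t0 hN N0 tN.
have := qM_le (hq Sq) (lexx (q (resolvent_residue n))) h1.
rewrite -(ler_pM2r n0) => /le_trans; apply.
rewrite -mulrA mulrBl mul1r mulVf ?gt_eqF//.
by rewrite -natr1 addrK.
Qed.

(** The increment from m to m + 1 is at most C / (m (m + 1)) = C (1/m - 1/(m + 1)), which
    telescopes. *)
Lemma q_resolvent_iter_cauchy (e : R) : 0 < e -> exists n, forall m, (n <= m)%N ->
  q (resolvent_iter m - resolvent_iter n) <= e.
Proof.
move=> e0; have [C [M [C0 hC]]] := q_resolvent_residue.
pose n := maxn M.+1 (Num.truncn (C / e)).+1.
have n0 : 0 < n%:R :> R by rewrite ltr0n leq_max.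
have nC : C / n%:R <= e.
  rewrite ler_pdivrMr// mulrC -ler_pdivrMr// ltW//; apply: lt_le_trans (truncnS_gt _) _.
  by rewrite ler_nat leq_maxr.
have Mn : (M.+1 <= n)%N by rewrite leq_maxl.
exists n; clearbody n => m nm; suff : q (resolvent_iter m - resolvent_iter n) <= C * (n%:R^-1 - m%:R^-1).
  have : 0 <= C * m%:R^-1 by rewrite mulr_ge0// invr_ge0.
  move: nC; lra.
elim: m nm => [|m IHm].
  by rewrite leqn0 => /eqP n00; move: n0; rewrite n00 ltxx.
rewrite leq_eqVlt => /predU1P[->|]; first by rewrite !subrr (q0 (hq Sq)) mulr0.
rewrite ltnS => nm; have {}IHm := IHm nm.
have m0 : 0 < m%:R :> R by apply: lt_le_trans n0 _; rewrite ler_nat.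
have h2 := hC m (leq_trans Mn nm).
rewrite /= addrAC; set d := _ *: _.
have hd : q d <= C * (m%:R^-1 - m.+1%:R^-1).
  rewrite /d (qZ (hq Sq)) ger0_norm ?invr_ge0// mulrC.
  have -> : m%:R^-1 - m.+1%:R^-1 = m%:R^-1 / m.+1%:R :> R.
    have m00 : m%:R != 0 :> R by rewrite gt_eqF.
    have m1 : m%:R + 1 != 0 :> R by rewrite natr1 pnatr_eq0.
    by rewrite -natr1; field; rewrite ?m00 ?m1.
  by rewrite mulrA ler_pM2r ?invr_gt0// ler_pdivlMr.
rewrite (le_trans (qD (hq Sq) _ _))// (le_trans (lerD IHm hd))//.
by rewrite -mulrDr addrA subrK.
Qed.

End one_seminorm.

Lemma resolvent : pos h -> st h = h -> exists r,
  [/\ st r = r, forall c, GRing.comm c h -> GRing.comm c r, r * (1 + h) = 1 &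
      forall q, S q -> q r <= 1].
Proof.
move=> ph sh; have [r hr] : exists r, seq_lim resolvent_iter r.
  by apply: (family_complete hS) => q Sq e; apply: q_resolvent_iter_cauchy => //; exact: ph.
have r1 : r * (1 + h) = 1.
  apply/eqP; rewrite eq_sym -subr_eq0; apply/eqP.
  apply: (@seq_lim_unique resolvent_residue); last first.
    move=> q Sq e e0; have [C [M [C0 hC]]] := q_resolvent_residue Sq (ph _ Sq).
    pose n := maxn M.+1 (Num.truncn (C / e)).+1.
    exists n => m nm; rewrite subr0.
    have m0 : 0 < m%:R :> R by rewrite ltr0n (leq_trans _ nm)// leq_max.
    rewrite -(ler_pM2r m0) (le_trans (hC m _))//.
      by rewrite (leq_trans _ nm)// leq_maxl.
    rewrite mulrC -ler_pdivrMr// ltW//; apply: lt_le_trans (truncnS_gt _) _.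
    by rewrite ler_nat (leq_trans _ nm)// leq_maxr.
  apply: eq_seq_lim (seq_limD (@seq_lim_cst 1) (seq_limN (seq_limM hr (@seq_lim_cst (1 + h))))) => n.
  exact: resolvent_residueE.
exists r; split=> //.
- by apply: seq_lim_sa hr => n; exact: resolvent_iter_sa.
- by move=> c ch; apply: seq_lim_comm hr => n; exact: resolvent_iter_comm.
(* From r (1 + h) = 1 follows (N + 1) r = 1 + r (N - h), hence (N + 1) q(r) <= 1 + N q(r). *)
- move=> q Sq; have [_ [N N0 hN]] := ph _ Sq.
  have : q ((N + 1) *: r) <= 1 + q r * N.
    have -> : (N + 1) *: r = 1 + r * (N%:A - h).
      have rh : r * h = 1 - r by rewrite -r1 mulrDr mulr1 addrC addKr.
      by rewrite mulrBr -scalerAr mulr1 rh scalerDl scale1r; ncring.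
    rewrite (le_trans (qD (hq Sq) _ _))// lerD ?(q1 hst (hq Sq))//.
    exact: (qM_le (hq Sq)).
  rewrite (qZ (hq Sq)) gtr0_norm; [lra|lra].
Qed.

End resolvent.

Lemma pos_sqrt h : st h = h -> pos h -> exists s,
  [/\ st s = s, forall c, GRing.comm c h -> GRing.comm c s, s * s = h & pos s].
Proof.
move=> sh ph; have [r [sr cr r1 qr]] := resolvent ph sh.
have hr : GRing.comm h r by apply: cr.
pose k := r * r * h.
have rh : r * h = 1 - r by rewrite -r1 mulrDr mulr1 addrC addKr.
have kE : k = r - r * r by rewrite /k -mulrA rh mulrBr mulr1.
have sk : st k = k by rewrite kE (stB hst) (stM hst) sr.
have ck c : GRing.comm c h -> GRing.comm c k.
  by move=> ch; rewrite /k; do 2 apply: commrM => //; apply: cr.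
(* k is positive with seminorms at most 2, so 1 - k/2 lies in all the unit balls and k/2 gets an
   exact root w. *)
pose x := 1 - 2^-1 *: k.
have xk : 1 - x = 2^-1 *: k by rewrite /x opprB addrC subrK.
have [w [sw cw ww qw]] : exists w,
  [/\ st w = w, forall c, GRing.comm c x -> GRing.comm c w, w * w = 1 - x &
      forall q, S q -> q (1 - w) <= 1].
  apply: bounded_sqrt; first by rewrite (stB hst) (st1 hst) (stZ hst) sk.
  move=> q Sq; have pk : qpos st q k.
    apply: (qpos_mul hst (hq Sq)) => //; [exact: (qpos_sqr hst (hq Sq))|exact: ph|].
    by apply/commr_sym/commrM.
  have qk : q k <= 2.
    rewrite kE (le_trans (qB (hq Sq) _ _))// (_ : 2 = 1 + 1)// lerD ?qr//.
    by rewrite -(mulr1 1) (qM_le (hq Sq)) ?qr.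
  have := qpos_bound hst (hq Sq) pk qk.
  have -> : 2%:A - k = 2 *: x.
    by rewrite /x scalerBr scalerA mulfV ?pnatr_eq0// scale1r.
  by rewrite (qZ (hq Sq)) gtr0_norm// ger_pMr.
have cwh c : GRing.comm c h -> GRing.comm c w.
  by move=> ch; apply/cw/commrB; [exact: commr1|exact/commrZ/ck].
have hw : GRing.comm h w by exact: cwh.
pose a := 1 + h; have aw : GRing.comm a w by apply/commr_sym/commrD; [exact: commr1|exact/commr_sym].
have ar : a * r = 1 by rewrite /a mulrDl mul1r hr -[X in X + _]mulr1 -mulrDr r1.
have ppw : pos w by move=> q Sq; split => //; exists 1 => //; rewrite scale1r; exact: qw.
have c2 : 0 < Num.sqrt 2 :> R by rewrite sqrtr_gt0.
(* The factor sqrt 2 makes up for halving k, and a = 1 + h cancels the two factors r of k = r r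
   h. *)
exists (Num.sqrt 2 *: (a * w)); split.
- by rewrite (stZ hst) (stM hst) sw /a (stD hst) (st1 hst) sh -/a aw.
- move=> c ch; apply/commrZ/commrM; last exact: cwh.
  by apply: commrD => //; exact: commr1.
- rewrite -scalerAl -scalerAr scalerA -expr2 sqr_sqrtr//.
  have -> : a * w * (a * w) = a * a * (w * w) by rewrite -!mulrA (mulrA w) -aw !mulrA.
  rewrite ww xk -scalerAr scalerA mulfV ?pnatr_eq0// scale1r /k.
  by rewrite !mulrA -(mulrA a a r) ar mulr1 ar mul1r.
- move=> q Sq; apply: (qposZ hst (hq Sq) c2).
  apply: (qpos_mul hst (hq Sq)) => //; last exact: ppw.
  by apply: (qposD hst (hq Sq)); [exact: (qpos1 hst (hq Sq))|exact: ph].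
Qed.

(* [m] is |h|, so that [m - h] is twice the negative part of [h]. *)
Lemma sa_abs h : st h = h -> exists m z,
  [/\ st m = m, m * m = h * h, st z = z, (m - h) * h * (m - h) + z * z = 0 &
      z = 0 -> pos h].
Proof.
move=> sh; have shh : st (h * h) = h * h by rewrite (stM hst) sh.
have [m [sm cm mm pm]] := pos_sqrt shh (pos_sqr sh).
(* With n^2 = m, z = n v is self-adjoint and z^2 = m v^2. Then v h v + z^2 = (h + m) v v = 0,
   because (h + m)(m - h) = m^2 - h^2 = 0. *)
have [n [sn cn nn pn]] := pos_sqrt sm pm.
have hm : GRing.comm h m by apply: cm; exact: commrM.
have hn : GRing.comm h n by exact: cn.
have mn : GRing.comm m n by exact: cn.
pose v := m - h.
have sv : st v = v by rewrite /v (stB hst) sm sh.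
have nv : GRing.comm n v by apply: commrB; exact: commr_sym.
have hv : GRing.comm h v by apply: commrB.
have mv : GRing.comm m v by apply: commrB => //; exact: commr_sym.
have e0 : (h + m) * v = 0.
  by rewrite /v mulrDl !mulrBr mm hm addrA subrK subrr.
have zz : n * v * (n * v) = m * v * v by rewrite -!mulrA (mulrA v) -nv -nn !mulrA.
exists m, (n * v); split => //.
- by rewrite (stM hst) sn sv nv.
- by rewrite zz -hv -!mulrDl e0 mul0r.
(* Now m v^2 = 0, while v^2 = 2 m v; so v^3 = 0, and the self-adjoint v vanishes. Thus h = m is
   positive. *)
- move=> z0; move: zz; rewrite z0 mul0r => mvv.
  have v2 : v * v = m * v + m * v.
    rewrite {1}/v mulrBl; congr (_ + _); apply/eqP; rewrite eq_sym -addr_eq0.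
    by rewrite addrC -mulrDl e0.
  have v3 : v * v * v = 0 by rewrite v2 mulrDl -mvv addr0.
  have v0 : v = 0.
    apply: sqr_eq0_sa => //; apply: sqr_eq0_sa; first by rewrite (stM hst) sv.
    by rewrite mulrA v3 mul0r.
  by move/eqP: v0; rewrite subr_eq0 => /eqP <-.
Qed.

(** Kaplansky's argument: let h = x* x and y = x (|h| - h). Then y* y = - z^2, so - y y* is positive
    too, while y* y + y y* is a sum of two squares. Hence z^2 is one of several positive terms with
    sum 0, so z = 0, which forces h to be positive. *)
Theorem pos_star_mul x : pos (st x * x).
Proof.
have sh : st (st x * x) = st x * x by rewrite (stM hst) (stK hst).
have [m [z [sm _ sz hz]]] := sa_abs sh; apply.
pose y := x * (m - st x * x).
have yy : st y * y = - (z * z).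
  apply/eqP; rewrite -addr_eq0 -{}[X in _ == X]hz /y (stM hst) (stB hst) sm sh.
  by rewrite !mulrA.
have [a [b [sa sb yab]]] := st_re_im hst y.
apply: sqr_eq0_sa => //; apply: (family_sep hS) => q Sq; apply/eqP.
rewrite eq_le (q_ge0 (hq Sq)) andbT.
have p1 : qpos st q (z * z) by exact: (qpos_sqr hst (hq Sq)).
have p2 : qpos st q (- (y * st y)).
  by apply: (qposN_swap hst (hq Sq)); rewrite yy opprK.
have p3 : qpos st q (a * a + b * b).
  by apply: (qposD hst (hq Sq)); exact: (qpos_sqr hst (hq Sq)).
have := q_le_qposD hst (hq Sq) p1 (qposD hst (hq Sq) p2 p3).
have -> : z * z + (- (y * st y) + (a * a + b * b)) = 0 by rewrite -yab yy; ncring.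
by rewrite (q0 (hq Sq)).
Qed.

End positive_for_all_seminorms.

Local Open Scope staralg_scope.
Local Open Scope complex_scope.

(** * Bounded operators and the unitization *)

Section star_algebra_theory.
Variables (R : realType) (B : starAlgType R).
Implicit Types (a b c : B) (z : R[i]) (r : R) (T : B -> B).

Lemma ReZ_normr r : complex.Re `|r%:C| = `|r|.
Proof. by rewrite normc_def/= expr0n addr0 sqrtr_sqr. Qed.

Lemma conj_real r : Num.conj (r%:C : R[i]) = r%:C.
Proof. by apply: conj_Creal; rewrite complex_real. Qed.

Lemma conj_i : Num.conj ('i : R[i]) = - 'i.
Proof. exact: conjCi. Qed.

Lemma amula0 a : a ** 0 = 0.
Proof. by rewrite -(scale0r (0 : B)) amulZr !scale0r. Qed.

Lemma amul0a a : 0 ** a = 0.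
Proof. by rewrite -(scale0r (0 : B)) amulZl !scale0r. Qed.

Lemma amulaN a b : a ** (- b) = - (a ** b).
Proof. by rewrite -scaleN1r amulZr scaleN1r. Qed.

Lemma amulNa a b : (- a) ** b = - (a ** b).
Proof. by rewrite -scaleN1r amulZl scaleN1r. Qed.

Lemma amulBl a b c : (a - b) ** c = a ** c - b ** c.
Proof. by rewrite amulDl amulNa. Qed.

Lemma amulBr a b c : a ** (b - c) = a ** b - a ** c.
Proof. by rewrite amulDr amulaN. Qed.

Lemma star_0 : star (0 : B) = 0.
Proof. by rewrite -(scale0r (0 : B)) starZ rmorph0 !scale0r. Qed.

Lemma starN a : star (- a) = - star a.
Proof. by rewrite -scaleN1r starZ rmorphN1 scaleN1r. Qed.

Lemma starB a b : star (a - b) = star a - star b.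
Proof. by rewrite starD starN. Qed.

Lemma starZr r a : star (r%:C *: a) = r%:C *: star a.
Proof. by rewrite starZ conj_real. Qed.

Section one_seminorm.
Variable p : B -> R.
Hypothesis hp : is_cstar_seminorm p.

Lemma csD a b : p (a + b) <= p a + p b. Proof. by case: hp. Qed.
Lemma csZ z a : p (z *: a) = complex.Re `|z| * p a. Proof. by case: hp. Qed.
Lemma csM a b : p (a ** b) <= p a * p b. Proof. by case: hp. Qed.
Lemma cs_star a : p (star a) = p a. Proof. by case: hp. Qed.
Lemma csC a : p (star a ** a) = p a * p a. Proof. by case: hp => *; rewrite -expr2. Qed.
Lemma csZr r a : p (r%:C *: a) = `|r| * p a. Proof. by rewrite csZ ReZ_normr. Qed.
Lemma cs0 : p 0 = 0. Proof. by rewrite -(scale0r 0) csZ normr0 mul0r. Qed.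
Lemma csN a : p (- a) = p a.
Proof. by rewrite -scaleN1r csZ normrN1 mul1r. Qed.
Lemma csB a b : p (a - b) <= p a + p b. Proof. by rewrite -(csN b) csD. Qed.
Lemma cs_distC a b : p (a - b) = p (b - a). Proof. by rewrite -csN opprB. Qed.
Lemma cs_ge0 a : 0 <= p a.
Proof. by have := csB a a; rewrite subrr cs0; lra. Qed.
Lemma cs_near a b (e : R) : p (a - b) <= e -> p a <= p b + e.
Proof. by move=> ab; rewrite -(subrK b a) addrC (le_trans (csD _ _))// lerD. Qed.
Lemma csM_le a b (x y : R) : p a <= x -> p b <= y -> p (a ** b) <= x * y.
Proof. by move=> ax by_; apply: le_trans (csM _ _) _; rewrite ler_pM// cs_ge0. Qed.

(* [sup] of an unbounded set is a junk value: [opn] is the norm of T with respect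
   to p only when T is bounded for p. *)
Definition opn (T : B -> B) : R := sup [set p (T x) | x in [set x | p x <= 1]].

Definition opbounded (T : B -> B) :=
  (forall r x, T (r%:C *: x) = r%:C *: T x) /\ exists C : R, forall x, p (T x) <= C * p x.

Lemma opn_le T (C : R) : (forall x, p x <= 1 -> p (T x) <= C) -> opn T <= C.
Proof.
move=> h; apply: ge_sup => [|_ [x px <-]]; last exact: h.
by exists (p (T 0)), 0 => //=; rewrite cs0.
Qed.

Lemma opn_leM T (C : R) : 0 <= C -> (forall x, p (T x) <= C * p x) -> opn T <= C.
Proof. by move=> C0 h; apply: opn_le => x px; apply: le_trans (h x) _; rewrite ler_piMr. Qed.

Lemma opn_ub T x : opbounded T -> p x <= 1 -> p (T x) <= opn T.
Proof.
move=> [_ [C hC]] px; apply: ub_le_sup; last by exists x.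
exists `|C| => _ [y py <-]; apply: le_trans (hC y) _.
apply: (@le_trans _ _ (`|C| * p y)); first by rewrite ler_wpM2r ?cs_ge0 ?ler_norm.
by rewrite ler_piMr.
Qed.

Lemma opn_ge0 T : opbounded T -> 0 <= opn T.
Proof.
move=> hT; apply: le_trans (opn_ub (x := 0) hT _); first exact: cs_ge0.
by rewrite cs0.
Qed.

Lemma opnP T x : opbounded T -> p (T x) <= opn T * p x.
Proof.
move=> hT; have [p0|p0] := eqVneq (p x) 0.
  by have [_ [C /(_ x)]] := hT; rewrite p0 !mulr0.
have {}p0 : 0 < p x by rewrite lt_neqAle eq_sym p0 cs_ge0.
have := opn_ub (x := (p x)^-1%:C *: x) hT.
rewrite csZr gtr0_norm ?invr_gt0// mulVf ?gt_eqF// => /(_ (lexx _)).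
by rewrite hT.1 csZr gtr0_norm ?invr_gt0// mulrC ler_pdivrMr.
Qed.

(** The square of p (T' x) is p (star (T (T' x)) ** x), at most opn T times p (T' x) times p x; then
    divide by p (T' x). Pairing an element with itself in this way recurs below. *)
Lemma opn_adj_bounded T T' : (forall x y, star (T x) ** y = star x ** T' y) ->
  (forall r x, T' (r%:C *: x) = r%:C *: T' x) -> opbounded T ->
  opbounded T' /\ opn T' <= opn T.
Proof.
move=> TT' T'Z hT.
have h x : p (T' x) <= opn T * p x.
  have [->|p0] := eqVneq (p (T' x)) 0; first by rewrite mulr_ge0 ?cs_ge0 ?opn_ge0.
  have {}p0 : 0 < p (T' x) by rewrite lt_neqAle eq_sym p0 cs_ge0.
  rewrite -(ler_pM2r p0) -csC -TT' mulrAC; apply: csM_le => //.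
  by rewrite cs_star opnP.
split; last exact: opn_leM (opn_ge0 hT) h.
by split => //; exists (opn T).
Qed.

Lemma adj_swap T T' : (forall x y, star (T x) ** y = star x ** T' y) ->
  forall x y, star (T' x) ** y = star x ** T y.
Proof.
by move=> h x y; rewrite -[LHS]starK starM starK -h starM starK.
Qed.

Lemma opn_adj T T' : (forall x y, star (T x) ** y = star x ** T' y) ->
  (forall r x, T' (r%:C *: x) = r%:C *: T' x) -> opbounded T -> opn T' = opn T.
Proof.
move=> TT' T'Z hT; have [hT' le] := opn_adj_bounded TT' T'Z hT.
apply/eqP; rewrite eq_le le/=.
by apply: (opn_adj_bounded (adj_swap TT') _ hT').2; exact: hT.1.
Qed.

Lemma opn_comp T T' : opbounded T -> opbounded T' -> opn (T \o T') <= opn T * opn T'.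
Proof.
move=> hT hT'; apply: opn_leM; first by rewrite mulr_ge0 ?opn_ge0.
move=> x /=; apply: le_trans (opnP _ hT) _.
by rewrite -mulrA ler_wpM2l ?opn_ge0 ?opnP.
Qed.

Lemma opbounded_comp T T' : opbounded T -> opbounded T' -> opbounded (T \o T').
Proof.
move=> hT hT'; split=> [r x|] /=; first by rewrite hT'.1 hT.1.
exists (opn T * opn T') => x /=; apply: le_trans (opnP _ hT) _.
by rewrite -mulrA ler_wpM2l ?opn_ge0 ?opnP.
Qed.

Lemma opn_add T T' : opbounded T -> opbounded T' ->
  opn (fun x => T x + T' x) <= opn T + opn T'.
Proof.
move=> hT hT'; apply: opn_le => x px; apply: le_trans (csD _ _) _.
by rewrite lerD// opn_ub.
Qed.

Lemma opn_scale_le z T : opbounded T -> opn (fun x => z *: T x) <= complex.Re `|z| * opn T.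
Proof.
move=> hT; apply: opn_le => x px; rewrite csZ ler_wpM2l ?opn_ub//.
by rewrite normc_def/= sqrtr_ge0.
Qed.

Lemma opn_Cstar T T' : (forall x y, star (T x) ** y = star x ** T' y) ->
  (forall r x, T' (r%:C *: x) = r%:C *: T' x) -> opbounded T ->
  opn (T' \o T) = opn T * opn T.
Proof.
move=> TT' T'Z hT; have [hT' le] := opn_adj_bounded TT' T'Z hT.
apply/eqP; rewrite eq_le; apply/andP; split.
  apply: le_trans (opn_comp hT' hT) _.
  by rewrite ler_wpM2r// opn_ge0.
have c0 : 0 <= opn (T' \o T) by apply/opn_ge0/opbounded_comp.
rewrite -(sqr_sqrtr c0) -expr2 ler_sqr ?nnegrE ?sqrtr_ge0 ?opn_ge0//.
apply: opn_le => x px; apply: le_of_sqr; first exact: sqrtr_ge0.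
rewrite -csC TT' -!expr2 sqr_sqrtr//.
rewrite -[X in _ <= X]mul1r; apply: csM_le; first by rewrite cs_star.
by apply: opn_ub px; exact: opbounded_comp.
Qed.

End one_seminorm.
End star_algebra_theory.

(* Only real multiples of the unit are adjoined; this is enough for the order
   theory and spares a second copy of the complex scalars. *)
Definition unitization (R : realType) (B : starAlgType R) : Type := (R * B)%type.

Section unitization.
Variables (R : realType) (B : starAlgType R).
Local Notation U := (unitization B).
Implicit Types (x y z : U) (r : R) (a b c : B).

HB.instance Definition _ := GRing.Zmodule.copy U (R * B)%type.

Let one : U := (1, 0).
Let mul x y : U := (x.1 * y.1, x.1%:C *: y.2 + y.1%:C *: x.2 + x.2 ** y.2).
Let scale r x : U := (r * x.1, r%:C *: x.2).

Lemma unitization_eq x y : x.1 = y.1 -> x.2 = y.2 -> x = y.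
Proof. by case: x y => [? ?] [? ?] /= -> ->. Qed.

Let mulA : associative mul.
Proof.
move=> [r a] [s b] [t c]; apply: unitization_eq => /=; first exact: mulrA.
rewrite !scalerDr !amulDl !amulDr !amulZl !amulZr !scalerA -!rmorphM/=.
rewrite (mulrC s t) (mulrC r t) amulA -!addrA; congr (_ + _).
by congr (_ + _); rewrite !addrA [LHS](ACl (2*4*1*3*5)).
Qed.

Let mul1 : left_id one mul.
Proof.
move=> [r a]; apply: unitization_eq => /=; first exact: mul1r.
by rewrite scale1r scaler0 addr0 amul0a addr0.
Qed.

Let mulr1_ : right_id one mul.
Proof.
move=> [r a]; apply: unitization_eq => /=; first exact: mulr1.
by rewrite scale1r scaler0 add0r amula0 addr0.
Qed.

Let mulDl_ : left_distributive mul +%R.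
Proof.
move=> [r a] [s b] [t c]; apply: unitization_eq => /=; first exact: mulrDl.
rewrite rmorphD/= scalerDl scalerDr amulDl -!addrA; congr (_ + _).
by rewrite !addrA [LHS](ACl (2*4*1*3*5)).
Qed.

Let mulDr_ : right_distributive mul +%R.
Proof.
move=> [r a] [s b] [t c]; apply: unitization_eq => /=; first exact: mulrDr.
rewrite rmorphD/= scalerDl scalerDr amulDr -!addrA; congr (_ + _).
by rewrite !addrA [LHS](ACl (2*4*1*3*5)).
Qed.

Let one_neq0 : one != 0 :> U.
Proof. by apply/eqP => /(congr1 fst)/eqP; rewrite /= oner_eq0. Qed.

HB.instance Definition _ :=
  GRing.Zmodule_isNzRing.Build U mulA mul1 mulr1_ mulDl_ mulDr_ one_neq0.

Let scaleA r s x : scale r (scale s x) = scale (r * s) x.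
Proof. by apply: unitization_eq; rewrite /= ?mulrA// scalerA rmorphM. Qed.

Let scale1 : left_id 1 scale.
Proof. by move=> x; apply: unitization_eq; rewrite /= ?mul1r// scale1r. Qed.

Let scaleDr_ : right_distributive scale +%R.
Proof. by move=> r x y; apply: unitization_eq; rewrite /= ?mulrDr// scalerDr. Qed.

Let scaleDl_ x : {morph (scale^~ x) : r s / r + s}.
Proof. by move=> r s; apply: unitization_eq; rewrite /= ?mulrDl// rmorphD/= scalerDl. Qed.

HB.instance Definition _ :=
  GRing.Zmodule_isLmodule.Build R U scaleA scale1 scaleDr_ scaleDl_.

Let scaleAl_ r x y : r *: (x * y) = (r *: x) * y.
Proof.
case: x y => [s a] [t b]; apply: unitization_eq => /=; first exact: mulrA.
by rewrite !scalerDr !amulZl !scalerA -!rmorphM/= (mulrC r t).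
Qed.

HB.instance Definition _ := GRing.Lmodule_isLalgebra.Build R U scaleAl_.

Let scaleAr_ r x y : r *: (x * y) = x * (r *: y).
Proof.
case: x y => [s a] [t b]; apply: unitization_eq => /=; first exact: mulrCA.
by rewrite !scalerDr !amulZr !scalerA -!rmorphM/= (mulrC r s).
Qed.

HB.instance Definition _ := GRing.Lalgebra_isAlgebra.Build R U scaleAr_.

Definition ustar x : U := (x.1, star x.2).

Definition uin a : U := (0, a).

Definition uop x b : B := x.1%:C *: b + x.2 ** b.

Lemma uinM a b : uin a * uin b = uin (a ** b).
Proof. by apply: unitization_eq => /=; rewrite ?mulr0// !scale0r !add0r. Qed.

Lemma uinD a b : uin a + uin b = uin (a + b).
Proof. by apply: unitization_eq => //=; rewrite addr0. Qed.

Lemma uinN a : - uin a = uin (- a).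
Proof. by apply: unitization_eq => //=; rewrite oppr0. Qed.

Lemma uinZ r a : r *: uin a = uin (r%:C *: a).
Proof. by apply: unitization_eq => //=; rewrite mulr0. Qed.

Lemma uin_star a : ustar (uin a) = uin (star a).
Proof. by []. Qed.

Lemma uinE x : x.1 = 0 -> x = uin x.2.
Proof. by move=> x0; apply: unitization_eq. Qed.

Lemma uopM x y b : uop (x * y) b = uop x (uop y b).
Proof.
rewrite /uop /= !amulDl !scalerDr !amulDr !amulZl !amulZr !scalerA -!rmorphM/= amulA.
by rewrite -!addrA; congr (_ + (_ + (_ + _))).
Qed.

Lemma uopD x y b : uop (x + y) b = uop x b + uop y b.
Proof. by rewrite /uop /= rmorphD/= scalerDl amulDl addrACA. Qed.

Lemma uopZ r x b : uop (r *: x) b = r%:C *: uop x b.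
Proof. by rewrite /uop /= scalerDr scalerA rmorphM/= amulZl. Qed.

Lemma uop_addr x b c : uop x (b + c) = uop x b + uop x c.
Proof. by rewrite /uop scalerDr amulDr addrACA. Qed.

Lemma uop_scale x (z : R[i]) b : uop x (z *: b) = z *: uop x b.
Proof. by rewrite /uop scalerDr !scalerA amulZr mulrC. Qed.

Lemma uop_star x b c : star (uop x b) ** c = star b ** uop (ustar x) c.
Proof.
by rewrite /uop starD starZr starM amulDl amulDr amulZl amulZr amulA.
Qed.

Lemma ustar_axioms : star_axioms ustar.
Proof.
split.
- by move=> x; apply: unitization_eq => //=; rewrite starK.
- by move=> x y; apply: unitization_eq => //=; rewrite starD.
- by move=> r x; apply: unitization_eq => //=; rewrite starZr.
- move=> x y; apply: unitization_eq => /=; first exact: mulrC.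
  by rewrite !starD !starZr starM; congr (_ + _); rewrite addrC.
(* The witnesses are sqrt 2 times the real and imaginary parts of y. In y* - y the real scalar part
   cancels, so the multiplication by i takes place in [B]. *)
- move=> y; pose c := Num.sqrt (2^-1 : R).
  have cc : c * c = 2^-1 by rewrite -expr2 sqr_sqrtr// invr_ge0.
  pose d := star y.2 - y.2.
  have dE : uin d = ustar y - y.
    by rewrite /d; apply: unitization_eq => //=; rewrite subrr.
  exists (c *: (y + ustar y)), (uin (c%:C *: ('i *: d))); split.
  + apply: unitization_eq => //=; first by rewrite starZr starD starK addrC.
  + rewrite uin_star starZr starZ conj_i /d starB starK scaleNr -scalerN opprB.
    by [].
  + have -> : uin (c%:C *: ('i *: d)) * uin (c%:C *: ('i *: d)) =
        - (2^-1 *: (uin d * uin d)).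
      rewrite !uinM uinZ uinN; congr uin.
      rewrite !amulZl !amulZr !scalerA -scaleNr -cc rmorphM/=; congr (_ *: _).
      move: (c%:C) => k; have -> : k * 'i * k * 'i = k * k * 'i ^+ 2 by ring.
      by rewrite sqr_i mulrN1.
    rewrite dE -scalerAl -scalerAr scalerA cc -scalerBr.
    have -> : (y + ustar y) * (y + ustar y) - (ustar y - y) * (ustar y - y) =
       (2 : R) *: (ustar y * y + y * ustar y) by rewrite scaler_nat mulr2n; ncring.
    by rewrite scalerA mulVf ?pnatr_eq0// scale1r.
Qed.

Section one_seminorm.
Variable p : B -> R.
Hypothesis hp : is_cstar_seminorm p.

(** The operator seminorm alone does not separate points if [B] already has a unit e: the element
    (1, -e) acts as 0. The absolute value of the scalar part is itself a C*-seminorm, and so is the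
    maximum. *)
Definition useminorm x : R := Num.max `|x.1| (opn p (uop x)).

Lemma uop_le x b : p (uop x b) <= (`|x.1| + p x.2) * p b.
Proof.
rewrite mulrDl (le_trans (csD hp _ _))// lerD//; first by rewrite (csZr hp).
exact: csM hp _ _.
Qed.

Lemma uop_bounded x : opbounded p (uop x).
Proof.
split; first by move=> r b; rewrite uop_scale.
by exists (`|x.1| + p x.2) => b; exact: uop_le.
Qed.

Lemma useminorm_le x : useminorm x <= `|x.1| + p x.2.
Proof.
have a0 : 0 <= `|x.1| + p x.2 by rewrite addr_ge0 ?(cs_ge0 hp).
rewrite ge_max lerDl (cs_ge0 hp)/=.
by apply: (opn_leM hp) => // b; exact: uop_le.
Qed.

Lemma useminorm_leM x (C : R) : 0 <= C -> `|x.1| <= C ->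
  (forall b, p (uop x b) <= C * p b) -> useminorm x <= C.
Proof. by move=> C0 xC h; rewrite ge_max xC/=; exact: (opn_leM hp). Qed.

Lemma useminorm_fst x : `|x.1| <= useminorm x.
Proof. by rewrite le_max lexx. Qed.

Lemma useminorm_op x : opn p (uop x) <= useminorm x.
Proof. by rewrite le_max lexx orbT. Qed.

Lemma useminorm_uop x b : p (uop x b) <= useminorm x * p b.
Proof.
apply: le_trans (opnP hp _ (uop_bounded x)) _.
by rewrite ler_wpM2r ?(cs_ge0 hp)// useminorm_op.
Qed.

Lemma useminorm_ge0 x : 0 <= useminorm x.
Proof. exact: le_trans (normr_ge0 _) (useminorm_fst x). Qed.

Lemma useminorm_uin a : useminorm (uin a) = p a.
Proof.
apply/eqP; rewrite eq_le; apply/andP; split.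
  by apply: le_trans (useminorm_le _) _; rewrite /= normr0 add0r.
have [->|p0] := eqVneq (p a) 0; first exact: useminorm_ge0.
have {}p0 : 0 < p a by rewrite lt_neqAle eq_sym p0 (cs_ge0 hp).
rewrite -(ler_pM2r p0); have := useminorm_uop (uin a) (star a).
by rewrite /uop/= scale0r add0r (cs_star hp) -{1}(starK a) (csC hp) !(cs_star hp).
Qed.

Lemma useminormZ_le r x : useminorm (r *: x) <= `|r| * useminorm x.
Proof.
apply: useminorm_leM; first by rewrite mulr_ge0 ?useminorm_ge0.
  by rewrite normrM ler_wpM2l// useminorm_fst.
by move=> b; rewrite uopZ (csZr hp) -mulrA ler_wpM2l// useminorm_uop.
Qed.

Lemma useminorm_cstar : cstar_seminorm ustar useminorm.
Proof.
have stlin x r b : uop (ustar x) (r%:C *: b) = r%:C *: uop (ustar x) b by exact: uop_scale.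
split.
- move=> x y; apply: useminorm_leM; first by rewrite addr_ge0 ?useminorm_ge0.
    by rewrite (le_trans (ler_normD _ _))// lerD// useminorm_fst.
  by move=> b; rewrite uopD mulrDl (le_trans (csD hp _ _))// lerD// useminorm_uop.
- move=> r x; apply/eqP; rewrite eq_le useminormZ_le/=.
  have [->|r0] := eqVneq r 0; first by rewrite normr0 mul0r useminorm_ge0.
  rewrite mulrC -ler_pdivlMr ?normr_gt0// mulrC -normfV.
  by apply: le_trans (useminormZ_le _ _); rewrite scalerA mulVf// scale1r.
- move=> x y; apply: useminorm_leM; first by rewrite mulr_ge0 ?useminorm_ge0.
    by rewrite normrM ler_pM// useminorm_fst.
  move=> b; rewrite uopM (le_trans (useminorm_uop _ _))// -mulrA.
  by rewrite ler_wpM2l ?useminorm_ge0// useminorm_uop.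
- move=> x; rewrite /useminorm /=; congr Num.max.
  exact: (opn_adj hp (uop_star x) (stlin x) (uop_bounded x)).
- move=> x; have := opn_Cstar hp (uop_star x) (stlin x) (uop_bounded x).
  have -> : uop (ustar x) \o uop x = uop (ustar x * x).
    by apply/funext => b; rewrite uopM.
  rewrite /useminorm => ->; rewrite /= normrM.
  have o0 := opn_ge0 hp (uop_bounded x).
  have n0 := normr_ge0 x.1.
  by rewrite /Num.max; case: ltP => h1; case: ltP => h2 //; nra.
- move=> c d sc sd cd; set K := useminorm (c * c + d * d).
  have K0 : 0 <= K by exact: useminorm_ge0.
  have KK : Num.sqrt K * Num.sqrt K = K by rewrite -expr2 sqr_sqrtr.
  suff h : useminorm c <= Num.sqrt K by rewrite -KK ler_pM ?useminorm_ge0.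
  apply: useminorm_leM; first exact: sqrtr_ge0.
    apply: le_of_sqr; first exact: sqrtr_ge0.
    rewrite -[X in _ <= X]expr2 sqr_sqrtr//; apply: le_trans (useminorm_fst _).
    rewrite /= -normrM ler_norml; apply/andP; split.
      by rewrite lerNl; apply: le_trans (normr_ge0 _); rewrite oppr_le0 -expr2 sqr_ge0.
    rewrite ger0_norm; last by rewrite addr_ge0 // -expr2 sqr_ge0.
    by rewrite lerDl -expr2 sqr_ge0.
  move=> b.
  (* For e = i or -i, T e stands for c + e d acting on the complex space [B]. Its adjoint is T (-e),
     and T (-e) T e = c^2 + d^2, so both operators are bounded by sqrt K, and 2c is their sum. *)
  pose T (e : R[i]) (x : B) := uop c x + e *: uop d x.
  have TT (e : R[i]) (x y : B) : Num.conj e = - e -> e * e = -1 ->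
      star (T e x) ** y = star x ** T (- e) y.
    move=> ce ee; rewrite /T starD amulDl uop_star sc starZ amulZl uop_star sd ce.
    by rewrite (amulDr _ (uop c y)) amulZr.
  have T2 (e : R[i]) (x : B) : e * e = -1 -> T (- e) (T e x) = uop (c * c + d * d) x.
    move=> ee; rewrite /T (uop_addr c (uop c x)) (uop_addr d (uop c x)).
    rewrite (uop_scale c e) (uop_scale d e) (scalerDr (- e)) scalerA mulNr ee opprK scale1r.
    rewrite -!uopM cd scaleNr addrA addrK -uopD.
    by [].
  have pT (e : R[i]) (x : B) : Num.conj e = - e -> e * e = -1 -> p (T e x) <= Num.sqrt K * p x.
    move=> ce ee; apply: le_of_sqr; first by rewrite mulr_ge0 ?sqrtr_ge0 ?(cs_ge0 hp).
    rewrite -(csC hp) (TT e)// T2//.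
    apply: le_trans (csM hp _ _) _; rewrite (cs_star hp).
    rewrite mulrACA KK mulrCA ler_wpM2l ?(cs_ge0 hp)//.
    exact: useminorm_uop.
  have i2 : 'i * 'i = -1 :> R[i] by rewrite -expr2 sqr_i.
  have h1 := pT 'i b (conj_i R) i2.
  have ci : Num.conj (- 'i : R[i]) = - - 'i by rewrite rmorphN/= conj_i.
  have ii : (- 'i : R[i]) * (- 'i) = -1 by rewrite mulrNN.
  have h2 := pT (- 'i) b ci ii.
  have e2 : T 'i b + T (- 'i) b = (1 + 1)%:C *: uop c b.
    by rewrite /T scaleNr addrACA subrr addr0 rmorphD/= scalerDl scale1r.
  have := csD hp (T 'i b) (T (- 'i) b); rewrite e2 (csZr hp) gtr0_norm ?addr_gt0//.
  by move: h1 h2; lra.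
Qed.

End one_seminorm.
End unitization.

(** * Positivity in complete algebras without unit *)

Lemma real_cauchy_lim (R : realType) (r : nat -> R) :
  (forall e, 0 < e -> exists n, forall m, (n <= m)%N -> `|r m - r n| <= e) ->
  exists l, forall e, 0 < e -> exists n, forall m, (n <= m)%N -> `|r m - l| <= e.
Proof.
move=> h; have : cvg (r @ \oo).
  apply: cauchy_cvg; apply: cauchy_exP => e e0.
  have [n hn] := h (e / 2) ltac:(by rewrite divr_gt0).
  exists (r n); exists n => // m /= nm; rewrite /ball/= distrC.
  by apply: le_lt_trans (hn m nm) _; rewrite ltr_pdivrMr// ltr_pMr// ltr1n.
move=> cr; exists (lim (r @ \oo)) => e e0.
have /cvgrPdist_le /(_ e e0) [n _ hn] := cr.
by exists n => m nm; rewrite distrC; exact: hn.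
Qed.

Section complete_family.
Variables (R : realType) (B : starAlgType R) (S : set (B -> R)).

(** The family is a parameter because this is applied to A with all of S(A), and to M(A) with the
    operator seminorms induced by S(A). *)
Record complete_cstar_family : Prop := {
  ccf_nonempty : exists q, S q;
  ccf_seminorm : forall q, S q -> is_cstar_seminorm q;
  ccf_sep : forall a, (forall q, S q -> q a = 0) -> a = 0;
  ccf_complete : forall u, seq_cauchy S u -> exists l, seq_lim S u l
}.

Hypothesis hS : complete_cstar_family.
Let hq := ccf_seminorm hS.
Local Notation US := [set useminorm q | q in S].
Local Notation upos := (pos (@ustar R B) US).

Lemma unitization_family : cstar_family (@ustar R B) US.
Proof.
split; first exact: ustar_axioms.
- by move=> _ [q Sq <-]; exact: useminorm_cstar (hq Sq).
- move=> x h; have x1 : x.1 = 0.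
    have [q Sq] := ccf_nonempty hS; apply/eqP; rewrite -normr_le0.
    by rewrite -(h (useminorm q)) ?useminorm_fst//; exists q.
  rewrite (uinE x1); suff -> : x.2 = 0 by [].
  apply: (ccf_sep hS) => q Sq; rewrite -(useminorm_uin (hq Sq)) -(uinE x1).
  by apply: h; exists q.
- move=> u hu.
  have [l hl] : exists l : R, forall e, 0 < e -> exists n, forall m, (n <= m)%N ->
      `|(u m).1 - l| <= e.
    apply: real_cauchy_lim => e e0; have [q Sq] := ccf_nonempty hS.
    have [n hn] := hu (useminorm q) (ex_intro2 _ _ q Sq erefl) e e0.
    exists n => m /hn; apply: le_trans.
    exact: (useminorm_fst q (u m - u n)).
  have [a ha] : exists a, seq_lim S (fun n => (u n).2) a.
    apply: (ccf_complete hS) => q Sq e e0.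
    have [n hn] := hu (useminorm q) (ex_intro2 _ _ q Sq erefl) (e / 2) ltac:(lra).
    exists n => m /hn; move: (u m) (u n) => x y xy.
    rewrite -(useminorm_uin (hq Sq)).
    have -> : uin (x.2 - y.2) = (x - y) - (x.1 - y.1)%:A.
      apply: unitization_eq => /=; first by rewrite mulr1 subrr.
      by rewrite scaler0 subr0.
    have hu' := useminorm_cstar (hq Sq).
    have := qB hu' (x - y) (x.1 - y.1)%:A.
    have := qA (ustar_axioms B) hu' (x.1 - y.1).
    have := useminorm_fst q (x - y); rewrite [(x - y).1]/=; lra.
  exists (l, a) => _ [q Sq <-] e e0.
  have [n hn] := hl (e / 2) ltac:(lra); have [m hm] := ha _ Sq (e / 2) ltac:(lra).
  exists (maxn n m) => k; rewrite geq_max => /andP[/hn h1 /hm h2].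
  apply: le_trans (useminorm_le (hq Sq) _) _.
  by rewrite /=; lra.
Qed.

Let hst := ustar_axioms B.
Let hUS := unitization_family.
Let huq q (Sq : S q) := useminorm_cstar (hq Sq).

Lemma positive_star (h : B) : positive h -> star h = h.
Proof. by case=> b ->; rewrite starM starK. Qed.

(** One direction is [pos_star_mul] in the unitization. For the other, the root s of h in the
    unitization has scalar part 0, as its square has, so it lies in [B]. *)
Lemma positive_upos (h : B) : positive h <-> star h = h /\ upos (uin h).
Proof.
split=> [ph|[sh ph]].
  split; first exact: positive_star.
  by case: ph => b ->; rewrite -uinM -uin_star; exact: pos_star_mul.
have [|s [ss _ sh' _]] := pos_sqrt hUS _ ph; first by rewrite uin_star sh.
have s0 : s.1 = 0.
  have /(congr1 fst)/eqP := sh'; rewrite /= mulf_eq0 orbb => /eqP //.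
exists s.2; have /(congr1 snd)/= := sh'; rewrite s0 scale0r !add0r => <-.
by congr (_ ** _); have /(congr1 snd)/= := ss.
Qed.

Lemma upos_qpos (h : B) q : S q -> positive h -> qpos (@ustar R B) (useminorm q) (uin h).
Proof. by move=> Sq /positive_upos[_]; apply; exists q. Qed.

Lemma positiveD (h k : B) : positive h -> positive k -> positive (h + k).
Proof.
move=> /positive_upos[sh ph] /positive_upos[sk pk]; apply/positive_upos; split.
  by rewrite starD sh sk.
by rewrite -uinD; exact: (posD hUS).
Qed.

Lemma positive0 : positive (0 : B).
Proof. by exists 0; rewrite amula0. Qed.

Lemma positive_sum (I : Type) (r : seq I) (P : pred I) (f : I -> B) :
  (forall i, P i -> positive (f i)) -> positive (\sum_(i <- r | P i) f i).
Proof.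
by move=> hf; elim/big_ind: _ => //; [exact: positive0|exact: positiveD].
Qed.

Lemma cs_le_positiveD q (h k : B) : S q -> positive h -> positive k -> q h <= q (h + k).
Proof.
move=> Sq ph pk; rewrite -!(useminorm_uin (hq Sq)) -uinD.
by apply: (q_le_qposD hst (huq Sq)); exact: upos_qpos.
Qed.

Lemma positive_lim u (h : B) : (forall n, positive (u n)) -> seq_lim S u h -> positive h.
Proof.
move=> pu uh; have sh : star h = h.
  apply/eqP; rewrite -subr_eq0; apply/eqP/(ccf_sep hS) => q Sq; apply/eqP.
  rewrite eq_le (cs_ge0 (hq Sq)) andbT; apply/ler_addgt0Pr => e e0; rewrite add0r.
  have [n /(_ n (leqnn _)) hn] := uh q Sq (e / 2) ltac:(lra).
  have -> : star h - h = (u n - h) - star (u n - h).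
    by rewrite starB (positive_star (pu n)) opprB [RHS]addrC addrA subrK.
  have := csB (hq Sq) (u n - h) (star (u n - h)); rewrite (cs_star (hq Sq)); lra.
apply/positive_upos; split => // _ [q Sq <-].
apply: (qpos_closed hst (huq Sq)); first by rewrite uin_star sh.
move=> e e0; have [n /(_ n (leqnn _)) hn] := uh q Sq e e0.
exists (uin (u n)); first exact: upos_qpos.
by rewrite uinN uinD (useminorm_uin (hq Sq)).
Qed.

Lemma positiveZ (r : R) (h : B) : 0 <= r -> positive h -> positive (r%:C *: h).
Proof.
move=> r0 [b ->]; exists ((Num.sqrt r)%:C *: b).
by rewrite starZr amulZl amulZr scalerA -rmorphM/= -expr2 sqr_sqrtr.
Qed.

Lemma sa_abs_positive (h : B) : star h = h -> exists m z : B,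
  [/\ star m = m, star z = z, (m - h) ** h ** (m - h) + z ** z = 0 &
      z = 0 -> positive h].
Proof.
move=> sh; have [|m [z [sm mm sz mz hz]]] := @sa_abs _ _ _ _ hUS (uin h).
  by rewrite uin_star sh.
have m0 : m.1 = 0 by have /(congr1 fst)/eqP := mm; rewrite /= mulr0 mulf_eq0 orbb => /eqP.
have z0 : z.1 = 0.
  have /(congr1 fst)/eqP := mz; rewrite /= m0 mulr0 mul0r add0r.
  by rewrite mulf_eq0 orbb => /eqP.
move: mz; rewrite (uinE m0) (uinE z0) !(uinN, uinD, uinM) => /(congr1 snd)/= mz.
exists m.2, z.2; split => //.
- by have /(congr1 snd) := sm.
- by have /(congr1 snd) := sz.
- by move=> z20; apply/positive_upos; split => //; apply: hz; rewrite (uinE z0) z20.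
Qed.

(* [x' = x (1 + x* x)^-1] *)
Lemma bounded_transform (x : B) : exists x' : B,
  x = x' + x' ** (star x ** x) /\ forall q, S q -> q x' <= 2.
Proof.
have px : positive (star x ** x) by exists x.
have [_ ph] := (positive_upos _).1 px.
have [|r [sr cr r1 qr]] := resolvent hUS ph; first by rewrite uin_star positive_star.
set h := star x ** x in px ph cr r1; pose x' := uin x * r.
have x10 : x'.1 = 0 by rewrite /= mul0r.
exists x'.2; split.
  have : x' * (1 + uin h) = uin x by rewrite -mulrA r1 mulr1.
  by rewrite mulrDr mulr1 (uinE x10) uinM uinD => /(congr1 snd).
move=> q Sq; apply: le_of_sqr => //.
rewrite -(csC (hq Sq)) -(useminorm_uin (hq Sq)) -uinM -uin_star -(uinE x10).
(* This has seminorm at most 2 since r has seminorm at most 1; the bound 2 for x' then leaves room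
   to spare. *)
have -> : ustar x' * x' = r - r * r.
  have rh : r * uin h = 1 - r by rewrite -r1 mulrDr mulr1 addrC addKr.
  rewrite (stM hst) sr uin_star -mulrA [uin (star x) * _]mulrA uinM -/h mulrA rh.
  by rewrite mulrBl mul1r.
have qr1 := qr _ (ex_intro2 _ _ q Sq erefl).
rewrite (le_trans (qB (huq Sq) _ _))//.
have := qM_le (huq Sq) qr1 qr1; lra.
Qed.

End complete_family.

(** * Modules over a locally C*-algebra *)

Section locally_cstar.
Variables (R : realType) (A : locCstarType R).
Local Notation SA := (cstar_seminorms A).
Implicit Types (p q : A -> R) (a b : A).

Lemma SA_cs p : SA p -> is_cstar_seminorm p. Proof. by case. Qed.

Lemma cvg_seq_lim (u : nat -> A) (l : A) : u @ \oo --> l <-> seq_lim SA u l.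
Proof.
split=> [ul p [hp cp] e e0|ul].
  have : (fun n => p (u n - l)) @ \oo --> p (l - l).
    apply: (@cvg_comp _ _ _ (fun n => u n - l) p); last exact: cp.
    apply: (@cvg_comp _ _ _ (fun n => (u n, - l)) (fun z : A * A => z.1 + z.2)); last first.
      exact: (@add_continuous A (l, - l)).
    by apply: cvg_pair => //=; exact: cvg_cst.
  rewrite subrr (cs0 hp) => /cvgrPdist_le/(_ e e0)[n _ hn].
  exists n => m nm; have := hn m nm.
  by rewrite sub0r normrN ger0_norm// (cs_ge0 hp).
apply: locCstar_topology => p Sp; apply/cvgrPdist_le => e e0.
have [n hn] := ul _ Sp e e0; exists n => // m /= nm.
by rewrite sub0r normrN ger0_norm ?hn// (cs_ge0 (SA_cs Sp)).
Qed.

Lemma SA_zero : SA (fun=> 0).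
Proof.
split; last exact: cst_continuous.
by split=> *; rewrite ?addr0 ?mulr0 ?expr0n.
Qed.

Lemma SA_complete : complete_cstar_family SA.
Proof.
split; [by exists (fun=> 0); exact: SA_zero|exact: SA_cs|exact: cstar_seminorms_sep|].
move=> u hu; have [] := @locCstar_complete R A (u @ \oo); last first.
  by move=> l ul; exists l; apply/cvg_seq_lim.
apply: locCstar_topology => p Sp; have hp := SA_cs Sp; apply/cvgrPdist_le => e e0.
have [n hn] := hu p Sp (e / 2) ltac:(lra).
exists ([set x | p (x - u n) <= e / 2], [set x | p (x - u n) <= e / 2]).
  by split; exists n => // m /= nm; exact: hn.
move=> [x y] /= [hx hy]; rewrite subr0 sub0r normrN ger0_norm ?(cs_ge0 hp)//.
have -> : x - y = (x - u n) - (y - u n) by rewrite opprB addrA subrK.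
have := csB hp (x - u n) (y - u n); lra.
Qed.

Lemma seq_lim_SA_unique (u : nat -> A) (a b : A) : seq_lim SA u a -> seq_lim SA u b -> a = b.
Proof.
move=> ua ub; apply/eqP; rewrite -subr_eq0; apply/eqP/cstar_seminorms_sep => p Sp.
have hp := SA_cs Sp; apply/eqP; rewrite eq_le (cs_ge0 hp) andbT.
apply/ler_addgt0Pr => e e0; rewrite add0r.
have [n hn] := ua _ Sp (e / 2) ltac:(lra); have [m hm] := ub _ Sp (e / 2) ltac:(lra).
have := hn (maxn n m) (leq_maxl _ _); have := hm (maxn n m) (leq_maxr _ _).
move: (u _) => x; rewrite (cs_distC hp x a) => h1 h2.
have -> : a - b = (a - x) + (x - b) by rewrite addrA subrK.
have := csD hp (a - x) (x - b); lra.
Qed.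

End locally_cstar.

(** * Cauchy-Schwarz for semi-inner products *)

Section semi_inner_product.
Variables (R : realType) (A : locCstarType R) (E : ipModule A).

(* Definiteness of the inner product is dropped: partial sums of the inner
   products of a sequence of modules only satisfy this weaker notion. *)
Record semi_hilbert : Prop := {
  sh_car0 : car E 0;
  sh_carD : forall x y, car E x -> car E y -> car E (x + y);
  sh_carZ : forall (z : R[i]) x, car E x -> car E (z *: x);
  sh_car_act : forall x b, car E x -> car E (act x b);
  sh_ipDr : forall x y y', car E x -> car E y -> car E y' ->
    ip x (y + y') = ip x y + ip x y';
  sh_ipZr : forall (z : R[i]) x y, car E x -> car E y -> ip x (z *: y) = z *: ip x y;
  sh_ip_act : forall x y b, car E x -> car E y -> ip x (act y b) = ip x y ** b;
  sh_ip_star : forall x y, car E x -> car E y -> star (ip x y) = ip y x;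
  sh_ip_ge0 : forall x, car E x -> positive (ip x x)
}.

Lemma pre_hilbert_semi : pre_hilbert_module E -> semi_hilbert.
Proof. by case=> *; split. Qed.

Hypothesis hE : semi_hilbert.
Local Notation SA := (cstar_seminorms A).
Local Notation C := (car E).
Implicit Types (x y : amb E) (a b : A) (z : R[i]).

Lemma sh_carN x : C x -> C (- x).
Proof. by move=> xC; rewrite -scaleN1r; apply: sh_carZ. Qed.

Lemma sh_carB x y : C x -> C y -> C (x - y).
Proof. by move=> xC yC; apply: sh_carD => //; exact: sh_carN. Qed.

Lemma sh_ipNr x y : C x -> C y -> ip x (- y) = - ip x y.
Proof. by move=> xC yC; rewrite -scaleN1r sh_ipZr// scaleN1r. Qed.

Lemma sh_ipBr x y y' : C x -> C y -> C y' -> ip x (y - y') = ip x y - ip x y'.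
Proof. by move=> xC yC yC'; rewrite sh_ipDr// ?sh_ipNr//; exact: sh_carN. Qed.

Lemma sh_ipDl x x' y : C x -> C x' -> C y -> ip (x + x') y = ip x y + ip x' y.
Proof.
move=> xC xC' yC; rewrite -(sh_ip_star hE yC (sh_carD hE xC xC')) sh_ipDr//.
by rewrite starD !sh_ip_star.
Qed.

Lemma sh_ipZl z x y : C x -> C y -> ip (z *: x) y = Num.conj z *: ip x y.
Proof.
move=> xC yC; rewrite -(sh_ip_star hE yC (sh_carZ hE z xC)) sh_ipZr//.
by rewrite starZ sh_ip_star.
Qed.

Lemma sh_ip_actl x y b : C x -> C y -> ip (act x b) y = star b ** ip x y.
Proof.
move=> xC yC; rewrite -(sh_ip_star hE yC (sh_car_act hE b xC)) sh_ip_act//.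
by rewrite starM sh_ip_star.
Qed.

Lemma sh_ip0r x : C x -> ip x 0 = 0.
Proof. by move=> xC; rewrite -(scale0r 0) (sh_ipZr hE) ?scale0r//; exact: sh_car0. Qed.

Section one_seminorm.
Variable p : A -> R.
Hypothesis Sp : SA p.
Let hp := SA_cs Sp.
Local Notation n := (mod_seminorm E p).

(** The positivity of the inner square of w = y - t x c, with c = <x, y>. Since <x, x> cannot be
    inverted in A, t is a real number chosen after applying p: the inverse of p <x, x>, or a large
    number when p <x, x> = 0. *)
Lemma cauchy_schwarz_sqr x y : C x -> C y ->
  p (ip x y) * p (ip x y) <= p (ip x x) * p (ip y y).
Proof.
move=> xC yC; set c := ip x y; set al := p (ip x x).
have al0 : 0 <= al by exact: cs_ge0.
have key (t : R) : 0 <= t -> 2 * t * (p c * p c) <= p (ip y y) + t * t * al * (p c * p c).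
  move=> t0; pose w := y - t%:C *: act x c.
  have cx : C (act x c) by exact: sh_car_act.
  have ctx : C (t%:C *: act x c) by exact: sh_carZ.
  have wC : C w by exact: sh_carB.
  have cc : star c ** c = ip y x ** c by rewrite sh_ip_star.
  have e : ip y y + (t * t)%:C *: (star c ** (ip x x ** c)) =
      (2 * t)%:C *: (star c ** c) + ip w w.
    rewrite {2}/w sh_ipBr// sh_ipZr// sh_ip_act// /w.
    have -> : ip (y - t%:C *: act x c) y = ip y y - t%:C *: (star c ** c).
      rewrite -(sh_ip_star hE yC wC) sh_ipBr// sh_ipZr// sh_ip_act// -cc.
      by rewrite starB starZr starM starK sh_ip_star.
    have -> : ip (y - t%:C *: act x c) x = ip y x - t%:C *: (star c ** ip x x).
      rewrite -(sh_ip_star hE xC wC) sh_ipBr// sh_ipZr// sh_ip_act//.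
      by rewrite starB starZr starM !sh_ip_star.
    rewrite amulBl -cc amulZl scalerBr scalerA -rmorphM/= amulA.
    rewrite (_ : 2 * t = t + t); last by ring.
    rewrite rmorphD/= scalerDl opprB !addrA -[RHS]addrA.
    move: (ip y y) (_ *: (_ ** _ ** c)) (t%:C *: _) => u v s.
    by rewrite addrA [RHS](ACl (3*5*(1*4)*(2*6)))/= !subrr !addr0.
  have := cs_le_positiveD (SA_complete A) Sp
    (positiveZ (mulr_ge0 (ler0n R 2) t0) (ex_intro _ c erefl))
    (sh_ip_ge0 hE wC).
  rewrite -e (csZr hp) ger0_norm ?mulr_ge0// (csC hp) => /le_trans; apply.
  apply: le_trans (csD hp _ _) _; rewrite lerD2l (csZr hp) ger0_norm ?mulr_ge0//.
  rewrite -(mulrA (t * t)) ler_wpM2l ?mulr_ge0//.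
  have := csM_le hp (lexx (p (star c))) (csM hp (ip x x) c).
  by rewrite (cs_star hp) -/al; rewrite mulrCA.
have [a0|a0] := eqVneq al 0.
  rewrite a0 mul0r; have y0 := cs_ge0 hp (ip y y).
  have c0 := cs_ge0 hp c.
  rewrite leNgt; apply/negP => cc0.
  have := key ((p (ip y y) + 1) / (p c * p c)) (divr_ge0 (addr_ge0 y0 ler01) (ltW cc0)).
  rewrite a0 mulr0 mul0r addr0 -mulrA divfK ?gt_eqF//; lra.
have {}al0 : 0 < al by rewrite lt_neqAle eq_sym a0.
have := key al^-1; rewrite invr_ge0 => /(_ (ltW al0)).
rewrite (_ : al^-1 * al^-1 * al = al^-1); last by field.
move=> h.
have := ler_wpM2l (ltW al0) h.
have -> : al * (2 / al * (p c * p c)) = 2 * (p c * p c) by field.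
have -> : al * (p (ip y y) + al^-1 * (p c * p c)) = al * p (ip y y) + p c * p c by field.
lra.
Qed.

Lemma mod_seminorm_ge0 x : 0 <= n x. Proof. exact: sqrtr_ge0. Qed.

Lemma mod_seminorm_sqr x : n x * n x = p (ip x x).
Proof. by rewrite -expr2 sqr_sqrtr// cs_ge0. Qed.

Lemma cauchy_schwarz x y : C x -> C y -> p (ip x y) <= n x * n y.
Proof.
move=> xC yC; apply: le_of_sqr; first by rewrite mulr_ge0 ?mod_seminorm_ge0.
by rewrite mulrACA !mod_seminorm_sqr cauchy_schwarz_sqr.
Qed.

Lemma mod_seminormD x y : C x -> C y -> n (x + y) <= n x + n y.
Proof.
move=> xC yC; apply: le_of_sqr; first by rewrite addr_ge0 ?mod_seminorm_ge0.
have xyC : C (x + y) by exact: sh_carD.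
rewrite mod_seminorm_sqr sh_ipDr// !sh_ipDl//.
have h1 := csD hp (ip x x + ip y x) (ip x y + ip y y).
have h2 := csD hp (ip x x) (ip y x); have h3 := csD hp (ip x y) (ip y y).
have h4 := cauchy_schwarz xC yC; have h5 := cauchy_schwarz yC xC.
move: h2 h3; rewrite -!mod_seminorm_sqr; move: h1 h4 h5; lra.
Qed.

Lemma mod_seminormZ z x : C x -> n (z *: x) = complex.Re `|z| * n x.
Proof.
move=> xC; have zx : C (z *: x) by exact: sh_carZ.
rewrite /mod_seminorm sh_ipZr// sh_ipZl// !(csZ hp) mulrA sqrtrM; last first.
  by rewrite mulr_ge0// normc_def/= sqrtr_ge0.
congr (_ * _); rewrite norm_conjC -expr2 sqrtr_sqr ger0_norm//.
by rewrite normc_def/= sqrtr_ge0.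
Qed.

Lemma mod_seminormN x : C x -> n (- x) = n x.
Proof. by move=> xC; rewrite -scaleN1r mod_seminormZ// normrN1 mul1r. Qed.

Lemma mod_seminormB x y : C x -> C y -> n (x - y) <= n x + n y.
Proof. by move=> xC yC; rewrite -(mod_seminormN yC) mod_seminormD//; exact: sh_carN. Qed.

Lemma mod_seminorm_triangle x y y' : C x -> C y -> C y' -> n (x - y') <= n (x - y) + n (y - y').
Proof.
move=> xC yC yC'; have -> : x - y' = (x - y) + (y - y') by rewrite addrA subrK.
by apply: mod_seminormD; exact: sh_carB.
Qed.

Lemma mod_seminorm_act x a : C x -> n (act x a) <= n x * p a.
Proof.
move=> xC; apply: le_of_sqr; first by rewrite mulr_ge0 ?mod_seminorm_ge0 ?(cs_ge0 hp).
have xaC : C (act x a) by exact: sh_car_act.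
rewrite mod_seminorm_sqr sh_ip_act// sh_ip_actl// mulrACA mod_seminorm_sqr.
apply: le_trans (csM hp _ _) _.
rewrite mulrA ler_wpM2r ?(cs_ge0 hp)//; apply: le_trans (csM hp _ _) _.
by rewrite (cs_star hp) mulrC.
Qed.

End one_seminorm.
End semi_inner_product.

Arguments mor_car {R B E F T} m [x] _.
Arguments morD {R B E F T} m [x y] _ _.
Arguments morZ {R B E F T} m z [x] _.
Arguments mor_act {R B E F T} m [x] b _.

(** * Boundedness of adjointable operators *)

Section adjointable_bounded.
Variables (R : realType) (A : locCstarType R).
Local Notation SA := (cstar_seminorms A).
Local Notation A1 := (self_module A).
Variables (T T' : A -> A).
Hypotheses (mT : module_morphism A1 A1 T) (TT' : is_adjoint A1 A1 T T').
Variable p : A -> R.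
Hypothesis Sp : SA p.
Let hp := SA_cs Sp.

Let unit_ball (x : A) := forall q, SA q -> q x <= 1.

Let TD x y : T (x + y) = T x + T y. Proof. by apply: (morD mT). Qed.
Let TZ (z : R[i]) x : T (z *: x) = z *: T x. Proof. by apply: (morZ mT). Qed.
Let TM x y : T (x ** y) = T x ** y. Proof. by apply: (mor_act mT). Qed.
Let TB x y : T (x - y) = T x - T y.
Proof. by rewrite TD -scaleN1r TZ scaleN1r. Qed.

Lemma bounded_of_unit_ball (C : R) : (forall x, unit_ball x -> p (T x) <= C) ->
  exists C', forall x, p (T x) <= C' * p x.
Proof.
move=> hC.
have C0 : 0 <= C.
  by apply: le_trans (hC 0 _); [exact: cs_ge0|move=> q /SA_cs hq; rewrite (cs0 hq)].
(* T x is the sum of T x' and of (T x') x* x. As x'/2 lies in the unit ball of every seminorm, each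
   of the two terms is at most 2C. *)
have h1 x : p x <= 1 -> p (T x) <= 4 * C.
  move=> px; have [x' [xE qx']] := bounded_transform (SA_complete A) x.
  have hx' : p (T x') <= 2 * C.
    have -> : x' = (2 : R)%:C *: ((2^-1 : R)%:C *: x').
      by rewrite scalerA -rmorphM/= mulfV ?pnatr_eq0// scale1r.
    rewrite TZ (csZr hp) gtr0_norm// ler_pM2l//; apply: hC => q Sq.
    rewrite (csZr (SA_cs Sq)) gtr0_norm ?invr_gt0// mulrC ler_pdivrMr// mul1r.
    exact: qx'.
  rewrite [x]xE TD TM; apply: le_trans (csD hp _ _) _.
  have : p (T x' ** (star x ** x)) <= 2 * C * 1.
    by apply: (csM_le hp hx'); rewrite (csC hp) mulr_ile1// (cs_ge0 hp).
  by lra.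
exists (4 * C) => x; have [x0|x0] := eqVneq (p x) 0.
  (* Every multiple k x has p (k x) = 0, so k p (T x) stays below 4C for all k, which forces p (T x)
     = 0. *)
  rewrite x0 mulr0; apply/ler_addgt0Pr => e e0; rewrite add0r.
  pose k := (4 * C) / e + 1.
  have k0 : 0 < k by rewrite ltr_wpDl// divr_ge0 ?mulr_ge0// ltW.
  have := h1 (k%:C *: x); rewrite TZ !(csZr hp) x0 mulr0 gtr0_norm// => /(_ ler01).
  have kE : k * e = 4 * C + e by rewrite /k mulrDl divfK ?gt_eqF// mul1r.
  move=> h; rewrite leNgt; apply/negP => eT.
  have := ltr_pM2l k0 e (p (T x)); rewrite eT kE => /idP; lra.
have {}x0 : 0 < p x by rewrite lt_neqAle eq_sym x0 (cs_ge0 hp).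
have := h1 ((p x)^-1%:C *: x).
rewrite TZ !(csZr hp) gtr0_norm ?invr_gt0// mulVf ?gt_eqF// => /(_ (lexx _)).
by rewrite mulrC ler_pdivrMr.
Qed.

(** The adjoint turns c (T x) into multiplication of x by a fixed element, so these functionals are
    p-bounded before T is known to be. *)
Let phi_bound (c : A) : exists K : R, forall x, p (c ** T x) <= K * p x.
Proof.
exists (p (T' (star c))) => x.
have -> : c ** T x = star (T' (star c)) ** x.
  have := @TT' x (star c) I I; rewrite /= => /(congr1 (@star R A)).
  by rewrite !starM !starK => ->.
by apply: le_trans (csM hp _ _) _; rewrite (cs_star hp).
Qed.

(* Uniform boundedness of the functionals c (T -) with p c <= 1, by Sokal's
   argument: one of c (T (x + y)) and c (T (x - y)) is at least c (T y), so that
   the signs in the sum of the 3^-n y_n can be chosen against cancellation. *)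
Let gliding_hump : (forall C : R, exists2 x, unit_ball x & C < p (T x)) -> False.
Proof.
move=> hT.
(* K is the norm of the functional c (T -) on the unit ball; it is at least n 3^n, and y reaches
   three quarters of it. *)
have hn (n : nat) : exists cyK : A * A * R,
    [/\ p cyK.1.1 <= 1, unit_ball cyK.1.2, n%:R * 3 ^+ n <= cyK.2,
        3 / 4 * cyK.2 <= p (cyK.1.1 ** T cyK.1.2) &
        forall x, unit_ball x -> p (cyK.1.1 ** T x) <= cyK.2].
  have [x ux xT] := hT (n%:R * 3 ^+ n).
  have pT0 : 0 < p (T x) by apply: le_lt_trans xT; rewrite mulr_ge0// exprn_ge0.
  pose c := (p (T x))^-1%:C *: star (T x).
  have pc : p c = 1.
    by rewrite (csZr hp) (cs_star hp) gtr0_norm ?invr_gt0// mulVf// gt_eqF.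
  have pcT : p (c ** T x) = p (T x).
    rewrite /c amulZl (csZr hp) (csC hp) gtr0_norm ?invr_gt0//.
    by rewrite mulrA mulVf ?mul1r// gt_eqF.
  pose X := [set p (c ** T y) | y in unit_ball].
  have [K0 hK0] := phi_bound c.
  have hX : has_sup X.
    split; first by exists (p (c ** T x)), x.
    exists `|K0| => _ [y uy <-]; apply: le_trans (hK0 y) _.
    apply: (@le_trans _ _ (`|K0| * p y)); first by rewrite ler_wpM2r ?(cs_ge0 hp)// ler_norm.
    by rewrite ler_piMr//; exact: uy.
  have Xub y : unit_ball y -> p (c ** T y) <= sup X.
    by move=> uy; apply: sup_upper_bound => //; exists y.
  have K1 := Xub x ux; rewrite pcT in K1.
  have sX0 : 0 < sup X by exact: lt_le_trans K1.
  have [_ [y uy <-] yX] := @sup_adherent _ X (sup X / 4) ltac:(lra) hX.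
  exists (c, y, sup X); split => //=; [by rewrite pc|lra|lra].
have [f hf] := choice hn.
pose c n := (f n).1.1; pose y n := (f n).1.2; pose K n := (f n).2.
pose s n : A := ((3 ^- n : R)%:C) *: y n.
pose step n (x : A) := if p (c n ** T (x - s n)) <= p (c n ** T (x + s n))
  then x + s n else x - s n.
pose u := fix u n := if n is m.+1 then step m (u m) else 0.
have t0 n : 0 < 3 ^- n :> R by rewrite invr_gt0 exprn_gt0.
have hu n : 3 ^- n * (3 / 4 * K n) <= p (c n ** T (u n.+1)).
  have [_ _ _ h4 _] := hf n.
  have hs : 3 ^- n * (3 / 4 * K n) <= p (c n ** T (s n)).
    by rewrite TZ amulZr (csZr hp) gtr0_norm// ler_pM2l.
  apply: le_trans hs _.
  have e2 : (1 + 1)%:C *: (c n ** T (s n)) = c n ** T (u n + s n) - c n ** T (u n - s n).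
    rewrite -amulBr -TB opprB [u n + s n + _]addrC addrA subrK rmorphD/= scalerDl scale1r.
    by rewrite TD amulDr.
  have := csB hp (c n ** T (u n + s n)) (c n ** T (u n - s n)).
  rewrite -e2 (csZr hp) gtr0_norm ?addr_gt0//= /step.
  by case: ifPn => [|]; rewrite -?ltNge; lra.
have us q n : SA q -> q (u n.+1 - u n) <= 3 ^- n.
  move=> Sq; have [_ uy _ _ _] := hf n.
  have qs : q (s n) <= 3 ^- n.
    by rewrite (csZr (SA_cs Sq)) gtr0_norm// ler_piMr ?(ltW (t0 n))//; exact: uy.
  rewrite /= /step; case: ifP => _; first by rewrite addrC addKr.
  by rewrite addrC addKr (csN (SA_cs Sq)).
have uc q n m : SA q -> (n <= m)%N -> q (u m - u n) <= 3 / 2 * (3 ^- n - 3 ^- m).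
  move=> Sq; have hq := SA_cs Sq; elim: m => [|m IHm].
    by rewrite leqn0 => /eqP ->; rewrite !subrr (cs0 hq) mulr0.
  rewrite leq_eqVlt => /predU1P[->|]; first by rewrite !subrr (cs0 hq) mulr0.
  rewrite ltnS => /IHm {}IHm.
  have -> : u m.+1 - u n = (u m.+1 - u m) + (u m - u n) by rewrite addrA subrK.
  have := csD hq (u m.+1 - u m) (u m - u n); have := us q m Sq.
  rewrite exprS invfM; move: (t0 m); lra.
have small (e : R) : 0 < e -> exists n : nat, 3 / 2 * 3 ^- n <= e.
  move=> e0; pose n := (Num.truncn (3 / 2 / e)).+1; exists n.
  have : 3 / 2 / e < n%:R by exact: truncnS_gt.
  have : n%:R <= 3 ^+ n :> R.
    by rewrite -natrX ler_nat ltnW// ltn_expl.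
  move=> h1 h2; rewrite ler_pdivrMr ?exprn_gt0// [X in _ <= X]mulrC -ler_pdivrMr//.
  by rewrite ltW//; exact: lt_le_trans h2 h1.
have [x ux] : exists x, seq_lim SA u x.
  apply: (ccf_complete (SA_complete A)) => q Sq e e0.
  have [n n_e] := small e e0; exists n => m nm.
  have := uc q n m Sq nm; have := t0 m; lra.
have ux' q n : SA q -> q (x - u n) <= 3 / 2 * 3 ^- n.
  move=> Sq; have hq := SA_cs Sq; apply/ler_addgt0Pr => e e0.
  have [m hm] := ux q Sq e e0.
  have := hm (maxn n m) (leq_maxr _ _); have := uc q n (maxn n m) Sq (leq_maxl _ _).
  have := t0 (maxn n m); move: (u (maxn n m)) => v.
  rewrite (cs_distC hq v x) => h0 h1 h2.
  have -> : x - u n = (x - v) + (v - u n) by rewrite addrA subrK.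
  have := csD hq (x - v) (v - u n); lra.
(* The partial sum contributes at least 3/4 of 3^-n K, and the tail, whose size is at most 3^-n / 2,
   removes at most half of 3^-n K. A quarter remains, which is at least n/4. *)
have low n : n%:R / 4 <= p (T x).
  have [pc _ nK _ hK] := hf n.
  have K0 : 0 <= K n by apply: le_trans nK; rewrite mulr_ge0// exprn_ge0.
  have h1 : p (c n ** T (x - u n.+1)) <= 3 ^- n * (2^-1 * K n).
    have -> : x - u n.+1 = (2^-1 * 3 ^- n)%:C *: ((2 * 3 ^+ n)%:C *: (x - u n.+1)).
      rewrite scalerA -rmorphM/= mulrACA mulVf ?pnatr_eq0// mul1r mulVf ?scale1r//.
      by rewrite gt_eqF// exprn_gt0.
    rewrite TZ amulZr (csZr hp) gtr0_norm; last by rewrite mulr_gt0 ?t0// invr_gt0.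
    rewrite [X in _ <= X]mulrCA mulrA ler_pM2l; last by rewrite mulr_gt0 ?t0// invr_gt0.
    apply: hK => q Sq.
    rewrite (csZr (SA_cs Sq)) gtr0_norm; last by rewrite mulr_gt0 ?exprn_gt0.
    have := ux' q n.+1 Sq; rewrite exprS invfM => h.
    have n0 : 0 < 2 * 3 ^+ n :> R by rewrite mulr_gt0 ?exprn_gt0.
    rewrite mulrC -ler_pdivlMr// div1r invfM; lra.
  have h2 : 3 ^- n * (4^-1 * K n) <= p (c n ** T x).
    have -> : T x = T (u n.+1) + T (x - u n.+1) by rewrite -TD addrC subrK.
    have := csB hp (c n ** (T (u n.+1) + T (x - u n.+1))) (c n ** T (x - u n.+1)).
    rewrite {1}amulDr addrK; have := hu n; move: h1; lra.
  have h3 : p (c n ** T x) <= p (T x).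
    by apply: le_trans (csM hp _ _) _; rewrite ler_piMl// (cs_ge0 hp).
  apply: le_trans h3; apply: le_trans h2.
  rewrite mulrCA [X in _ <= X]mulrC ler_pM2r ?invr_gt0// mulrC.
  by rewrite ler_pdivlMr ?exprn_gt0.
have := low (Num.truncn (4 * p (T x))).+1.
have := truncnS_gt (4 * p (T x)); lra.
Qed.

Lemma adjointable_bounded : exists C : R, forall x, p (T x) <= C * p x.
Proof.
have [[C hC]|] := pselect (exists C : R, forall x, unit_ball x -> p (T x) <= C).
  exact: bounded_of_unit_ball hC.
move=> h; exfalso; apply: gliding_hump => C.
apply: contrapT => hx; apply: h; exists C => x ux.
by rewrite leNgt; apply/negP => xC; apply: hx; exists x.
Qed.

End adjointable_bounded.

(** * Adjoints between pre-Hilbert modules *)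

Section pre_hilbert_theory.
Variables (R : realType) (B : preTopStarAlgType R).

Section one_module.
Variable E : ipModule B.
Hypothesis hE : pre_hilbert_module E.
Local Notation C := (car E).
Implicit Types (x y : amb E) (b : B) (z : R[i]).

Lemma carN x : C x -> C (- x).
Proof. by move=> xC; rewrite -scaleN1r; apply: (carZ hE). Qed.

Lemma carB x y : C x -> C y -> C (x - y).
Proof. by move=> xC yC; apply: (carD hE) => //; exact: carN. Qed.

Lemma ipBr x y y' : C x -> C y -> C y' -> ip x (y - y') = ip x y - ip x y'.
Proof.
move=> xC yC yC'; rewrite (ipDr hE)//; last exact: carN.
by rewrite -scaleN1r (ipZr hE)// scaleN1r.
Qed.

Lemma ipDl x x' y : C x -> C x' -> C y -> ip (x + x') y = ip x y + ip x' y.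
Proof.
move=> xC xC' yC; rewrite -(ip_star hE yC (carD hE xC xC')) (ipDr hE)//.
by rewrite starD !(ip_star hE).
Qed.

Lemma ipZl z x y : C x -> C y -> ip (z *: x) y = Num.conj z *: ip x y.
Proof.
move=> xC yC; rewrite -(ip_star hE yC (carZ hE z xC)) (ipZr hE)//.
by rewrite starZ (ip_star hE).
Qed.

Lemma ip_inj x y : C x -> C y -> (forall u, C u -> ip u x = ip u y) -> x = y.
Proof.
move=> xC yC h; have xyC := carB xC yC.
apply/eqP; rewrite -subr_eq0; apply/eqP/(ip_eq0 hE) => //.
by rewrite ipBr// h// subrr.
Qed.

End one_module.

Section two_modules.
Variables E F : ipModule B.
Hypotheses (hE : pre_hilbert_module E) (hF : pre_hilbert_module F).

Lemma is_adjoint_sym T S : (forall x, car E x -> car F (T x)) ->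
  (forall y, car F y -> car E (S y)) -> is_adjoint E F T S -> is_adjoint F E S T.
Proof.
move=> TC SC TS y x yC xC.
rewrite -(ip_star hE xC (SC _ yC)) -TS// (ip_star hF)//; exact: TC.
Qed.

(** Linearity comes for free from an adjoint: T x is determined by the products <u, T x> = <S u, x>,
    which are linear in x. Hence only the adjoint relation is ever checked to prove
    adjointability. *)
Lemma adjoint_morphism T S : (forall x, car E x -> car F (T x)) ->
  (forall y, car F y -> car E (S y)) -> is_adjoint E F T S -> module_morphism E F T.
Proof.
move=> TC SC TS; have ST := is_adjoint_sym TC SC TS; split=> //.
- move=> x y xC yC; apply: (ip_inj hF); [exact/TC/(carD hE)|apply: (carD hF); exact: TC|].
  move=> u uC; rewrite (ipDr hF)//; try exact: TC.
  by rewrite -!ST// ?(ipDr hE)//; [exact: SC|exact: (carD hE)].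
- move=> z x xC; apply: (ip_inj hF); [exact/TC/(carZ hE)|apply: (carZ hF); exact: TC|].
  move=> u uC; rewrite (ipZr hF)//; last exact: TC.
  by rewrite -!ST// ?(ipZr hE)//; [exact: SC|exact: (carZ hE)].
- move=> x b xC; apply: (ip_inj hF); [exact/TC/(car_act hE)|apply: (car_act hF); exact: TC|].
  move=> u uC; rewrite (ip_act hF)//; last exact: TC.
  by rewrite -!ST// ?(ip_act hE)//; [exact: SC|exact: (car_act hE)].
Qed.

Lemma adj_eq T S : (forall y, car F y -> car E (S y)) -> is_adjoint E F T S ->
  forall y, car F y -> adj E F T y = S y.
Proof.
move=> SC TS y yC; apply: xget_subset1.
  by split; [exact: SC|move=> x xC; apply: TS].
move=> u v [uC uP] [vC vP]; apply: (ip_inj hE) => // x xC.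
by rewrite -uP// vP.
Qed.

Lemma adj_spec T : adjointable E F T ->
  (forall y, car F y -> car E (adj E F T y)) /\ is_adjoint E F T (adj E F T).
Proof.
move=> [_ [S [mS TS]]]; have SC := mor_car mS; have e := adj_eq SC TS.
by split=> [y yC|x y xC yC]; rewrite e//; [exact: SC|exact: TS].
Qed.

End two_modules.

Lemma adjointable_of (E F : ipModule B) T S : pre_hilbert_module E -> pre_hilbert_module F ->
  (forall x, car E x -> car F (T x)) -> (forall y, car F y -> car E (S y)) ->
  is_adjoint E F T S -> adjointable E F T.
Proof.
move=> hE hF TC SC TS.
split; first exact: (adjoint_morphism hE hF TC SC TS).
exists S; split => //; apply: (adjoint_morphism hF hE SC TC).
exact: is_adjoint_sym.
Qed.

End pre_hilbert_theory.

(** * Limits of adjointable operators *)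

Section adjointable_limits.
Variables (R : realType) (A : locCstarType R).
Local Notation SA := (cstar_seminorms A).
Local Notation A1 := (self_module A).

Lemma self_pre_hilbert : pre_hilbert_module A1.
Proof.
split => //=.
- by move=> *; rewrite amulDl.
- by move=> *; rewrite amulDr.
- by move=> *; rewrite amulA.
- by move=> *; rewrite amulZl.
- by move=> *; rewrite amulZr.
- by move=> *; rewrite amulDr.
- by move=> *; rewrite amulZr.
- by move=> *; rewrite amulA.
- by move=> *; rewrite starM starK.
- by move=> x _; exists x.
- by move=> x _; split=> [/star_amul_eq0//|->]; rewrite amula0.
Qed.

Lemma self_mod_seminorm p (a : A) : SA p -> mod_seminorm A1 p a = p a.
Proof. by move=> /SA_cs hp; rewrite /mod_seminorm/= (csC hp) -expr2 sqrtr_sqr ger0_norm// cs_ge0. Qed.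

Lemma self_filter_complete (F : set_system A) : ProperFilter F ->
  (forall p, SA p -> forall e : R, 0 < e -> exists2 G, F G & forall x y, G x -> G y -> p (x - y) <= e) ->
  exists l, forall p, SA p -> forall e : R, 0 < e -> F [set x | p (x - l) <= e].
Proof.
move=> FF h; have [] := @locCstar_complete R A F; last first.
  move=> l Fl; exists l => p [hp cp] e e0.
  have : (fun x => p (x - l)) @ F --> p (l - l).
    apply: (@cvg_comp _ _ _ (fun n => n - l) p); last exact: cp.
    apply: (@cvg_comp _ _ _ (fun n => (n, - l)) (fun z : A * A => z.1 + z.2)); last first.
      exact: (@add_continuous A (l, - l)).
    by apply: cvg_pair => //=; exact: cvg_cst.
  rewrite subrr (cs0 hp) => /cvgrPdist_le/(_ e e0); apply: filterS => x.
  by rewrite sub0r normrN ger0_norm// (cs_ge0 hp).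
apply: locCstar_topology => p Sp; have hp := SA_cs Sp; apply/cvgrPdist_le => e e0.
have [G FG hG] := h p Sp e e0.
exists (G, G) => // -[x y] /= [Gx Gy].
by rewrite subr0 sub0r normrN ger0_norm ?hG// (cs_ge0 hp).
Qed.

Section limit.
Variable D : ipModule A.
Hypothesis hD : hilbert_module D.
Let hDp := hD.1.
Let hDs := pre_hilbert_semi hD.1.
Let hA := self_pre_hilbert.

Lemma mod_seminorm_sep x : car D x -> (forall p, SA p -> mod_seminorm D p x = 0) -> x = 0.
Proof.
move=> xC h; apply/(ip_eq0 hDp) => //; apply: cstar_seminorms_sep => p Sp.
by rewrite -(mod_seminorm_sqr Sp) h// mul0r.
Qed.

Lemma module_filter_complete (F : set_system (amb D)) : ProperFilter F -> F (car D) ->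
  (forall p, SA p -> forall e : R, 0 < e -> exists2 G, F G &
    forall x y, G x -> G y -> car D x -> car D y -> mod_seminorm D p (x - y) <= e) ->
  exists2 l, car D l & forall p, SA p -> forall e : R, 0 < e ->
    F [set x | mod_seminorm D p (x - l) <= e].
Proof.
move=> FF FC h; have [] := hD.2 F FF FC.
  move=> _ [p Sp <-]; apply/cvgrPdist_le => e e0; have [G FG hG] := h p Sp e e0.
  exists (G `&` car D, G `&` car D); first by split; exact: filterI.
  move=> [x y] /= [[Gx Cx] [Gy Cy]].
  by rewrite sub0r normrN ger0_norm ?hG// mod_seminorm_ge0.
move=> l lC hl; exists l => // p Sp e e0.
have /cvgrPdist_le/(_ e e0) := hl _ (ex_intro2 _ _ p Sp erefl).
by apply: filterS => x; rewrite sub0r normrN ger0_norm// mod_seminorm_ge0.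
Qed.

Lemma adj_dist_le p (e : R) (s t : A -> amb D) y : SA p -> 0 <= e ->
  adjointable A1 D s -> adjointable A1 D t -> car D y ->
  (forall a, mod_seminorm D p (s a - t a) <= e * p a) ->
  p (adj A1 D s y - adj A1 D t y) <= e * mod_seminorm D p y.
Proof.
move=> Sp e0 as_ at_ yC st; have hp := SA_cs Sp.
have [_ hs] := adj_spec hA as_; have [_ ht] := adj_spec hA at_.
have sC a : car D (s a) := mor_car as_.1 (I : car A1 a).
have tC a : car D (t a) := mor_car at_.1 (I : car A1 a).
set u := _ - _.
have uE : star u ** u = ip (s u - t u) y.
  have -> : ip (s u - t u) y = ip (s u) y - ip (t u) y.
    rewrite -(ip_star hDp yC); last exact: (carB hDp).
    by rewrite (ipBr hDp)// starB !(ip_star hDp).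
  by rewrite hs// ht//= -amulBr.
have [u0|u0] := eqVneq (p u) 0; first by rewrite u0 mulr_ge0 ?mod_seminorm_ge0.
have {}u0 : 0 < p u by rewrite lt_neqAle eq_sym u0 (cs_ge0 hp).
rewrite -(ler_pM2r u0) -(csC hp) uE.
apply: le_trans (cauchy_schwarz hDs Sp (carB hDp (sC u) (tC u)) yC) _.
by rewrite mulrAC ler_wpM2r// mod_seminorm_ge0.
Qed.

(** Along F both t a and t* y converge, the latter because an operator bound passes to adjoints, and
    the adjoint relation survives in the limit. The case D = A gives the completeness of M(A), the
    general case that of M(D). *)
Lemma adjointable_limit (F : set_system (A -> amb D)) : ProperFilter F ->
  F (adjointable A1 D) ->
  (forall p, SA p -> forall e : R, 0 < e -> exists2 G, F G & forall s t, G s -> G t ->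
     adjointable A1 D s -> adjointable A1 D t ->
     forall a, mod_seminorm D p (s a - t a) <= e * p a) ->
  exists2 T, adjointable A1 D T & forall p, SA p -> forall e : R, 0 < e ->
    F [set t | forall a, mod_seminorm D p (t a - T a) <= e * p a].
Proof.
move=> FF Fadj FC.
have tC t a : adjointable A1 D t -> car D (t a).
  by move=> at_; exact: (mor_car at_.1 (I : car A1 a)).
have hT a : exists x, car D x /\ forall p, SA p -> forall e : R, 0 < e ->
    F [set t | mod_seminorm D p (t a - x) <= e].
  have [| |x xC hx] := @module_filter_complete ((fun t => t a) @ F).
  - by apply: (@filterS _ F _ _ _ _ Fadj) => t; exact: tC.
  - move=> p Sp e e0; have hp := SA_cs Sp; have a0 := cs_ge0 hp a.
    have [G FG hG] := FC p Sp (e / (p a + 1)) (divr_gt0 e0 (ltr_wpDl a0 ltr01)).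
    exists ((fun t : A -> amb D => t a) @` (G `&` adjointable A1 D)).
      exact: (@filterS _ F _ _ _ (fun s Gs => ex_intro2 _ _ s Gs erefl) (filterI FG Fadj)).
    move=> _ _ [s [Gs as_] <-] [t [Gt at_] <-] _ _; apply: le_trans (hG s t Gs Gt as_ at_ a) _.
    by rewrite mulrAC ler_pdivrMr ?ltr_wpDl// ler_wpM2l ?(ltW e0)// lerDl.
  - by exists x; split.
have [T HT] := choice hT.
have unif p (e : R) : SA p -> 0 < e -> F [set t | forall a, mod_seminorm D p (t a - T a) <= e * p a].
  move=> Sp e0; have [G FG hG] := FC p Sp e e0.
  apply: filterS (filterI FG Fadj) => t [Gt at_] a.
  apply/ler_addgt0Pr => d d0; have [TC /(_ p Sp d d0) hTa] := HT a.
  have [s [[Gs as_] hs]] := filter_ex (filterI (filterI FG Fadj) hTa).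
  apply: le_trans (mod_seminorm_triangle hDs Sp (tC _ a at_) (tC _ a as_) TC) _.
  by rewrite lerD//; exact: hG.
have hT' y : exists x : A, car D y -> forall p, SA p -> forall e : R, 0 < e ->
    F [set t | p (adj A1 D t y - x) <= e].
  have [yC|yC] := pselect (car D y); last by exists 0.
  have [|x hx] := @self_filter_complete ((fun t => adj A1 D t y) @ F); last by exists x.
  move=> p Sp e e0; have y0 := @mod_seminorm_ge0 _ _ D p y.
  have d0 := divr_gt0 e0 (ltr_wpDl y0 ltr01).
  have [G FG hG] := FC p Sp _ d0.
  exists ((fun t : A -> amb D => adj A1 D t y) @` (G `&` adjointable A1 D)).
    exact: (@filterS _ F _ _ _ (fun s Gs => ex_intro2 _ _ s Gs erefl) (filterI FG Fadj)).
  move=> _ _ [s [Gs as_] <-] [t [Gt at_] <-].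
  apply: le_trans (adj_dist_le Sp (ltW d0) as_ at_ yC (hG s t Gs Gt as_ at_)) _.
  by rewrite mulrAC ler_pdivrMr ?ltr_wpDl// ler_wpM2l ?(ltW e0)// lerDl.
have [T' HT'] := choice hT'.
have TC a : car D (T a) := (HT a).1.
exists T; last by move=> p Sp e e0; exact: unif.
apply: (@adjointable_of _ _ A1 D T T') => // a y _ yC /=.
apply/eqP; rewrite -subr_eq0; apply/eqP/cstar_seminorms_sep => p Sp.
have hp := SA_cs Sp; apply/eqP; rewrite eq_le (cs_ge0 hp) andbT.
have a0 := cs_ge0 hp a; have y0 := @mod_seminorm_ge0 _ _ D p y.
apply: (@le_eps _ _ _ (mod_seminorm D p y + p a + 1)); first by rewrite ltr_wpDl ?addr_ge0.
move=> e e0 _; rewrite add0r.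
have [t [[h1 h2] at_]] := filter_ex
  (filterI (filterI ((HT a).2 p Sp e e0) (HT' y yC p Sp e e0)) Fadj).
have [_ ht] := adj_spec hA at_.
have {}tC := tC t a at_.
have -> : ip (T a) y - star a ** T' y =
    star a ** (adj A1 D t y - T' y) - ip (t a - T a) y.
  have -> : ip (t a - T a) y = ip (t a) y - ip (T a) y.
    rewrite -(ip_star hDp yC); last exact: (carB hDp).
    by rewrite (ipBr hDp)// starB !(ip_star hDp).
  by rewrite ht//= amulBr opprB [RHS]addrC addrA subrK.
apply: le_trans (csB hp _ _) _.
have := csM_le hp (lexx (p (star a))) h2; rewrite (cs_star hp).
have := cauchy_schwarz hDs Sp (carB hDp tC (TC a)) yC.
have : mod_seminorm D p (t a - T a) * mod_seminorm D p y <= e * mod_seminorm D p y.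
  by rewrite ler_wpM2r.
rewrite [p a * e]mulrC; lra.
Qed.

End limit.
End adjointable_limits.

(** * The multiplier algebra *)

Section multiplier_algebra_seminorms.
Variables (R : realType) (A : locCstarType R).
Local Notation SA := (cstar_seminorms A).
Local Notation A1 := (self_module A).
Local Notation M := (multiplier A).
Implicit Types (p : A -> R) (T : M) (a b : A).

Definition mseminorm p (T : M) : R := op_seminorm A1 A1 p T.

Lemma mseminormE p T : SA p -> mseminorm p T = opn p T.
Proof.
move=> Sp; rewrite /mseminorm /op_seminorm /opn; congr sup.
rewrite eqEsubset; split=> r [x /=].
  by case=> _; rewrite !(self_mod_seminorm _ Sp) => px <-; exists x.
by move=> px <-; exists x; rewrite /= ?(self_mod_seminorm _ Sp).
Qed.

Lemma mult_adj T a b : star (T a) ** b = star a ** (star T : M) b.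
Proof. by have [_ h] := adjP (multiplierP T); exact: (h a b I I). Qed.

Lemma multZ T (z : R[i]) a : T (z *: a) = z *: T a.
Proof. have [m _] := multiplierP T; exact: (morZ m z (I : car A1 a)). Qed.

Lemma mult_opbounded p T : SA p -> opbounded p T.
Proof.
move=> Sp; split; first by move=> r x; exact: multZ.
have [m [T' [_ TT']]] := multiplierP T.
exact: adjointable_bounded m TT' _ Sp.
Qed.

Lemma mseminorm_cstar p : SA p -> is_cstar_seminorm (mseminorm p).
Proof.
move=> Sp; have hp := SA_cs Sp.
have b T := mult_opbounded T Sp.
have ge0 (z : R[i]) : 0 <= complex.Re `|z| by rewrite normc_def/= sqrtr_ge0.
have Zle (z : R[i]) T : mseminorm p (z *: T) <= complex.Re `|z| * mseminorm p T.
  by rewrite !mseminormE//; exact: (opn_scale_le hp z (b T)).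
split.
- by move=> S T; rewrite !mseminormE//; exact: (opn_add hp (b S) (b T)).
- move=> z T; apply/eqP; rewrite eq_le; apply/andP; split; first exact: Zle.
  have [->|z0] := eqVneq z 0.
    rewrite normr0 mul0r mseminormE//.
    exact: opn_ge0.
  have : complex.Re `|z| * complex.Re `|z^-1| = 1.
    have : `|z| * `|z^-1| = 1 by rewrite normfV mulfV// normr_eq0.
    by rewrite !normc_def -rmorphM => /(congr1 (@complex.Re R)).
  move=> zz; have := Zle z^-1 (z *: T); rewrite scalerA mulVf// scale1r.
  by move=> /(ler_wpM2l (ge0 z)); rewrite mulrA zz mul1r.
- by move=> S T; rewrite !mseminormE//; exact: (opn_comp hp (b S) (b T)).
- move=> T; rewrite !mseminormE//; apply: (opn_adj hp (mult_adj T) _ (b T)).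
  by move=> r x; exact: multZ.
- move=> T; rewrite !mseminormE// expr2.
  apply: (opn_Cstar hp (mult_adj T) _ (b T)).
  by move=> r x; exact: multZ.
Qed.

Lemma mseminormP p T a : SA p -> p (T a) <= mseminorm p T * p a.
Proof. by move=> Sp; rewrite mseminormE//; exact: (opnP (SA_cs Sp) _ (mult_opbounded T Sp)). Qed.

Lemma mseminorm_le p T (C : R) : SA p -> 0 <= C -> (forall a, p (T a) <= C * p a) ->
  mseminorm p T <= C.
Proof. by move=> Sp C0 h; rewrite mseminormE//; exact: (opn_leM (SA_cs Sp) C0 h). Qed.

Lemma multE (S T : M) : (forall a, S a = T a) -> S = T.
Proof. by move=> ST; apply/val_inj/funext. Qed.

Lemma self_hilbert : hilbert_module A1.
Proof.
split; first exact: self_pre_hilbert.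
move=> F FF _ hF; have [|l hl] := @self_filter_complete _ _ F FF.
  move=> p Sp e e0; have hp := SA_cs Sp.
  have /cvgrPdist_le/(_ e e0) [[P Q] [FP FQ] PQ] := hF _ (ex_intro2 _ _ p Sp erefl).
  exists (P `&` Q) => [|x y [Px _] [_ Qy]]; first exact: filterI.
  have := PQ (x, y) (conj Px Qy).
  by rewrite /= sub0r normrN (self_mod_seminorm _ Sp) ger0_norm// (cs_ge0 hp).
exists l => // _ [p Sp <-]; apply/cvgrPdist_le => e e0.
have hp := SA_cs Sp; apply: filterS (hl p Sp e e0) => x.
by rewrite /= sub0r normrN (self_mod_seminorm _ Sp) ger0_norm// (cs_ge0 hp).
Qed.

End multiplier_algebra_seminorms.

Section multiplier_algebra_topology.
Variables (R : realType) (A : locCstarType R).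
Local Notation SA := (cstar_seminorms A).
Local Notation A1 := (self_module A).
Local Notation M := (multiplier A).
Local Notation I := ((A -> R) * M * R)%type.
Implicit Types (p : A -> R) (T : M) (a b : A).

(** The topology is given by a subbase, so the finitely many balls around T need not be centred at
    T. *)
Lemma multiplier_nbhs_basis T (V : set M) : nbhs T V -> exists l : seq I,
  (forall i, i \in l -> [/\ SA i.1.1, 0 < i.2 & mseminorm i.1.1 (T - i.1.2) < i.2]) /\
  (forall s, (forall i, i \in l -> mseminorm i.1.1 (s - i.1.2) < i.2) -> V s).
Proof.
rewrite nbhsE => -[U [oU UT] UV]; case: oU => D' hD' DU.
move: UT; rewrite -DU => -[W D'W WT].
have [F FD FW] := hD' _ D'W.
exists (enum_fset F); split=> [i iF|s hs].
  move: WT; rewrite -FW => /(_ i iF) /= h.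
  by have := FD i iF; rewrite inE => -[].
apply: UV; rewrite -DU; exists W => //; change (W s); rewrite -FW => i iF; exact: hs.
Qed.

Lemma multiplier_ball_nbhs p T (e : R) : SA p -> 0 < e ->
  nbhs T [set s | mseminorm p (s - T) < e].
Proof.
move=> Sp e0; rewrite nbhsE; exists [set s | mseminorm p (s - T) < e] => //.
split; last by rewrite /= subrr (cs0 (mseminorm_cstar Sp)).
exists [set [set s | mseminorm p (s - T) < e]]; last by rewrite bigcup_set1.
move=> _ ->; exists [fset (p, T, e)]%fset.
  by move=> i; rewrite !inE => /eqP ->.
rewrite eqEsubset; split=> s /=.
  by move=> /(_ (p, T, e)); apply; rewrite /= inE.
by move=> h i /=; rewrite inE => /eqP ->.
Qed.

Lemma mseminorm_continuous p : SA p -> continuous (@mseminorm R A p).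
Proof.
move=> Sp T; have hm := mseminorm_cstar Sp; apply/(@cvgrPdist_lt _ _ _ (nbhs T) (nbhs_filter T)) => e e0.
apply: (@filterS M (nbhs T) (nbhs_filter T) _ _ _ (multiplier_ball_nbhs T Sp e0)) => s /=.
rewrite ltr_norml => h; have := csD hm (T - s) s; have := csD hm (s - T) T.
rewrite !subrK (cs_distC hm T); lra.
Qed.

Lemma mseminorm_SM p : SA p -> cstar_seminorms M (@mseminorm R A p).
Proof. by move=> Sp; split; [exact: mseminorm_cstar|exact: mseminorm_continuous]. Qed.

(** Bounds an arbitrary continuous C*-seminorm of M(A) by finitely many of those induced by S(A), as
    completeness of M(D) must be tested on all of them. *)
Lemma SM_controlled (q : M -> R) : cstar_seminorms M q -> exists (l : seq I) (d : R),
  [/\ 0 < d, forall i, i \in l -> SA i.1.1 &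
      forall e : R, 0 < e -> forall s : M,
        (forall i, i \in l -> mseminorm i.1.1 s <= d * e) -> q s <= e].
Proof.
move=> [hq cq].
have [l [hl hV]] : exists l : seq I,
  (forall i, i \in l -> [/\ SA i.1.1, 0 < i.2 & mseminorm i.1.1 (0 - i.1.2) < i.2]) /\
  (forall s, (forall i, i \in l -> mseminorm i.1.1 (s - i.1.2) < i.2) -> q s < 1).
  apply: (@multiplier_nbhs_basis 0 [set s | q s < 1]).
  have /(@cvgrPdist_lt _ _ _ (nbhs (0 : M)) (nbhs_filter _))/(_ 1 ltr01) := cq 0.
  apply: (@filterS M (nbhs (0 : M)) (nbhs_filter _)) => s.
  by rewrite (cs0 hq) sub0r normrN ger0_norm// (cs_ge0 hq).
(* d is the slack left around 0 in balls that contain 0 without being centred there; adding an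
   element of seminorm at most d stays inside. *)
have [d d0 hd] : exists2 d : R, 0 < d & forall i, i \in l ->
    d + mseminorm i.1.1 (0 - i.1.2) < i.2.
  elim: l hl {hV} => [|i l IHl] hl; first by exists 1.
  have [d d0 hd] := IHl (fun j jl => hl j (mem_behead (s := i :: l) jl)).
  have [_ _ hi] := hl i (mem_head _ _).
  pose d' := (i.2 - mseminorm i.1.1 (0 - i.1.2)) / 2.
  exists (Num.min d d').
    by rewrite lt_min d0 /d' divr_gt0// subr_gt0.
  move=> j; rewrite inE => /predU1P[->|/hd]; last first.
    by apply: le_lt_trans; rewrite lerD2r ge_min lexx.
  have : Num.min d d' <= d' by rewrite ge_min lexx orbT.
  by rewrite /d'; move: hi; lra.
exists l, d; split => // [i /hl[]//|e e0 s hs].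
have hs' i : i \in l -> mseminorm i.1.1 (e^-1%:C *: s - i.1.2) < i.2.
  move=> il; have [Si _ _] := hl i il; have hm := mseminorm_cstar Si.
  apply: le_lt_trans (hd i il).
  have -> : e^-1%:C *: s - i.1.2 = e^-1%:C *: s + (0 - i.1.2) by rewrite sub0r.
  apply: le_trans (csD hm _ _) _; rewrite lerD2r (csZr hm) gtr0_norm ?invr_gt0//.
  by rewrite mulrC ler_pdivrMr//; exact: hs.
have := hV _ hs'; rewrite (csZr hq) gtr0_norm ?invr_gt0// mulrC ltr_pdivrMr// mul1r.
exact: ltW.
Qed.

Lemma multiplier_complete :
  complete_cstar_family [set @mseminorm R A p | p in SA].
Proof.
split.
- by exists (@mseminorm R A (fun=> 0)), (fun=> 0); first exact: SA_zero.
- by move=> _ [p Sp <-]; exact: mseminorm_cstar.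
- move=> T h; apply: multE => a; apply: cstar_seminorms_sep => p Sp; apply/eqP.
  rewrite eq_le (cs_ge0 (SA_cs Sp)) andbT; apply: le_trans (mseminormP T a Sp) _.
  by rewrite h ?mul0r//; exists p.
- move=> u hu; pose F := (fun n => u n : A -> A) @ \oo.
  have [|p Sp e e0|T aT hT] := @adjointable_limit R A A1 (self_hilbert A) F _.
  + by exists 0%N => // n _; exact: multiplierP.
  + have [n hn] := hu _ (ex_intro2 _ _ p Sp erefl) (e / 2) ltac:(lra).
    exists [set t : A -> A | forall a, p (t a - u n a) <= e / 2 * p a].
      exists n => // m /= nm a; apply: le_trans (mseminormP (u m - u n) a Sp) _.
      by rewrite ler_wpM2r ?(cs_ge0 (SA_cs Sp))//; exact: hn.
    move=> s t /= hs ht _ _ a; rewrite (self_mod_seminorm _ Sp).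
    have -> : s a - t a = (s a - u n a) - (t a - u n a) by rewrite opprB addrA subrK.
    have := csB (SA_cs Sp) (s a - u n a) (t a - u n a); have := hs a; have := ht a; lra.
  + pose T' : M := Multiplier (asboolT aT).
    exists T' => _ [p Sp <-] e e0; have [n _ hn] := hT p Sp e e0.
    exists n => m nm; apply: (mseminorm_le Sp (ltW e0)) => a.
    by have := hn m nm a; rewrite (self_mod_seminorm _ Sp).
Qed.

(** Let v = |T| - T, so that v T v + z^2 = 0. The elements (z a)* z a and (v a)* T (v a) of A are
    both positive and add up to 0, so z a = 0 for every a. *)
Lemma multiplier_positive T : star T = T -> (forall a, positive (star a ** T a)) -> positive T.
Proof.
move=> sT pT; have [m [z [sm sz mz]]] := sa_abs_positive multiplier_complete sT.
apply; apply: multE => a; apply: (@star_amul_eq0 R A).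
pose v : M := m - T; have sv : star v = v by rewrite /v starB sm sT.
have e1 : star (v a) ** T (v a) = star a ** (v ** T ** v) a.
  by rewrite (mult_adj v) sv.
have e2 : star (z a) ** z a = star a ** (z ** z) a by rewrite (mult_adj z) sz.
have e0 : star (z a) ** z a + star (v a) ** T (v a) = 0.
  rewrite e1 e2 -amulDr; have -> : (z ** z) a + (v ** T ** v) a = (v ** T ** v + z ** z) a.
    by rewrite addrC.
  by rewrite mz amula0.
apply: cstar_seminorms_sep => p Sp; apply/eqP; rewrite eq_le (cs_ge0 (SA_cs Sp)) andbT.
have := cs_le_positiveD (SA_complete A) Sp (ex_intro _ (z a) erefl) (pT (v a)).
by rewrite e0 (cs0 (SA_cs Sp)).
Qed.

End multiplier_algebra_topology.

(** * Multiplier modules *)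

Section multiplier_module_hilbert.
Variables (R : realType) (A : locCstarType R).
Local Notation SA := (cstar_seminorms A).
Local Notation A1 := (self_module A).
Local Notation M := (multiplier A).
Variable D : ipModule A.
Hypothesis hD : pre_hilbert_module D.
Local Notation MD := (multiplier_module D).
Let hA := self_pre_hilbert A.
Let hDs := pre_hilbert_semi hD.
Implicit Types (s t : A -> amb D) (a b : A).

Lemma mult_inj (S T : M) : (forall a b, star a ** S b = star a ** T b) -> S = T.
Proof. by move=> h; apply: multE => b; apply: amul_inj => a; exact: h. Qed.

Lemma adjointable_car t a : adjointable A1 D t -> car D (t a).
Proof. by move=> at_; exact: (mor_car at_.1 (I : car A1 a)). Qed.

Lemma mult_module_ipE s t b : car MD s -> car MD t ->
  (@ip _ _ MD s t : M) b = adj A1 D s (t b).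
Proof.
move=> as_ at_; have [_ hs] := adj_spec hA as_; have [tC ht] := adj_spec hA at_.
(* The default 0 of [insubd] is not reached: the composite of t and s* is a multiplier, with adjoint
   the composite of s and t*. *)
rewrite /= (insubdK 0 _)//; apply/asboolP.
apply: (@adjointable_of _ _ A1 A1 (adj A1 D s \o t) (adj A1 D t \o s)) => //= x y _ _ /=.
have sy := adjointable_car y as_; have tx := adjointable_car x at_.
have /= <- := ht x (s y) (I : car A1 x) sy.
have /= e := hs y (t x) (I : car A1 y) tx.
by rewrite -(ip_star hD sy tx) e starM starK.
Qed.

(** With [mult_inj], this reduces the identities of the M(A)-valued product to those of D. *)
Lemma mult_module_ip s t a b : car MD s -> car MD t ->
  star a ** (@ip _ _ MD s t : M) b = ip (s a) (t b).
Proof.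
move=> as_ at_; rewrite mult_module_ipE//; have [_ hs] := adj_spec hA as_.
by rewrite hs//; exact: adjointable_car.
Qed.

Lemma mult_module_pre_hilbert : pre_hilbert_module MD.
Proof.
have tC t a : car MD t -> car D (t a) by exact: adjointable_car.
have cD s t : car MD s -> car MD t -> car MD (s + t).
  move=> as_ at_; have [sC hs] := adj_spec hA as_; have [tC' ht] := adj_spec hA at_.
  apply: (@adjointable_of _ _ A1 D (s + t) (fun y => adj A1 D s y + adj A1 D t y)) => //.
    by move=> a _; apply: (carD hD); exact: tC.
  move=> a y _ yC; rewrite fctE (ipDl hD)//; try exact: tC.
  by rewrite hs// ht//= amulDr.
have cZ (z : R[i]) t : car MD t -> car MD (z *: t).
  move=> at_; have [tC' ht] := adj_spec hA at_.
  apply: (@adjointable_of _ _ A1 D (z *: t) (fun y => Num.conj z *: adj A1 D t y)) => //.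
    by move=> a _; apply: (carZ hD); exact: tC.
  move=> a y _ yC; rewrite fctE (ipZl hD)//; last exact: tC.
  by rewrite ht//= amulZr.
have ca t (b : M) : car MD t -> car MD (@act _ _ MD t b).
  move=> at_; have [tC' ht] := adj_spec hA at_.
  apply: (@adjointable_of _ _ A1 D (t \o b) (fun y => (star b : M) (adj A1 D t y))) => //.
    by move=> a _ /=; exact: (tC t (b a)).
  by move=> a y _ yC /=; rewrite ht//= (mult_adj b).
split => //=.
- apply: (@adjointable_of _ _ A1 D 0 (fun=> 0)) => //.
    by move=> a _; exact: (car0 hD).
  move=> a y _ yC /=; rewrite amula0 -(ip_star hD yC (car0 hD)).
  by rewrite (sh_ip0r hDs)// star_0.
- move=> t b c at_; apply/funext => a /=.
  by rewrite fctE (morD at_.1 (x := b a) (y := c a)).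
- move=> z t b at_; apply/funext => a /=.
  by rewrite fctE /= (morZ at_.1 z (x := b a)).
- move=> s t t' as_ at_ at_'; apply: mult_inj => a b.
  rewrite [LHS](mult_module_ip _ _ as_ (cD _ _ at_ at_')) fctE (ipDr hD)//; try exact: tC.
  by rewrite amulDr; congr (_ + _); rewrite -mult_module_ip.
- move=> z s t as_ at_; apply: mult_inj => a b.
  rewrite [LHS](mult_module_ip _ _ as_ (cZ _ _ at_)) fctE (ipZr hD)//; try exact: tC.
  by rewrite amulZr; congr (_ *: _); rewrite -mult_module_ip.
- move=> s t m as_ at_; apply: mult_inj => a b.
  rewrite [LHS](mult_module_ip _ _ as_ (ca _ _ at_)) /=.
  by rewrite -mult_module_ip.
- move=> s t as_ at_; apply: mult_inj => a b.
  rewrite -[LHS]mult_adj -[LHS]starK starM starK [X in star X]mult_module_ip//.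
  by rewrite (ip_star hD) -?mult_module_ip//; exact: tC.
- move=> t at_; apply: multiplier_positive => [|a].
    apply: mult_inj => a b.
    rewrite -[LHS]mult_adj -[LHS]starK starM starK [X in star X]mult_module_ip//.
    by rewrite (ip_star hD) -?mult_module_ip//; exact: tC.
  by rewrite [X in positive X]mult_module_ip//; apply: (ip_ge0 hD); exact: tC.
- move=> t at_; split=> [t0|->].
    apply/funext => a; apply/(ip_eq0 hD); first exact: tC.
    by rewrite -mult_module_ip// [X in _ ** (X : M) _]t0 amula0.
  have c0 : car MD (0 : A -> amb D).
    by rewrite -(scale0r t); exact: cZ.
  apply: mult_inj => a b; rewrite [LHS]mult_module_ip//.
  have -> : (0 : M) b = 0 by [].
  by rewrite amula0; apply: (sh_ip0r hDs); exact: (car0 hD).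
Qed.

(** Together with [mult_module_le], this identifies the seminorm of M(D) induced by p with the
    operator seminorm of t. *)
Lemma mult_module_bound p t (e : R) : SA p -> 0 <= e -> car MD t ->
  (forall a, mod_seminorm D p (t a) <= e * p a) ->
  mseminorm p (@ip _ _ MD t t : M) <= e * e.
Proof.
move=> Sp e0 at_ te; have hp := SA_cs Sp.
apply: mseminorm_le; rewrite ?mulr_ge0// => a; set u := (_ : M) a.
have uE : star u ** u = ip (t u) (t a) by rewrite {2}/u mult_module_ip.
have [u0|u0] := eqVneq (p u) 0; first by rewrite u0 !mulr_ge0// cs_ge0.
have {}u0 : 0 < p u by rewrite lt_neqAle eq_sym u0 (cs_ge0 hp).
rewrite -(ler_pM2r u0) -(csC hp) uE.
apply: le_trans (cauchy_schwarz hDs Sp (adjointable_car u at_) (adjointable_car a at_)) _.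
have -> : e * e * p a * p u = (e * p u) * (e * p a) by ring.
by rewrite ler_pM ?mod_seminorm_ge0.
Qed.

Lemma mult_module_le p t a : SA p -> car MD t ->
  mod_seminorm D p (t a) <= mod_seminorm MD (@mseminorm R A p) t * p a.
Proof.
move=> Sp at_; have hp := SA_cs Sp.
apply: le_of_sqr; first by rewrite mulr_ge0 ?(cs_ge0 hp)// sqrtr_ge0.
rewrite mulrACA -[X in _ <= X * _]expr2 sqr_sqrtr ?(cs_ge0 (mseminorm_cstar Sp))//.
rewrite (mod_seminorm_sqr Sp) -mult_module_ip//.
rewrite mulrA mulrC; apply: (csM_le hp); first by rewrite (cs_star hp).
exact: mseminormP.
Qed.

End multiplier_module_hilbert.

Lemma filter_all (I : eqType) (X : Type) (F : set_system X) (l : seq I) (P : I -> set X) :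
  Filter F -> (forall i, i \in l -> F (P i)) -> F [set x | forall i, i \in l -> P i x].
Proof.
move=> FF; elim: l => [|i l IHl] h; first by apply: filterE => x i.
have h1 := h i (mem_head _ _).
have h2 := IHl (fun j jl => h j (mem_behead (s := i :: l) jl)).
by apply: filterS (filterI h1 h2) => x [xi xl] j; rewrite inE => /predU1P[->//|]; exact: xl.
Qed.

Theorem multiplier_module_hilbert (R : realType) (A : locCstarType R) (D : ipModule A) :
  hilbert_module D -> hilbert_module (multiplier_module D).
Proof.
move=> hD; have hDp := hD.1; have hM := mult_module_pre_hilbert hDp; split => //.
set MD := multiplier_module D in hM *.
move=> F FF FC hF.
have [|p Sp e e0|T aT hT] := @adjointable_limit R A D hD F FF.
- exact: FC.
- have SM : mod_seminorms MD (mod_seminorm MD (@mseminorm R A p)).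
    by exists (@mseminorm R A p) => //; exact: mseminorm_SM.
  have /cvgrPdist_le/(_ e e0) [[P Q] [FP FQ] PQ] := hF _ SM.
  exists (P `&` Q) => [|s t [Ps _] [_ Qt] as_ at_ a]; first exact: filterI.
  have := PQ (s, t) (conj Ps Qt).
  rewrite /= sub0r normrN ger0_norm ?sqrtr_ge0// => h.
  have st : car MD (s - t) by exact: (carB hM).
  apply: le_trans (mult_module_le hDp a Sp st) _.
  by rewrite ler_wpM2r// (cs_ge0 (SA_cs Sp)).
- exists T => // _ [q Sq <-]; apply/cvgrPdist_le => e e0.
  have hq := Sq.1; have [l [d [d0 lS ld]]] := SM_controlled Sq.
  (* The inner square of t - T is then at most eta^2 = d e^2, which [SM_controlled] turns into e^2
     for q, that is, e for the module seminorm. *)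
  pose eta := Num.sqrt d * e.
  have eta0 : 0 < eta by rewrite mulr_gt0// sqrtr_gt0.
  have h : F [set t | forall i, i \in l -> forall a,
      mod_seminorm D i.1.1 (t a - T a) <= eta * i.1.1 a].
    by apply: filter_all => i il; exact: hT (lS i il) _ eta0.
  apply: filterS (filterI h FC) => t [ht at_].
  have tT : car MD (t - T) by exact: (carB hM).
  rewrite sub0r normrN ger0_norm ?sqrtr_ge0//.
  apply: le_of_sqr; first exact: ltW.
  rewrite -[X in X <= _]expr2 sqr_sqrtr ?(cs_ge0 hq)//.
  apply: ld; first exact: mulr_gt0.
  move=> i il; have -> : d * (e * e) = eta * eta.
    by rewrite /eta mulrACA -[Num.sqrt d * _]expr2 sqr_sqrtr// ltW.
  apply: mult_module_bound => //; [exact: lS|exact: ltW|].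
  by move=> a; exact: ht.
Qed.

(** * Transport of a Hilbert module structure along a bijection *)

Section transport.
Variables (R : realType) (B : preTopStarAlgType R) (E F : ipModule B).
Variables (U : amb E -> amb F) (V : amb F -> amb E).
Hypotheses (UD : forall x y, U (x + y) = U x + U y)
  (UZ : forall (z : R[i]) x, U (z *: x) = z *: U x)
  (UK : cancel U V) (VK : cancel V U)
  (Ucar : forall x, car E x <-> car F (U x))
  (Uact : forall x b, car E x -> U (act x b) = act (U x) b)
  (Uip : forall x y, car E x -> car E y -> ip (U x) (U y) = ip x y).
Hypothesis hF : hilbert_module F.

Let hFp := hF.1.
Let UC x : car E x -> car F (U x). Proof. by move/Ucar. Qed.
Let VC y : car F y -> car E (V y). Proof. by move=> yC; apply/Ucar; rewrite VK. Qed.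
Let U0 : U 0 = 0. Proof. by rewrite -(scale0r 0) UZ !scale0r. Qed.
Let UN x : U (- x) = - U x. Proof. by rewrite -scaleN1r UZ scaleN1r. Qed.
Let Uinj := can_inj UK.

Lemma transport_pre_hilbert : pre_hilbert_module E.
Proof.
have cD x y : car E x -> car E y -> car E (x + y).
  by move=> xC yC; apply/Ucar; rewrite UD; apply: (carD hFp); exact: UC.
have cZ (z : R[i]) x : car E x -> car E (z *: x).
  by move=> xC; apply/Ucar; rewrite UZ; apply: (carZ hFp); exact: UC.
have ca x b : car E x -> car E (act x b).
  by move=> xC; apply/Ucar; rewrite Uact//; apply: (car_act hFp); exact: UC.
split => //.
- by apply/Ucar; rewrite U0; exact: (car0 hFp).
- move=> x y b xC yC; apply: Uinj; rewrite Uact ?UD ?Uact//; last exact: cD.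
  by apply: (actDl hFp); exact: UC.
- by move=> x b c xC; apply: Uinj; rewrite UD !Uact//; apply: (actDr hFp); exact: UC.
- move=> x b c xC; apply: Uinj; rewrite !Uact//; last exact: ca.
  by apply: (actA hFp); exact: UC.
- move=> z x b xC; apply: Uinj; rewrite UZ !Uact ?UZ//; last exact: cZ.
  by apply: (actZl hFp); exact: UC.
- by move=> z x b xC; apply: Uinj; rewrite UZ !Uact//; apply: (actZr hFp); exact: UC.
- move=> x y y' xC yC yC'; rewrite -!Uip// ?UD; last exact: cD.
  by apply: (ipDr hFp); exact: UC.
- move=> z x y xC yC; rewrite -!Uip// ?UZ; last exact: cZ.
  by apply: (ipZr hFp); exact: UC.
- move=> x y b xC yC; rewrite -!Uip// ?Uact//; last exact: ca.
  by apply: (ip_act hFp); exact: UC.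
- by move=> x y xC yC; rewrite -!Uip//; apply: (ip_star hFp); exact: UC.
- by move=> x xC; rewrite -Uip//; apply: (ip_ge0 hFp); exact: UC.
- move=> x xC; rewrite -Uip//; split.
    by move/(ip_eq0 hFp (UC xC)) => x0; apply: Uinj; rewrite x0 U0.
  by move=> ->; apply/(ip_eq0 hFp); rewrite U0//; exact: (car0 hFp).
Qed.

Let hE := transport_pre_hilbert.

Lemma transport_hilbert : hilbert_module E.
Proof.
split; first exact: hE.
have sE p x : car E x -> mod_seminorm F p (U x) = mod_seminorm E p x.
  by move=> xC; rewrite /mod_seminorm Uip.
move=> G GG GC hG; have [| |y yC hy] := hF.2 (U @ G) _.
- by apply: (@filterS _ G _ _ _ _ GC) => x; exact: UC.
- move=> _ [p Sp <-]; apply/cvgrPdist_le => e e0.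
  have /cvgrPdist_le/(_ e e0) [[P Q] [GP GQ] PQ] := hG _ (ex_intro2 _ _ p Sp erefl).
  exists (U @` (P `&` car E), U @` (Q `&` car E)).
    by split; apply: (@filterS _ G _ _ _ (fun s Gs => ex_intro2 _ _ s Gs erefl)); exact: filterI.
  move=> [_ _] /= [[x [Px xC] <-] [y [Qy yC] <-]].
  by rewrite -UN -UD sE; [exact: (PQ (x, y))|exact: (carB hE)].
- exists (V y); first exact: VC.
  move=> _ [p Sp <-]; apply/cvgrPdist_le => e e0.
  have /cvgrPdist_le/(_ e e0) h := hy _ (ex_intro2 _ _ p Sp erefl).
  apply: (@filterS _ G _ _ _ _ (@filterI _ G _ _ _ h GC)) => x /= [hx xC].
  have xyC : car E (x - V y) by apply: (carB hE) => //; exact: VC yC.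
  by move: hx; rewrite -[mod_seminorm E p _]sE// UD UN VK.
Qed.

Lemma transport_unitary : unitarily_equivalent E F.
Proof.
have UV : is_adjoint E F U V.
  by move=> x y xC yC; rewrite -Uip ?VK//; exact: VC.
exists U; split; first exact: (adjointable_of hE hFp UC VC UV).
- by move=> x xC; rewrite (adj_eq hE VC UV) ?UK//; exact: UC.
- by move=> y yC; rewrite (adj_eq hE VC UV) ?VK.
Qed.

End transport.

(** * Direct sums *)

Section locally_cstar_limits.
Variables (R : realType) (A : locCstarType R).
Local Notation SA := (cstar_seminorms A).
Implicit Types (u v : nat -> A) (a b : A) (p : A -> R).

Lemma lim_lipschitz (f : A -> A) u a :
  (forall p, SA p -> exists C : R, forall x y, p (f x - f y) <= C * p (x - y)) ->
  seq_lim SA u a -> seq_lim SA (fun n => f (u n)) (f a).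
Proof.
move=> hf ua p Sp e e0; have [C hC] := hf p Sp; have hp := SA_cs Sp.
have C0 : 0 < `|C| + 1 by rewrite ltr_wpDl.
have [n hn] := ua p Sp _ (divr_gt0 e0 C0); exists n => m nm.
apply: le_trans (hC _ _) _; apply: (@le_trans _ _ ((`|C| + 1) * p (u m - a))).
  by rewrite ler_wpM2r ?(cs_ge0 hp)//; apply: le_trans (ler_norm _) _; rewrite lerDl.
by rewrite mulrC -ler_pdivlMr//; exact: hn.
Qed.

Lemma lim_star u a : seq_lim SA u a -> seq_lim SA (fun n => star (u n)) (star a).
Proof.
apply: (@lim_lipschitz (@star R A)) => p Sp; exists 1 => x y.
by rewrite -starB (cs_star (SA_cs Sp)) mul1r.
Qed.

Lemma lim_scale (z : R[i]) u a : seq_lim SA u a -> seq_lim SA (fun n => z *: u n) (z *: a).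
Proof.
apply: (@lim_lipschitz (fun c => z *: c)) => p Sp; exists (complex.Re `|z|) => x y.
by rewrite -scalerBr (csZ (SA_cs Sp)).
Qed.

Lemma lim_amulr b u a : seq_lim SA u a -> seq_lim SA (fun n => u n ** b) (a ** b).
Proof.
apply: (@lim_lipschitz (fun c => c ** b)) => p Sp; exists (p b) => x y.
by rewrite -amulBl mulrC; exact: csM (SA_cs Sp) _ _.
Qed.

Lemma lim_amull b u a : seq_lim SA u a -> seq_lim SA (fun n => b ** u n) (b ** a).
Proof.
apply: (@lim_lipschitz (fun c => b ** c)) => p Sp; exists (p b) => x y.
by rewrite -amulBr; exact: csM (SA_cs Sp) _ _.
Qed.

Lemma lim_add u v a b : seq_lim SA u a -> seq_lim SA v b ->
  seq_lim SA (fun n => u n + v n) (a + b).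
Proof.
move=> ua vb p Sp e e0.
have [n hn] := ua _ Sp (e / 2) ltac:(lra); have [m hm] := vb _ Sp (e / 2) ltac:(lra).
exists (maxn n m) => k; rewrite geq_max => /andP[/hn h1 /hm h2].
rewrite opprD addrACA; have := csD (SA_cs Sp) (u k - a) (v k - b); lra.
Qed.

Lemma lim_le p u a (C : R) : SA p -> (forall n, p (u n) <= C) -> seq_lim SA u a -> p a <= C.
Proof.
move=> Sp uC ua; apply/ler_addgt0Pr => e e0; have [n /(_ n (leqnn _))] := ua _ Sp _ e0.
rewrite (cs_distC (SA_cs Sp)) => /(cs_near (SA_cs Sp)); have := uC n; lra.
Qed.

Lemma cs_sum p (I : Type) (r : seq I) (P : pred I) (f : I -> A) : SA p ->
  p (\sum_(i <- r | P i) f i) <= \sum_(i <- r | P i) p (f i).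
Proof.
move=> /SA_cs hp; elim/big_ind2: _ => //; first by rewrite (cs0 hp).
by move=> a x b y ax by_; apply: le_trans (csD hp _ _) _; exact: lerD.
Qed.

End locally_cstar_limits.

Section direct_sum_hilbert.
Variables (R : realType) (A : locCstarType R) (E : nat -> ipModule A).
Hypothesis hE : forall n, hilbert_module (E n).
Local Notation SA := (cstar_seminorms A).
Local Notation V := (vseq (fun n => amb (E n))).
Local Notation D := (direct_sum E).
Implicit Types (x y : V) (p : A -> R) (m n k : nat).

(** Treating the coordinates from m to n - 1 as a module of its own makes Cauchy-Schwarz and the
    triangle inequality available on tails. All sequences of vectors are allowed, so the carrier is
    the same for all m and n. *)
Definition segment m n : ipModule A :=
  @IPModule R A V [set x | forall k, car (E k) (x k)]
    (fun x a k => act (x k) a)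
    (fun x y => \sum_(m <= k < n) ip (x k) (y k)).

Local Notation C := (car (segment 0 0)).
Local Notation sip m n := (@ip _ _ (segment m n)).
Local Notation sn p m n := (mod_seminorm (segment m n) p).

Let hEp n := (hE n).1.

Lemma segment_semi m n : semi_hilbert (segment m n).
Proof.
split=> /=.
- by move=> k; exact: (car0 (hEp k)).
- by move=> x y xC yC k; exact: (carD (hEp k)).
- by move=> z x xC k; exact: (carZ (hEp k)).
- by move=> x b xC k; exact: (car_act (hEp k)).
- move=> x y y' xC yC yC'; rewrite -big_split /=.
  by apply: eq_bigr => k _; exact: (ipDr (hEp k)).
- move=> z x y xC yC; rewrite scaler_sumr.
  by apply: eq_bigr => k _; exact: (ipZr (hEp k)).
- move=> x y b xC yC; rewrite (big_morph (fun a => a ** b) (fun a c => amulDl a c b) (amul0a b)).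
  by apply: eq_bigr => k _; exact: (ip_act (hEp k)).
- move=> x y xC yC; rewrite (big_morph (@star R A) (@starD R A) (star_0 A)).
  by apply: eq_bigr => k _; exact: (ip_star (hEp k)).
- move=> x xC; apply: (positive_sum (SA_complete A)) => k _.
  exact: (ip_ge0 (hEp k)).
Qed.

Lemma segment_cat m n x y : (m <= n)%N -> sip 0 m x y + sip m n x y = sip 0 n x y.
Proof. by move=> mn; rewrite /= -big_cat_nat. Qed.

Lemma segment_sub m n x y : (m <= n)%N -> sip 0 n x y - sip 0 m x y = sip m n x y.
Proof. by move=> mn; rewrite -(segment_cat _ _ mn) addrC addKr. Qed.

(** The Cauchy criterion for the series of the <x_k, x_k>, phrased with seminorms of tails: these
    are subadditive, which is how a sum of two summable sequences is seen to be summable. *)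
Definition small_tails x := forall p, SA p -> forall e : R, 0 < e ->
  exists N, forall m n, (N <= m)%N -> (m <= n)%N -> sn p m n x <= e.

Lemma segment_lim x y : C x -> C y -> small_tails x -> small_tails y ->
  exists l, seq_lim SA (fun n => sip 0 n x y) l.
Proof.
move=> xC yC xt yt; apply: (ccf_complete (SA_complete A)) => p Sp e e0.
have [N hN] := xt p Sp 1 ltr01; have [N' hN'] := yt p Sp e e0.
exists (maxn N N') => m nm; rewrite segment_sub//.
apply: le_trans (cauchy_schwarz (segment_semi (maxn N N') m) Sp xC yC) _.
rewrite -[e]mul1r ler_pM ?mod_seminorm_ge0//.
  by apply: hN => //; rewrite leq_maxl.
by apply: hN' => //; rewrite leq_maxr.
Qed.

Lemma direct_sum_car x : car D x <-> C x /\ small_tails x.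
Proof.
split=> [[xC [l /cvg_seq_lim xl]]|[xC xt]].
  split => // p Sp e e0; have hp := SA_cs Sp.
  have [N hN] := xl p Sp (e * e / 2) ltac:(by rewrite divr_gt0// mulr_gt0).
  exists N => m n Nm mn; apply: le_of_sqr; first exact: ltW.
  rewrite (mod_seminorm_sqr Sp) -segment_sub//.
  have h1 := hN m Nm; have h2 := hN n (leq_trans Nm mn).
  have -> : sip 0 n x x - sip 0 m x x = (sip 0 n x x - l) - (sip 0 m x x - l).
    by rewrite opprB addrA subrK.
  apply: le_trans (csB hp _ _) _.
  rewrite (_ : e * e = e * e / 2 + e * e / 2); last by field.
  exact: lerD.
split => //; have [l xl] := segment_lim xC xC xt xt.
by exists l; apply/cvg_seq_lim.
Qed.

Lemma direct_sum_lim x y : car D x -> car D y ->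
  seq_lim SA (fun n => sip 0 n x y) (@ip _ _ D x y).
Proof.
move=> /direct_sum_car[xC xt] /direct_sum_car[yC yt].
have [l xl] := segment_lim xC yC xt yt; apply/cvg_seq_lim.
have /= := @xgetPex _ (0 : A) [set l : A | series (fun n => ip (x n) (y n)) @ \oo --> l].
by apply; exists l; apply/cvg_seq_lim.
Qed.

(** The rest of the series is a limit of sums over the complementary segments, hence positive, and
    seminorms are monotone on positive elements. *)
Lemma segment_le p m n x : SA p -> (m <= n)%N -> car D x -> sn p m n x <= mod_seminorm D p x.
Proof.
move=> Sp mn xD; have hp := SA_cs Sp.
have [xC _] := (direct_sum_car x).1 xD.
rewrite /mod_seminorm ler_sqrt ?(cs_ge0 hp)//.
have pr : positive (@ip _ _ D x x - sip m n x x).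
  apply: (positive_lim (SA_complete A) (u := fun N => sip 0 m x x + sip n N x x)).
    move=> N; apply: (positiveD (SA_complete A)); first exact: (sh_ip_ge0 (segment_semi 0 m)).
    exact: (sh_ip_ge0 (segment_semi n N)).
  move=> q Sq e e0; have [N hN] := direct_sum_lim xD xD Sq e0.
  exists (maxn N n) => k; rewrite geq_max => /andP[/hN h nk].
  apply: le_trans h; rewrite -(segment_cat x x nk) -(segment_cat x x mn).
  by rewrite opprB !addrA (addrAC _ _ (sip n k x x)) le_eqVlt eqxx.
have := cs_le_positiveD (SA_complete A) Sp (sh_ip_ge0 (segment_semi m n) xC) pr.
by rewrite addrC subrK.
Qed.

Lemma direct_sum_le p x (e : R) : SA p -> 0 <= e -> car D x -> (forall n, sn p 0 n x <= e) ->
  mod_seminorm D p x <= e.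
Proof.
move=> Sp e0 xD h; apply: le_of_sqr => //; rewrite /mod_seminorm -expr2 sqr_sqrtr; last first.
  exact: cs_ge0 (SA_cs Sp) _.
apply: (lim_le Sp) _ (direct_sum_lim xD xD) => n.
by rewrite -(mod_seminorm_sqr Sp) ler_pM ?mod_seminorm_ge0.
Qed.

Lemma coordinate_seminorm p k x : mod_seminorm (E k) p (x k) = sn p k k.+1 x.
Proof. by rewrite /mod_seminorm /= big_nat1. Qed.

Lemma small_tailsD x y : C x -> C y -> small_tails x -> small_tails y -> small_tails (x + y).
Proof.
move=> xC yC xt yt p Sp e e0.
have [N hN] := xt p Sp (e / 2) ltac:(lra); have [N' hN'] := yt p Sp (e / 2) ltac:(lra).
exists (maxn N N') => m n; rewrite geq_max => /andP[Nm N'm] mn.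
apply: le_trans (mod_seminormD (segment_semi m n) Sp xC yC) _.
have := hN m n Nm mn; have := hN' m n N'm mn; lra.
Qed.

Lemma small_tails_le x y : (forall p, SA p -> exists K : R, forall m n, (m <= n)%N ->
  sn p m n y <= K * sn p m n x) -> small_tails x -> small_tails y.
Proof.
move=> h xt p Sp e e0; have [K hK] := h p Sp.
have K0 : 0 < `|K| + 1 by rewrite ltr_wpDl.
have [N hN] := xt p Sp _ (divr_gt0 e0 K0).
exists N => m n Nm mn; apply: le_trans (hK m n mn) _.
apply: (@le_trans _ _ ((`|K| + 1) * sn p m n x)).
  by rewrite ler_wpM2r ?mod_seminorm_ge0//; apply: le_trans (ler_norm _) _; rewrite lerDl.
by rewrite mulrC -ler_pdivlMr//; exact: hN.
Qed.

Lemma direct_sum_pre_hilbert : pre_hilbert_module D.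
Proof.
have cD x y : car D x -> car D y -> car D (x + y).
  move=> /direct_sum_car[xC xt] /direct_sum_car[yC yt]; apply/direct_sum_car; split.
    exact: (sh_carD (segment_semi 0 0)).
  exact: small_tailsD.
have cZ (z : R[i]) x : car D x -> car D (z *: x).
  move=> /direct_sum_car[xC xt]; apply/direct_sum_car; split.
    exact: (sh_carZ (segment_semi 0 0)).
  apply: small_tails_le xt => p Sp; exists (complex.Re `|z|) => m n mn.
  by rewrite (mod_seminormZ (segment_semi m n) Sp).
have ca x a : car D x -> car D (@act _ _ D x a).
  move=> /direct_sum_car[xC xt]; apply/direct_sum_car; split.
    exact: (sh_car_act (segment_semi 0 0)).
  apply: small_tails_le xt => p Sp; exists (p a) => m n mn.
  by rewrite mulrC; exact: (mod_seminorm_act (segment_semi m n) Sp).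
have uniq u a b : seq_lim SA u a -> seq_lim SA u b -> a = b by exact: seq_lim_SA_unique.
have tC x : car D x -> C x by case/direct_sum_car.
split => //.
- apply/direct_sum_car; split; first exact: (sh_car0 (segment_semi 0 0)).
  move=> p Sp e e0; exists 0%N => m n _ _; rewrite -(scale0r 0).
  rewrite (mod_seminormZ (segment_semi m n) Sp) ?normr0 ?mul0r ?ltW//.
  exact: (sh_car0 (segment_semi 0 0)).
- move=> x y b /tC xC /tC yC; apply: functional_extensionality_dep => k.
  exact: (actDl (hEp k)).
- move=> x b c /tC xC; apply: functional_extensionality_dep => k.
  exact: (actDr (hEp k)).
- move=> x b c /tC xC; apply: functional_extensionality_dep => k.
  exact: (actA (hEp k)).
- move=> z x b /tC xC; apply: functional_extensionality_dep => k.
  exact: (actZl (hEp k)).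
- move=> z x b /tC xC; apply: functional_extensionality_dep => k.
  exact: (actZr (hEp k)).
- move=> x y y' xD yD yD'; apply: uniq (direct_sum_lim xD (cD _ _ yD yD')) _.
  have := lim_add (direct_sum_lim xD yD) (direct_sum_lim xD yD').
  congr seq_lim; apply/funext => n.
  by rewrite (sh_ipDr (segment_semi 0 n)) //; exact: tC.
- move=> z x y xD yD; apply: uniq (direct_sum_lim xD (cZ _ _ yD)) _.
  have := lim_scale z (direct_sum_lim xD yD).
  congr seq_lim; apply/funext => n.
  by rewrite (sh_ipZr (segment_semi 0 n)) //; exact: tC.
- move=> x y b xD yD; apply: uniq (direct_sum_lim xD (ca _ _ yD)) _.
  have := lim_amulr b (direct_sum_lim xD yD).
  congr seq_lim; apply/funext => n.
  by rewrite -(sh_ip_act (segment_semi 0 n)) //; exact: tC.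
- move=> x y xD yD; apply: uniq (direct_sum_lim yD xD).
  have := lim_star (direct_sum_lim xD yD).
  congr seq_lim; apply/funext => n.
  by rewrite (sh_ip_star (segment_semi 0 n)) //; exact: tC.
- move=> x xD; apply: (positive_lim (SA_complete A) _ (direct_sum_lim xD xD)) => n.
  by apply: (sh_ip_ge0 (segment_semi 0 n)); exact: tC.
- move=> x xD; split=> [x0|->].
    apply: functional_extensionality_dep => k; have xC := tC _ xD.
    apply: (mod_seminorm_sep (hE k) (xC k)) => p Sp.
    rewrite coordinate_seminorm; apply/eqP; rewrite eq_le mod_seminorm_ge0 andbT.
    apply: le_trans (segment_le Sp (leqnSn k) xD) _.
    by rewrite /mod_seminorm x0 (cs0 (SA_cs Sp)) sqrtr0.
  have zD : car D 0 by rewrite -(scale0r x); exact: cZ.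
  apply: uniq (direct_sum_lim zD zD) _ => p Sp e e0; exists 0%N => n _.
  rewrite (sh_ip0r (segment_semi 0 n)) ?subrr ?(cs0 (SA_cs Sp)) ?ltW//.
  exact: (sh_car0 (segment_semi 0 0)).
Qed.

Theorem direct_sum_hilbert : hilbert_module D.
Proof.
have hD := direct_sum_pre_hilbert; split => //.
have tC x : car D x -> C x by case/direct_sum_car.
move=> F FF FC hF.
have cF p (e : R) : SA p -> 0 < e -> exists2 G, F G &
    forall x y, G x -> G y -> mod_seminorm D p (x - y) <= e.
  move=> Sp e0.
  have /cvgrPdist_le/(_ e e0) [[P Q] [FP FQ] PQ] := hF _ (ex_intro2 _ _ p Sp erefl).
  exists (P `&` Q) => [|x y [Px _] [_ Qy]]; first exact: filterI.
  have := PQ (x, y) (conj Px Qy).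
  by rewrite /= sub0r normrN ger0_norm ?sqrtr_ge0.
have hk k : exists xk, car (E k) xk /\ forall p, SA p -> forall e : R, 0 < e ->
    F [set z : V | mod_seminorm (E k) p (z k - xk) <= e].
  have [| |xk xkC hxk] := @module_filter_complete R A (E k) (hE k) ((fun z : V => z k) @ F) _.
  - by apply: (@filterS _ F _ _ _ _ FC) => z /tC; apply.
  - move=> p Sp e e0; have [G FG hG] := cF p e Sp e0.
    exists ((fun z : V => z k) @` (G `&` car D)).
      exact: (@filterS _ F _ _ _ (fun s Gs => ex_intro2 _ _ s Gs erefl) (filterI FG FC)).
    move=> _ _ [x [Gx xD] <-] [y [Gy yD] <-] _ _.
    have xyD : car D (x - y) by exact: (carB hD).
    rewrite (_ : x k - y k = (x - y) k)// coordinate_seminorm.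
    by apply: le_trans (segment_le Sp (leqnSn k) xyD) _; exact: hG.
  - by exists xk.
pose x : V := fun k => projT1 (cid (hk k)).
have xk k := projT2 (cid (hk k)).
have xC : C x by move=> k; exact: (xk k).1.
(* The coordinatewise limit x is not yet known to lie in D, so it is compared with y on finite
   segments only. An intermediate z is near y in D and within eta of x at each coordinate; fewer
   than n + 1 coordinates contribute eta^2 each, at most d^2 altogether. *)
have close p (e : R) G m n y : SA p -> F G ->
    (forall x y, G x -> G y -> mod_seminorm D p (x - y) <= e) ->
    G y -> car D y -> (m <= n)%N -> sn p m n (y - x) <= e.
  move=> Sp FG hG Gy yD mn; apply/ler_addgt0Pr => d d0.
  pose eta := d / n.+1%:R; have eta0 : 0 < eta by rewrite divr_gt0.
  have h : F [set z | forall k, k \in iota m (n - m) -> mod_seminorm (E k) p (z k - x k) <= eta].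
    by apply: filter_all => k _; exact: (xk k).2.
  have [z [[Gz zD] hz]] := filter_ex (filterI (filterI FG FC) h).
  have yzD : car D (y - z) by exact: (carB hD).
  apply: le_trans (mod_seminorm_triangle (segment_semi m n) Sp (tC _ yD) (tC _ zD) xC) _.
  apply: lerD; first by apply: le_trans (segment_le Sp mn yzD) _; exact: hG.
  have zxC : C (z - x) by apply: (sh_carB (segment_semi 0 0)) => //; exact: tC.
  apply: le_of_sqr; first exact: ltW.
  rewrite (mod_seminorm_sqr Sp) /=.
  apply: le_trans (cs_sum _ _ _ Sp) _.
  apply: (@le_trans _ _ (\sum_(m <= k < n) eta * eta)).
    apply: ler_sum_nat => k /andP[mk kn].
    rewrite -(mod_seminorm_sqr Sp) ler_pM ?mod_seminorm_ge0//.
      by apply: hz; rewrite mem_iota mk subnKC.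
    by apply: hz; rewrite mem_iota mk subnKC.
  rewrite sumr_const_nat -mulr_natr.
  have dE : d = eta * n.+1%:R by rewrite /eta divfK// pnatr_eq0.
  clearbody eta; rewrite dE mulrACA ler_pM2l ?mulr_gt0//.
  rewrite -natrM ler_nat; apply: leq_trans (leq_subr _ _) _.
  by rewrite mulSn leqW// leq_addr.
(* On every segment x is within e/2 of some y in D, so its tails inherit smallness from those of
   y. *)
have xD : car D x.
  apply/direct_sum_car; split => // p Sp e e0.
  have [G FG hG] := cF p (e / 2) Sp ltac:(by rewrite divr_gt0).
  have [y [Gy yD]] := filter_ex (filterI FG FC).
  have [yC yt] := (direct_sum_car y).1 yD.
  have [N hN] := yt p Sp (e / 2) ltac:(by rewrite divr_gt0).
  exists N => m n Nm mn; have -> : x = y - (y - x) by rewrite opprB addrC subrK.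
  have yxC : C (y - x) by exact: (sh_carB (segment_semi 0 0)).
  apply: le_trans (mod_seminormB (segment_semi m n) Sp yC yxC) _.
  rewrite [e]splitr; apply: lerD; first exact: hN.
  exact: close Sp FG hG Gy yD mn.
exists x => // _ [p Sp <-]; apply/cvgrPdist_le => e e0.
have [G FG hG] := cF p e Sp e0.
apply: (@filterS _ F _ _ _ _ (filterI FG FC)) => y [Gy yD].
rewrite sub0r normrN ger0_norm ?sqrtr_ge0//.
apply: direct_sum_le => //; [exact: ltW|exact: (carB hD)|move=> n].
exact: close Sp FG hG Gy yD (leq0n n).
Qed.

End direct_sum_hilbert.

Section strict_direct_sum.
Variables (R : realType) (A : locCstarType R) (E : nat -> ipModule A).
Hypothesis hE : forall n, hilbert_module (E n).
Local Notation SA := (cstar_seminorms A).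
Local Notation A1 := (self_module A).
Local Notation M := (multiplier A).
Local Notation V := (vseq (fun n => amb (E n))).
Local Notation D := (direct_sum E).
Local Notation MD := (multiplier_module D).
Local Notation ME k := (multiplier_module (E k)).
Local Notation SDS := (strict_direct_sum E).
Local Notation C := (car (segment E 0 0)).
Local Notation sip m n := (@ip _ _ (segment E m n)).
Local Notation sn p m n := (mod_seminorm (segment E m n) p).
Implicit Types (p : A -> R) (a b : A).

Let hEp n := (hE n).1.
Let hD := direct_sum_hilbert hE.
Let hDp := hD.1.
Let hA := self_pre_hilbert A.
Let sC x (xD : car D x) : C x := ((direct_sum_car hE x).1 xD).1.

Definition to_sum (t : amb SDS) : amb MD := fun a n => t n a.
Definition of_sum (T : amb MD) : amb SDS := fun n a => T a n.

Definition single k (y : amb (E k)) : V := dfwith (fun j => 0 : amb (E j)) y.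

Lemma ip_single k (x : V) (y : amb (E k)) n : C x -> car (E k) y -> (k < n)%N ->
  sip 0 n x (single y) = ip (x k) y.
Proof.
move=> xC yC kn; rewrite /= (bigD1_seq k) ?mem_index_iota ?iota_uniq//=.
rewrite /single dfwith_in big1 ?addr0// => j jk.
by rewrite dfwith_out 1?eq_sym//; apply: (sh_ip0r (pre_hilbert_semi (hEp j))).
Qed.

Lemma single_car k (y : amb (E k)) : car (E k) y -> car D (single y).
Proof.
move=> yC; have yC' : C (single y).
  by move=> j; rewrite /single; case: dfwithP => // i _; exact: (car0 (hEp i)).
apply/(direct_sum_car hE); split => // p Sp e e0; exists k.+1 => m n km mn.
rewrite /mod_seminorm /= big_nat_cond big1 ?(cs0 (SA_cs Sp)) ?sqrtr0 ?ltW// => j.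
rewrite andbT => /andP[mj _]; rewrite {2}/single dfwith_out.
  by apply: (sh_ip0r (pre_hilbert_semi (hEp j))); exact: yC'.
by rewrite neq_ltn (leq_trans km mj).
Qed.

(** The adjoint of the k-th coordinate is T* after the inclusion of E_k: the series of <T a,
    [single y]> is constant past index k. *)
Lemma of_sum_adjointable (T : amb MD) k : car MD T -> car (ME k) (of_sum T k).
Proof.
move=> aT; have [TC hT] := adj_spec hA aT.
have TD a : car D (T a) := adjointable_car a aT.
apply: (@adjointable_of _ _ A1 (E k) (of_sum T k) (fun y => adj A1 D T (single y))) => //.
  by move=> a _; exact: (sC (TD a)).
move=> a y _ yC; have yD := single_car yC; rewrite -hT//.
apply: seq_lim_SA_unique (direct_sum_lim hE (TD a) yD) => p Sp e e0.
exists k.+1 => n kn; rewrite ip_single//; last exact: sC.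
by rewrite subrr (cs0 (SA_cs Sp)) ltW.
Qed.

Lemma mult_sum (I : Type) (r : seq I) (f : I -> M) a :
  (\sum_(i <- r) f i) a = \sum_(i <- r) f i a.
Proof. by elim/big_rec2: _ => // i x y _ <-. Qed.

Lemma amul_sumr (I : Type) (r : seq I) (f : I -> A) a :
  a ** (\sum_(i <- r) f i) = \sum_(i <- r) a ** f i.
Proof. exact: (big_morph (fun b => a ** b) (amulDr a) (amula0 a)). Qed.

Lemma strict_seriesE (t s : amb SDS) n a b : (forall k, car (ME k) (t k)) ->
  (forall k, car (ME k) (s k)) ->
  star a ** (series (fun k => @ip _ _ (ME k) (t k) (s k)) n : M) b =
  sip 0 n (to_sum t a) (to_sum s b).
Proof.
move=> tC s_C; rewrite seriesEnat [X in _ ** X]mult_sum amul_sumr.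
by apply: eq_bigr => k _; rewrite (mult_module_ip (hEp k)).
Qed.

Lemma strict_cvg_lim (u : nat -> M) (l : M) : strict_cvg u l ->
  forall a, seq_lim SA (fun n => u n a) (l a).
Proof.
move=> ul a p Sp e e0.
have q : strict_seminorms A1 (fun t => mod_seminorm A1 p (t a) + p (adj A1 A1 t a)).
  by exists p, a, a.
have /cvgrPdist_le/(_ e e0) [n _ hn] := ul _ q; exists n => m nm.
have := hn m nm; rewrite /= sub0r normrN (self_mod_seminorm _ Sp).
rewrite ger0_norm; last by rewrite addr_ge0 ?(cs_ge0 (SA_cs Sp)).
by apply: le_trans; rewrite lerDl (cs_ge0 (SA_cs Sp)).
Qed.

Lemma strict_cvg_unique (u : nat -> M) (l l' : M) : strict_cvg u l -> strict_cvg u l' -> l = l'.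
Proof.
move=> ul ul'; apply: multE => a.
exact: seq_lim_SA_unique (strict_cvg_lim ul a) (strict_cvg_lim ul' a).
Qed.

Section inner_product.
Variables T S : amb MD.
Hypotheses (aT : car MD T) (aS : car MD S).
Local Notation u T S := (series (fun k => @ip _ _ (ME k) (of_sum T k) (of_sum S k))).

Lemma strict_series_lim a : seq_lim SA (fun n => (u T S n : M) a) ((@ip _ _ MD T S : M) a).
Proof.
move=> p Sp e e0; have hp := SA_cs Sp.
pose K := mod_seminorm MD (@mseminorm R A p) T.
have K0 : 0 <= K by exact: sqrtr_ge0.
have TD b : car D (T b) := adjointable_car b aT.
have SD b : car D (S b) := adjointable_car b aS.
(* A tail below e / (K + 1) absorbs the bound K of T, and the added 1 covers K = 0. *)
have d0 : 0 < e / (K + 1) by rewrite divr_gt0// ltr_wpDl.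
have [N hN] := ((direct_sum_car hE _).1 (SD a)).2 p Sp _ d0.
exists N => m Nm; set w := _ - _.
have ww : p (star w ** w) <= mod_seminorm D p (T w) * (e / (K + 1)).
  rewrite {2}/w amulBr strict_seriesE; try by move=> k; exact: of_sum_adjointable.
  rewrite (mult_module_ip hDp _ _ aT aS) /to_sum /of_sum.
  (* Up to d, the full inner product is its n-th partial sum, so Cauchy-Schwarz is applied on the
     segment from m to n only. *)
  apply/ler_addgt0Pr => d dd0.
  have [n0 hn0] := direct_sum_lim hE (TD w) (SD a) Sp dd0.
  pose n := maxn m n0; have mn : (m <= n)%N by rewrite leq_maxl.
  have hn := hn0 n (leq_maxr _ _); rewrite (cs_distC hp) in hn.
  have -> : sip 0 m (T w) (S a) - @ip _ _ D (T w) (S a) =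
      - sip m n (T w) (S a) - (@ip _ _ D (T w) (S a) - sip 0 n (T w) (S a)).
    rewrite -(segment_cat (T w) (S a) mn) opprB [RHS]addrC [RHS]addrAC addrK.
    by [].
  apply: le_trans (csB hp _ _) _; rewrite (csN hp) lerD//.
    apply: le_trans (cauchy_schwarz (segment_semi hE m n) Sp (sC (TD w)) (sC (SD a))) _.
    by rewrite ler_pM ?mod_seminorm_ge0// ?(segment_le hE)// hN.
have [w0|w0] := eqVneq (p w) 0; first by rewrite w0 ltW.
have {}w0 : 0 < p w by rewrite lt_neqAle eq_sym w0 (cs_ge0 hp).
rewrite -(ler_pM2r w0) -(csC hp); apply: le_trans ww _.
apply: (@le_trans _ _ (K * p w * (e / (K + 1)))).
  by rewrite ler_wpM2r ?(ltW d0)//; exact: mult_module_le.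
rewrite mulrAC ler_wpM2r ?(ltW w0)// mulrA ler_pdivrMr ?ltr_wpDl//.
by rewrite mulrC ler_wpM2l ?(ltW e0)// lerDl.
Qed.

End inner_product.

(** Strict seminorms also test adjoints. The adjoint of a partial sum for (T, S) is the partial sum
    for (S, T), so [strict_series_lim] applies to both halves. *)
Lemma strict_cvg_ip (T S : amb MD) : car MD T -> car MD S ->
  strict_cvg (series (fun k => @ip _ _ (ME k) (of_sum T k) (of_sum S k))) (@ip _ _ MD T S).
Proof.
move=> aT aS _ [p [a [x [Sp _ ->]]]]; have hp := SA_cs Sp; apply/cvgrPdist_le => e e0.
have e2 : 0 < e / 2 by rewrite divr_gt0.
have [n hn] := strict_series_lim aT aS a Sp e2.
have [n' hn'] := strict_series_lim aS aT x Sp e2.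
exists (maxn n n') => // m /=; rewrite geq_max => /andP[nm n'm].
rewrite sub0r normrN (self_mod_seminorm _ Sp) ger0_norm; last first.
  by rewrite addr_ge0 ?(cs_ge0 hp).
rewrite [e]splitr; apply: lerD; first exact: hn.
apply: le_trans (hn' m n'm).
set u := series _; set l := (X in _ - mulfun X).
have -> : adj A1 A1 (u m - l : A -> A) = (star (u m - l : M) : M) by [].
rewrite starB.
have -> : star l = @ip _ _ MD S T by exact: (ip_star (mult_module_pre_hilbert hDp)).
have -> : star (u m) = series (fun k => @ip _ _ (ME k) (of_sum S k) (of_sum T k)) m.
  rewrite /u seriesEnat (big_morph (@star R M) (@starD R M) (star_0 M)).
  apply: eq_bigr => k _; apply: (ip_star (mult_module_pre_hilbert (hEp k))).
    exact: of_sum_adjointable.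
  exact: of_sum_adjointable.
by [].
Qed.

(** If l is the strict sum of the t_k* t_k, then <t a, t a> = a* l a. This puts t a in D and bounds
    it by the root of the seminorm of l; with that bound the candidate for the adjoint converges. *)
Lemma to_sum_adjointable (t : amb SDS) : car SDS t -> car MD (to_sum t).
Proof.
move=> [tC [l hl]]; have ul := strict_cvg_lim hl.
have tlim a : seq_lim SA (fun n => sip 0 n (to_sum t a) (to_sum t a)) (star a ** l a).
  have := lim_amull (star a) (ul a); congr seq_lim; apply/funext => n.
  by rewrite strict_seriesE.
have TD a : car D (to_sum t a).
  split; first by move=> k; exact: (adjointable_car a (tC k)).
  by exists (star a ** l a); apply/cvg_seq_lim; exact: tlim.
have bound p a : SA p ->
    mod_seminorm D p (to_sum t a) <= Num.sqrt (mseminorm p l) * p a.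
  move=> Sp; have hp := SA_cs Sp; apply: le_of_sqr.
    by rewrite mulr_ge0 ?sqrtr_ge0 ?(cs_ge0 hp).
  rewrite (mod_seminorm_sqr Sp) mulrACA -[X in _ <= X * _]expr2 sqr_sqrtr; last first.
    exact: cs_ge0 (mseminorm_cstar Sp) _.
  have -> : @ip _ _ D (to_sum t a) (to_sum t a) = star a ** l a.
    exact: seq_lim_SA_unique (direct_sum_lim hE (TD a) (TD a)) (tlim a).
  rewrite mulrCA; apply: (csM_le hp); first by rewrite (cs_star hp).
  exact: mseminormP.
(* The adjoint sends x to the sum of the t_k* x_k. For a difference c of partial sums, c* c is a
   segment of <t c, x>, so p (c) is controlled by a tail of x. *)
pose v (x : V) n := \sum_(0 <= k < n) adj A1 (E k) (t k) (x k).
have vE x m n a : C x -> (m <= n)%N -> star a ** (v x n - v x m) = sip m n (to_sum t a) x.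
  move=> xC mn; have -> : v x n - v x m = \sum_(m <= k < n) adj A1 (E k) (t k) (x k).
    by rewrite /v (big_cat_nat (leq0n m) mn)/= addrAC subrr add0r.
  rewrite amul_sumr; apply: eq_bigr => k _.
  have [_ h] := adj_spec hA (tC k).
  by have /= <- := h a (x k) (I : car A1 a) (xC k).
have vlim x : exists l, car D x -> seq_lim SA (v x) l.
  have [xD|xD] := pselect (car D x); last by exists 0.
  have [xC xt] := (direct_sum_car hE x).1 xD.
  suff [l' hl'] : exists l', seq_lim SA (v x) l' by exists l'.
  apply: (ccf_complete (SA_complete A)) => p Sp e e0; have hp := SA_cs Sp.
  pose K := Num.sqrt (mseminorm p l); have K0 : 0 <= K by exact: sqrtr_ge0.
  have d0 : 0 < e / (K + 1) by rewrite divr_gt0// ltr_wpDl.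
  have [N hN] := xt p Sp _ d0; exists N => m Nm; set c := _ - _.
  have [c0|c0] := eqVneq (p c) 0; first by rewrite c0 ltW.
  have {}c0 : 0 < p c by rewrite lt_neqAle eq_sym c0 (cs_ge0 hp).
  rewrite -(ler_pM2r c0) -(csC hp) {2}/c vE//.
  apply: le_trans (cauchy_schwarz (segment_semi hE N m) Sp (sC (TD c)) xC) _.
  apply: (@le_trans _ _ (K * p c * (e / (K + 1)))).
    rewrite ler_pM ?mod_seminorm_ge0//; last exact: hN.
    by apply: le_trans (segment_le hE Sp Nm (TD c)) _; exact: bound.
  rewrite mulrAC ler_wpM2r ?(ltW c0)// mulrA ler_pdivrMr ?ltr_wpDl//.
  by rewrite mulrC ler_wpM2l ?(ltW e0)// lerDl.
have [S hS] := choice vlim.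
apply: (@adjointable_of _ _ A1 D (to_sum t) S) => //.
move=> a x _ xD; have [xC _] := (direct_sum_car hE x).1 xD.
apply: seq_lim_SA_unique (direct_sum_lim hE (TD a) xD) _.
have := lim_amull (star a) (hS x xD); congr seq_lim; apply/funext => n.
by rewrite -vE//; congr (_ ** _); rewrite /v [X in _ - X]big_geq// subr0.
Qed.

Lemma to_sum_car (t : amb SDS) : car SDS t <-> car MD (to_sum t).
Proof.
split; first exact: to_sum_adjointable.
move=> tD; split; first by move=> k; exact: (of_sum_adjointable k tD).
exists (@ip _ _ MD (to_sum t) (to_sum t)); exact: (strict_cvg_ip tD tD).
Qed.

Lemma strict_direct_sum_lim (t s : amb SDS) : car SDS t -> car SDS s ->
  strict_cvg (series (fun k => @ip _ _ (ME k) (t k) (s k))) (ip t s).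
Proof.
move=> tC sC'; have h := strict_cvg_ip (to_sum_adjointable tC) (to_sum_adjointable sC').
exact: (@xgetPex _ (0 : M)
  [set l : M | strict_cvg (series (fun k => @ip _ _ (ME k) (t k) (s k))) l]
  (ex_intro _ _ h)).
Qed.

Lemma to_sum_ip (t s : amb SDS) : car SDS t -> car SDS s ->
  @ip _ _ MD (to_sum t) (to_sum s) = ip t s.
Proof.
move=> tC sC'; apply: strict_cvg_unique (strict_direct_sum_lim tC sC').
exact: strict_cvg_ip (to_sum_adjointable tC) (to_sum_adjointable sC').
Qed.

End strict_direct_sum.

Theorem theorem3p9 (R : realType) (A : locCstarType R) (E : nat -> ipModule A)
    (hE : forall n, hilbert_module (E n)) :
  [/\ forall t s : amb (strict_direct_sum E),
        car (strict_direct_sum E) t -> car (strict_direct_sum E) s ->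
        strict_cvg
          (series (fun k => @ip R _ (multiplier_module (E k)) (t k) (s k)))
          (ip t s),
      hilbert_module (strict_direct_sum E)
    & unitarily_equivalent (strict_direct_sum E)
        (multiplier_module (direct_sum E))].
Proof.
have hM := multiplier_module_hilbert (direct_sum_hilbert hE).
(* Both maps exchange the two arguments, so they are inverse by conversion on the whole ambient
   spaces, not just on the carriers. *)
have UK : cancel (@to_sum R A E) (@of_sum R A E) by [].
have VK : cancel (@of_sum R A E) (@to_sum R A E) by [].
split.
- exact: strict_direct_sum_lim.
- exact: (transport_hilbert (U := @to_sum R A E) (V := @of_sum R A E) _ _ UK VK
    (to_sum_car hE) _ (to_sum_ip hE) hM).
- exact: (transport_unitary (U := @to_sum R A E) (V := @of_sum R A E) _ _ UK VK
    (to_sum_car hE) _ (to_sum_ip hE) hM).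
Qed.
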